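(* Let $\bm X^*_l$, $l\in\mathbb N$, be independent copies of a $d$-dimensional $[0,\infty)^d$-valued random vector $\bm X^*$ that is regularly varying with index $1$, normalized such that $\lim_{u\to\infty}a^*(u)\mathbb P(X_i^*>u)=1$ for $i=1,\dots,d$, and such that for every nonempty $I\subset\{1,\dots,d\}$ the matrix $\bm V_I=(\mathbb E[\Theta^I_i\Theta^I_j])_{i,j\in I}$ is conditionally positive definite, i.e. $\bm a^\top\bm V_I\bm a>0$ for all $\bm a\in\mathbb R^{|I|}\setminus\{\bm 0\}$ with $\sum_{i\in I}a_i=0$. Let $u_n\to\infty$ with $n/a^*(u_n)\to\infty$ and assume that for $p=0,1,2$ and every nonempty $J\subset\{1,\dots,d\}$, $$\sup_{\bm v\in\partial B_1^+(\bm 0)}\sqrt{\frac{n}{a^*(u_n)}}\,\Big|a^*(u_n)\,\mathbb E[\widehat M_{n,u_n,J}(\bm v_J,p)]-\tau_J\,\mathbb E[(\bm v_J^\top\bm\Theta^J)^p]\Big|\to0,\qquad n\to\infty.$$ Then, for every nonempty $I\subset\{1,\dots,d\}$, the plug-in estimator $\frac1{\widehat\tau^{MK}_{I,n}}=\frac{\widehat M_{n,u_n,I}(\widehat{\bm v}^*_{n,u_n,I},1)}{\widehat P_{n,u_n,I}}$ satisfies $$\sqrt{\frac{n}{a^*(u_n)}}\left(\frac1{\widehat\tau^{MK}_{I,n}}-\frac1{\tau_I}\right)\stackrel{d}{\longrightarrow}\mathcal N\left(0,\ \tau_I^{-1}\,\mathrm{Var}({\bm v_I^*}^\top\bm\T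heta^I)\right).$$
   Context: $\|\cdot\|$ is the maximum norm on $\mathbb R^d$. Regular variation with index 1 of $\bm X^*$: there are $a^*:(0,\infty)\to(0,\infty)$ and a nonzero measure $\mu^*$ on $[0,\infty)^d\setminus\{\bm 0\}$, finite on sets bounded away from $\bm 0$ and homogeneous of order $-1$, with $a^*(u)\mathbb P(u^{-1}\bm X^*\in\cdot)\to\mu^*$ vaguely as $u\to\infty$ (tested against bounded continuous functions with support bounded away from $\bm 0$). $\tau=\mu^*(\{\|\bm x\|>1\})$. The spectral vector $\bm\Theta\in[0,\infty)^d$ satisfies $\|\bm\Theta\|=1$ a.s. and $\mu^*(\{\|\bm x\|>r,\bm x/\|\bm x\|\in B\})=\tau r^{-1}\mathbb P(\bm\Theta\in B)$. For nonempty $I\subset\{1,\dots,d\}$: $\ell_I(\bm x)=\max_{i\in I}x_i$; $\tau_I=\mu^*(\{\ell_I(\bm x)>1\})=\lim_{u\to\infty}a^*(u)\mathbb P(\ell_I(\bm X^* )>u)=\tau\,\mathbb E[\ell_I(\bm\Theta)]$ (the extremal coefficient); $\bm\Theta^I$ is a random vector with law $$\mathbb P(\bm\Theta^I\in A)=\frac1{\mathbb E[\ell_I(\bm\Theta)]}\mathbb E\big[\mathbf 1\{\bm\Theta/\ell_I(\bm\Theta)\in A\}\,\ell_I(\bm\Theta)\big].$$ $\partial B_1^+(\bm 0)=\{\bm v\in[0,\infty)^d:\sum_iv_i=1\}$; $\bm v_I$ has components $v_i$ for $i\in I$ and $0$ otherwise; write $\Delta_I=\{\bm v\in\partial B_1^+(\bm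 0): v_i=0\text{ for }i\notin I\}$. $\widehat M_{n,u,I}(\bm v,p)=\frac1n\sum_{l=1}^n\big(\bm v^\top\bm X_l^*/\ell_I(\bm X_l^* )\big)^p\mathbf 1\{\ell_I(\bm X^*_l)>u\}$ and $\widehat P_{n,u,I}=\frac1n\sum_{l=1}^n\mathbf 1\{\ell_I(\bm X_l^* )>u\}$ ($0^0=1$; ratio $0/0:=0$). $\bm v_I^*$ is the unique minimizer over $\Delta_I$ of $f^{(I)}(\bm v)=\mathbb E[(\bm v^\top\bm\Theta^I)^2]$ (unique by conditional positive definiteness of $\bm V_I$). $\widehat{\bm v}^*_{n,u,I}$ is an arbitrary minimizer over $\bm v\in\Delta_I$ of $\widehat M_{n,u,I}(\bm v,2)/\widehat P_{n,u,I}$ (an arbitrary element of $\Delta_I$ if $\widehat P_{n,u,I}=0$). *)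

(* Defs.v *)
From HB Require Import structures.
From mathcomp Require Import all_boot all_order all_algebra.
From mathcomp Require Import all_classical all_reals all_analysis.

Set Implicit Arguments.
Unset Strict Implicit.
Unset Printing Implicit Defensive.

Import Order.TTheory GRing.Theory Num.Theory.
Import numFieldNormedType.Exports.

Local Open Scope classical_set_scope.
Local Open Scope ring_scope.

(* Vectors of R^d are row vectors 'rV[R]_d: the library norm `|x| on them is the
   maximum norm.  They carry the Borel sigma-algebra of that norm topology. *)
HB.instance Definition _ (R : realType) (m n : nat) :=
  @isMeasurable.Build (sigma_display (@open 'M[R]_(m, n))) 'M[R]_(m, n)
    <<s @open 'M[R]_(m, n) >>
    (@sigma_algebra0 _ setT _) (@sigma_algebraC _ _)
    (@sigma_algebra_bigcup _ setT _).

Section vectors.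
Context {R : realType} {d : nat}.
Implicit Types (x v : 'rV[R]_d) (I : {set 'I_d}).

Definition orthant : set 'rV[R]_d := [set x | forall i, 0 <= x 0 i].

Definition punctured_orthant : set 'rV[R]_d := orthant `\ 0.

(* The base point 0 of the iterated maximum is harmless: I is nonempty and x is
   in the orthant wherever this is used. *)
Definition ell I x : R := \big[Num.max/0]_(i in I) x 0 i.

Definition dotv v x : R := \sum_i v 0 i * x 0 i.

Definition restrv I v : 'rV[R]_d := \row_i (if i \in I then v 0 i else 0).

Definition simplex : set 'rV[R]_d := [set v | orthant v /\ \sum_i v 0 i = 1].

Definition face I : set 'rV[R]_d :=
  [set v | simplex v /\ forall i, i \notin I -> v 0 i = 0].

End vectors.

Definition is_minimizer {R : realType} {V : Type} (D : set V) (f : V -> \bar R)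
    (v : V) : Prop :=
  D v /\ forall w, D w -> (f v <= f w)%E.

Section probability_notions.
Context {d0 : measure_display} {T : measurableType d0} {R : realType}.
Variable P : probability T R.

Definition identically_distributed {d1 : measure_display}
    {E : measurableType d1} (X Y : T -> E) : Prop :=
  forall A : set E, measurable A -> P (X @^-1` A) = P (Y @^-1` A).

Definition mutually_independent {d1 : measure_display} {E : measurableType d1}
    (X : nat -> T -> E) : Prop :=
  forall (s : seq nat) (A : nat -> set E), uniq s ->
    (forall l, measurable (A l)) ->
    P (\bigcap_(l in [set` s]) (X l @^-1` A l)) =
    (\prod_(l <- s) fine (P (X l @^-1` A l)))%:E.

(* Measurability of the Y n is part of the notion, since they enter as plain
   functions. *)
Definition cvg_in_distribution (Y : nat -> T -> R)
    (nu : probability (measurableTypeR R) R) : Prop :=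
  (forall n, measurable_fun setT (Y n)) /\
  forall f : R -> R, continuous f -> (exists M, forall x, `|f x| <= M) ->
    'E_P[f \o Y n]%E @[n --> \oo] --> (\int[nu]_x (f x)%:E)%E.

End probability_notions.

(* N(m, v) is parametrized by its variance v.  For v = 0 it is the Dirac mass at
   m, whereas the library's normal_prob m 0 is the uniform law on [0, 1]. *)
Definition gaussian {R : realType} (m v : R) :
    probability (measurableTypeR R) R :=
  if v == 0 then [the probability (measurableTypeR R) R of @dirac _ (measurableTypeR R) m R]
  else [the probability (measurableTypeR R) R of normal_prob m (Num.sqrt v)].

Definition cond_pos_def {R : realType} {k : nat} (V : 'M[R]_k) : Prop :=
  forall a : 'cV[R]_k, a != 0 -> \sum_i a i 0 = 0 -> 0 < (a^T *m V *m a) 0 0.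

Section regular_variation.
Context {d0 : measure_display} {T : measurableType d0} {R : realType} {d : nat}.

(* Regular variation with index 1 and limit measure mu, seen as a Borel measure
   on R^d carried by [0, oo)^d \ {0}. *)
Record regularly_varying (P : probability T R) (X : T -> 'rV[R]_d) (a : R -> R)
    (mu : {measure set 'rV[R]_d -> \bar R}) : Prop := {
  rv_pos : forall u, 0 < u -> 0 < a u;
  rv_carried : mu (~` punctured_orthant) = 0%E;
  rv_nonzero : mu setT != 0%E;
  rv_finite : forall A : set 'rV[R]_d, measurable A ->
    (exists2 e, 0 < e & forall x, A x -> e <= `|x|) -> (mu A < +oo)%E;
  rv_homogeneous : forall (c : R) (A : set 'rV[R]_d), 0 < c -> measurable A ->
    mu [set c *: x | x in A] = (c^-1%:E * mu A)%E;
  rv_vague : forall f : 'rV[R]_d -> R,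
    {within punctured_orthant, continuous f} ->
    (exists M, forall x, punctured_orthant x -> `|f x| <= M) ->
    (exists2 e, 0 < e &
       forall x, punctured_orthant x -> `|x| < e -> f x = 0) ->
    ((a u)%:E * \int[P]_(w in [set w | punctured_orthant (u^-1 *: X w)])
                  (f (u^-1 *: X w))%:E)%E @[u --> +oo]
    --> (\int[mu]_(x in punctured_orthant) (f x)%:E)%E
}.

Definition tau (mu : set 'rV[R]_d -> \bar R) : R :=
  fine (mu [set x | 1 < `|x|]).

Definition tauI (mu : set 'rV[R]_d -> \bar R) (I : {set 'I_d}) : R :=
  fine (mu [set x | 1 < ell I x]).

Record spectral_vector (mu : {measure set 'rV[R]_d -> \bar R})
    (Q : probability T R) (Theta : T -> 'rV[R]_d) : Prop := {
  sv_orthant : forall w, orthant (Theta w);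
  sv_norm : {ae Q, forall w, `|Theta w| = 1};
  sv_polar : forall (r : R) (B : set 'rV[R]_d), 0 < r -> measurable B ->
    mu [set x | r < `|x| /\ B (`|x|^-1 *: x)] =
    ((tau mu * r^-1)%:E * Q (Theta @^-1` B))%E
}.

(* ThetaI has the law of Theta / ell I Theta under the change of measure with
   density proportional to ell I Theta. *)
Definition tilted_law (Q : probability T R) (I : {set 'I_d})
    (Theta ThetaI : T -> 'rV[R]_d) : Prop :=
  forall A : set 'rV[R]_d, measurable A ->
    Q (ThetaI @^-1` A) =
    ((fine 'E_Q[ell I \o Theta])^-1%:E *
     'E_Q[(fun w => \1_A ((ell I (Theta w))^-1 *: Theta w)
                    * ell I (Theta w))%R])%E.

Definition VI (Q : probability T R) (I : {set 'I_d})
    (ThetaI : T -> 'rV[R]_d) : 'M[R]_#|I| :=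
  \matrix_(i, j)
    fine 'E_Q[(fun w => ThetaI w 0 (enum_val i)
                        * ThetaI w 0 (enum_val j))%R]%E.

End regular_variation.

Section estimators.
Context {T : Type} {R : realType} {d : nat}.
Variable X : nat -> T -> 'rV[R]_d.

(* The sample X_1, ..., X_n is X 0, ..., X n.-1.  The conventions 0 ^+ 0 = 1 and
   x / 0 = 0 are those of the library. *)
Definition Mhat (n : nat) (u : R) (I : {set 'I_d}) (v : 'rV[R]_d) (p : nat)
    (w : T) : R :=
  n%:R^-1 * \sum_(l < n) (dotv v (X l w) / ell I (X l w)) ^+ p
                         * (u < ell I (X l w))%R%:R.

Definition Phat (n : nat) (u : R) (I : {set 'I_d}) (w : T) : R :=
  n%:R^-1 * \sum_(l < n) (u < ell I (X l w))%R%:R.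

(* When Phat vanishes the objective is identically 0, so that any element of
   face I is allowed. *)
Definition is_vhat (n : nat) (u : R) (I : {set 'I_d}) (w : T)
    (v : 'rV[R]_d) : Prop :=
  is_minimizer (face I) (fun v => (Mhat n u I v 2 w / Phat n u I w)%:E) v.

Definition inv_tauMK (n : nat) (u : R) (I : {set 'I_d})
    (vhat : T -> 'rV[R]_d) (w : T) : R :=
  Mhat n u I (vhat w) 1 w / Phat n u I w.

End estimators.

(* Main.v *)
Require Import Defs.
From HB Require Import structures.
From mathcomp Require Import all_boot all_order all_algebra.
From mathcomp Require Import all_classical all_reals all_analysis.
From mathcomp Require Import measurable_realfun.
From mathcomp Require Import ring lra.

(** The estimation error is, up to a vanishing term, a normalized sum of
    independent variables. Write [k = n / a (u n)], [y_i = x_i / ell_I x] and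
    [W_i = k^(-1/2) * sum_l (y_i (X_l) - 1 / tau_I) * 1{ell_I (X_l) > u n}]. The
    first empirical moment is linear in the weights and the weights of a face sum
    to one, so the normalized error equals [sum_i v_i W_i / m] as soon as there is
    an exceedance, where [v] is the random minimizer and [m] is [a (u n)] times the empirical exceedance
    frequency (lemma [estimator_linear]).

    The fluctuations [W_i] stay bounded in mean square. This rests on the fact
    that [E (v . Theta^I) = 1 / tau_I] for every direction [v] of the face: the
    change of measure that defines [Theta^I] divides [E Theta_i] by
    [E ell_I(Theta)], and the normalization of the margins makes [tau E Theta_i]
    equal to one (lemmas [tauIE], [tilted_mean] and [clipped_mean]). By the bias
    condition the drift of each [W_i] then vanishes.

    The empirical second moments obey a weak law of large numbers ([tail_wlln]).
    The limiting quadratic form grows quadratically around its minimizer over the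
    face and is positive definite on directions of total mass zero, so that the
    random minimizer tends to [vstar] in probability ([vhat_close], [coercive]).
    The error made on the weights multiplies the bounded [W_i], so that any vanishing
    error is negligible. Hence the estimation error behaves like [sum_i vstar_i W_i / tau_I], a sum of small independent variables, to
    which a central limit theorem for triangular arrays applies
    ([iid_array_clt]).

    That central limit theorem is obtained by replacing, one variable at a time,
    the factors of [E cos (t S_n + b)] by those of a Gaussian transform
    ([cos_iid_sum_le]); convergence of these trigonometric expectations gives
    convergence of the expectations of test functions by smoothing with a small
    Gaussian ([cvg_cos_cvg_test]). A phase [b] in the cosine replaces complex
    exponentials. Finally the error is a measurable function of the sample, even
    though the minimizer may be chosen non-measurably: all minimizers have the
    same first empirical moment ([measurable_inv_tauMK]). *)

Set Implicit Arguments.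
Unset Strict Implicit.
Unset Printing Implicit Defensive.

Import Order.TTheory GRing.Theory Num.Theory.
Import numFieldNormedType.Exports.

Local Open Scope classical_set_scope.
Local Open Scope ring_scope.

Local Notation Ex P f := (Rintegral P setT f).

(** * Bounded measurable functions and their expectations *)

(** Such functions are integrable for every probability, and the class is stable
    under the algebraic operations: expectations can be computed with in the field
    of reals, without integrability side conditions. *)
Record bmf d (T : measurableType d) (R : realType) (f : T -> R) : Prop := Bmf {
  bmf_measurable : measurable_fun setT f ;
  bmf_bounded : exists M, forall x, `|f x| <= M }.

Section bmf_closure.
Context d (T : measurableType d) (R : realType).
Implicit Types f g : T -> R.

Lemma bmf_cst (c : R) : bmf (fun _ : T => c).
Proof. by split; [exact: measurable_cst | exists `|c|]. Qed.

Lemma bmf_ext f g : f =1 g -> bmf f -> bmf g.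
Proof. by move=> /funext ->. Qed.

Lemma bmfD f g : bmf f -> bmf g -> bmf (fun x => f x + g x).
Proof.
move=> [mf [M hM]] [mg [N hN]]; split; first exact: measurable_funD.
by exists (M + N) => x; rewrite (le_trans (ler_normD _ _))// lerD.
Qed.

Lemma bmfM f g : bmf f -> bmf g -> bmf (fun x => f x * g x).
Proof.
move=> [mf [M hM]] [mg [N hN]]; split; first exact: measurable_funM.
by exists (M * N) => x; rewrite normrM ler_pM.
Qed.

Lemma bmfZ c f : bmf f -> bmf (fun x => c * f x).
Proof. by move=> bf; apply: bmfM => //; exact: bmf_cst. Qed.

Lemma bmfN f : bmf f -> bmf (fun x => - f x).
Proof. by move=> /(bmfZ (-1)); apply: bmf_ext => x; rewrite mulN1r. Qed.

Lemma bmfB f g : bmf f -> bmf g -> bmf (fun x => f x - g x).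
Proof. by move=> bf /bmfN; exact: bmfD. Qed.

Lemma bmfX f n : bmf f -> bmf (fun x => f x ^+ n).
Proof.
move=> bf; elim: n => [|n IH]; first exact: (@bmf_cst 1).
by apply: bmf_ext (bmfM bf IH) => x; rewrite exprS.
Qed.

Lemma bmf_sum (I : Type) (r : seq I) (Q : pred I) (F : I -> T -> R) :
  (forall i, bmf (F i)) -> bmf (fun x => \sum_(i <- r | Q i) F i x).
Proof.
move=> bF; elim: r => [|i r IH].
  by apply: bmf_ext (bmf_cst 0) => x; rewrite big_nil.
case Qi: (Q i).
  by apply: bmf_ext (bmfD (bF i) IH) => x; rewrite big_cons Qi.
by apply: bmf_ext IH => x; rewrite big_cons Qi.
Qed.

Lemma bmf_sum_cond (I : finType) (Q : pred I) (F : I -> T -> R) :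
  (forall i, Q i -> bmf (F i)) -> bmf (fun x => \sum_(i | Q i) F i x).
Proof.
move=> bF; under eq_fun do rewrite big_mkcond.
by apply: bmf_sum => i; case: (boolP (Q i)) => [Qi|_]; [exact: bF|exact: bmf_cst].
Qed.

Lemma bmf_prod (I : Type) (r : seq I) (Q : pred I) (F : I -> T -> R) :
  (forall i, bmf (F i)) -> bmf (fun x => \prod_(i <- r | Q i) F i x).
Proof.
move=> bF; elim: r => [|i r IH].
  by apply: bmf_ext (bmf_cst 1) => x; rewrite big_nil.
case Qi: (Q i).
  by apply: bmf_ext (bmfM (bF i) IH) => x; rewrite big_cons Qi.
by apply: bmf_ext IH => x; rewrite big_cons Qi.
Qed.

Lemma bmf_norm f : bmf f -> bmf (fun x => `|f x|).
Proof.
move=> [mf [M hM]]; split; first exact: measurableT_comp.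
by exists M => x; rewrite normr_id.
Qed.

Lemma bmf_indic (A : set T) : measurable A -> bmf (\1_A : T -> R).
Proof.
move=> mA; split; first exact: measurable_indic.
by exists 1 => x; rewrite indicE; case: (_ \in _); rewrite ?normr1 ?normr0.
Qed.

End bmf_closure.

Lemma bmf_comp d (T : measurableType d) d' (U : measurableType d')
    (R : realType) (f : U -> R) (X : T -> U) :
  bmf f -> measurable_fun setT X -> bmf (fun w => f (X w)).
Proof.
move=> [mf [M hM]] mX; split; first exact: measurableT_comp.
by exists M => x.
Qed.

Section bounded_expectation.
Context d (T : measurableType d) (R : realType).
Variable P : probability T R.
Implicit Types f g : T -> R.

Lemma bmf_integrable f : bmf f -> P.-integrable setT (EFin \o f).
Proof.
move=> [mf [M hM]]; apply: (@le_integrable _ _ _ P setT _ _ (cst M%:E)) => //.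
- exact/measurable_EFinP.
- by move=> x _ /=; rewrite lee_fin (le_trans (hM x))// ler_norm.
- exact: finite_measure_integrable_cst.
Qed.

Lemma bmf_expectation f : bmf f -> 'E_P[f]%E = (Ex P f)%:E.
Proof.
move=> bf; rewrite unlock /Rintegral fineK//.
exact: (integrable_fin_num _ (bmf_integrable bf)).
Qed.

Lemma Ex_cst c : Ex P (fun=> c) = c.
Proof. by rewrite Rintegral_cst//= (probability_setT P) mulr1. Qed.

Lemma ExD f g : bmf f -> bmf g ->
  Ex P (fun x => f x + g x) = Ex P f + Ex P g.
Proof. by move=> bf bg; rewrite RintegralD//; exact: bmf_integrable. Qed.

Lemma ExB f g : bmf f -> bmf g ->
  Ex P (fun x => f x - g x) = Ex P f - Ex P g.
Proof. by move=> bf bg; rewrite RintegralB//; exact: bmf_integrable. Qed.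

Lemma ExZ c f : bmf f -> Ex P (fun x => c * f x) = c * Ex P f.
Proof. by move=> bf; rewrite RintegralZl//; exact: bmf_integrable. Qed.

Lemma Ex_sum (I : Type) (r : seq I) (Q : pred I) (F : I -> T -> R) :
  (forall i, bmf (F i)) ->
  Ex P (fun x => \sum_(i <- r | Q i) F i x) = \sum_(i <- r | Q i) Ex P (F i).
Proof.
move=> bF; elim: r => [|i r IH].
  rewrite big_nil -[RHS](Ex_cst 0); congr (Rintegral _ _ _).
  by apply/funext => x; rewrite big_nil.
rewrite big_cons; case Qi: (Q i).
  rewrite -IH -ExD//; last exact: bmf_sum.
  by congr (Rintegral _ _ _); apply/funext => x; rewrite big_cons Qi.
by rewrite -IH; congr (Rintegral _ _ _); apply/funext => x; rewrite big_cons Qi.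
Qed.

Lemma Ex_sum_cond (I : finType) (Q : pred I) (F : I -> T -> R) :
  (forall i, Q i -> bmf (F i)) ->
  Ex P (fun x => \sum_(i | Q i) F i x) = \sum_(i | Q i) Ex P (F i).
Proof.
move=> bF; under eq_Rintegral do rewrite big_mkcond.
rewrite Ex_sum.
  rewrite [RHS]big_mkcond; apply: eq_bigr => i _.
  by case: (boolP (Q i)) => // _; exact: Ex_cst.
by move=> i; case: (boolP (Q i)) => [Qi|_]; [exact: bF|exact: bmf_cst].
Qed.

Lemma Ex_le f g : bmf f -> bmf g -> (forall x, f x <= g x) ->
  Ex P f <= Ex P g.
Proof. by move=> bf bg fg; apply: le_Rintegral => //; exact: bmf_integrable. Qed.

Lemma Ex_ge0 f : (forall x, 0 <= f x) -> 0 <= Ex P f.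
Proof. by move=> f0; exact: Rintegral_ge0. Qed.

Lemma Ex_norm_le f : bmf f -> `|Ex P f| <= Ex P (fun x => `|f x|).
Proof. by move=> bf; apply: le_normr_Rintegral => //; exact: bmf_integrable. Qed.

Lemma Ex_normB f g h : bmf f -> bmf g -> bmf h ->
  (forall x, `|f x - g x| <= h x) -> `|Ex P f - Ex P g| <= Ex P h.
Proof.
move=> bf bg bh fgh; rewrite -ExB// (le_trans (Ex_norm_le (bmfB bf bg)))//.
by apply: Ex_le => //; exact/bmf_norm/bmfB.
Qed.

Lemma Ex_norm_bound f c : bmf f -> (forall x, `|f x| <= c) -> `|Ex P f| <= c.
Proof.
move=> bf hf; rewrite -(Ex_cst c) (le_trans (Ex_norm_le bf))//.
by apply: Ex_le => //; [exact: bmf_norm|exact: bmf_cst].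
Qed.

Lemma Ex_indic (A : set T) : measurable A -> Ex P (\1_A) = fine (P A).
Proof. by move=> mA; rewrite /Rintegral integral_indic// setIT. Qed.

End bounded_expectation.

(** * Functionals determined by their values on indicators *)

(** The sum counts the levels [j / m] reached by [x]: it is the integer part of
    [m x]. *)
Lemma layer_cake_discrete (R : realType) (x : R) (m : nat) : (0 < m)%N ->
  0 <= x <= 1 ->
  `|x - m%:R^-1 * \sum_(j < m) (j.+1%:R <= m%:R * x)%R%:R| <= m%:R^-1.
Proof.
move=> m0 /andP[x0 x1].
have m0' : 0 < m%:R :> R by rewrite ltr0n.
have mx0 : 0 <= m%:R * x by rewrite mulr_ge0.
set t := Num.truncn (m%:R * x).
have /andP[t1 t2] := truncn_itv mx0; rewrite -/t in t1 t2.
have tm : (t <= m)%N.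
  by rewrite -(ler_nat R) (le_trans t1)// ler_piMr// ltW.
have -> : \sum_(j < m) (j.+1%:R <= m%:R * x)%R%:R = t%:R :> R.
  rewrite (eq_bigr (fun j : 'I_m => ((j < t)%N%:R : R))); last first.
    move=> j _; congr (_%:R); congr (nat_of_bool _).
    apply/idP/idP => [h|h].
      by rewrite -ltnS -(ltr_nat R) (le_lt_trans h).
    by rewrite (le_trans _ t1)// ler_nat.
  rewrite -natr_sum; congr (_%:R).
  rewrite -(big_mkord xpredT (fun j => nat_of_bool (j < t)%N)).
  rewrite (big_cat_nat _ tm)//= big_nat (eq_bigr (fun=> 1%N)); last first.
    by move=> j /andP[_ ->].
  rewrite -big_nat sum_nat_const_nat subn0 muln1 big_nat big1 ?addn0//.
  by move=> j /andP[tj _]; rewrite ltnNge tj.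
have -> : x - m%:R^-1 * t%:R = m%:R^-1 * (m%:R * x - t%:R).
  by rewrite mulrBr mulKf// gt_eqF.
rewrite normrM gtr0_norm ?invr_gt0// ler_piMr ?invr_ge0//.
rewrite ger0_norm ?subr_ge0// lerBlDl.
by rewrite (le_trans (ltW t2))// -natr1.
Qed.

(** Continuity for the uniform norm is all that the approximation by
    combinations of indicators requires. *)
Definition bounded_linear d (U : measurableType d) (R : realType)
    (L : (U -> R) -> R) : Prop :=
  [/\ forall f g, bmf f -> bmf g -> L (fun x => f x + g x) = L f + L g,
      forall c f, bmf f -> L (fun x => c * f x) = c * L f &
      exists2 C, 0 <= C &
        forall f e, bmf f -> (forall x, `|f x| <= e) -> `|L f| <= C * e].

Section bounded_linear_ext.
Context d (U : measurableType d) (R : realType).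

Let bounded_linear_sum (L : (U -> R) -> R) (I : Type) (r : seq I)
    (F : I -> U -> R) : bounded_linear L ->
  (forall i, bmf (F i)) ->
  L (fun x => \sum_(i <- r) F i x) = \sum_(i <- r) L (F i).
Proof.
move=> [LD LZ _] bF; elim: r => [|i r IH].
  rewrite big_nil (_ : (fun _ => _) = (fun x : U => 0 * (0 : R))).
    by rewrite LZ ?mul0r//; exact: bmf_cst.
  by apply/funext => x; rewrite big_nil mul0r.
rewrite big_cons -IH -LD//; last exact: bmf_sum.
by congr (L _); apply/funext => x; rewrite big_cons.
Qed.

(** The values on indicators determine the functional because a function with
    values in [0, 1] is a uniform limit of averages of its level indicators. *)
Lemma bounded_linear_ext (L1 L2 : (U -> R) -> R) :
  bounded_linear L1 -> bounded_linear L2 ->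
  (forall A, measurable A -> L1 \1_A = L2 \1_A) ->
  forall f, bmf f -> L1 f = L2 f.
Proof.
move=> bL1 bL2 L12.
have L12c c : L1 (fun=> c) = L2 (fun=> c).
  have [_ Z1 _] := bL1; have [_ Z2 _] := bL2.
  have -> : (fun=> c) = (fun x => c * (\1_(@setT U) x : R)).
    by apply/funext => x; rewrite indicE in_setT mulr1.
  rewrite Z1 ?Z2 ?L12//; exact: bmf_indic.
have H01 f : bmf f -> (forall x, 0 <= f x <= 1) -> L1 f = L2 f.
  move=> bf f01; apply/eqP; rewrite -subr_eq0; apply/eqP.
  pose S (m : nat) x : R := m%:R^-1 * \sum_(j < m) (j.+1%:R <= m%:R * f x)%R%:R.
  pose A (m : nat) (j : 'I_m) : set U := [set x | j.+1%:R <= m%:R * f x].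
  have mA m j : measurable (@A m j).
    rewrite -[X in measurable X]setTI.
    apply: (measurable_fun_le (f := cst _)) => //.
    exact: (bmf_measurable (bmfZ _ bf)).
  have SE m : S m = fun x => m%:R^-1 * \sum_(j < m) \1_(@A m j) x.
    apply/funext => x; congr (_ * _); apply: eq_bigr => j _.
    rewrite indicE; congr (nat_of_bool _)%:R.
    by apply/idP/idP => h; [rewrite inE|rewrite inE in h].
  have bS m : bmf (S m).
    rewrite SE; apply/bmfZ/bmf_sum => j; exact: bmf_indic.
  have L12S m : L1 (S m) = L2 (S m).
    rewrite SE; have [_ Z1 _] := bL1; have [_ Z2 _] := bL2.
    have bI j : bmf (\1_(@A m j) : U -> R) by exact: bmf_indic.
    rewrite Z1 ?Z2; try exact: bmf_sum.
    rewrite !bounded_linear_sum//.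
    by congr (_ * _); apply: eq_bigr => j _; rewrite L12.
  have [D1 Z1 [C1 C10 B1]] := bL1; have [D2 Z2 [C2 C20 B2]] := bL2.
  have LB L (DL : forall f g, bmf f -> bmf g -> L (fun x => f x + g x) = L f + L g)
     (ZL : forall c f, bmf f -> L (fun x => c * f x) = c * L f) m :
     L (fun x => f x - S m x) = L f - L (S m).
    rewrite (_ : (fun x => f x - S m x) = (fun x => f x + (-1) * S m x)).
      by rewrite (DL _ _ bf (bmfZ (-1) (bS m))) (ZL _ _ (bS m)) mulN1r.
    by apply/funext => x; rewrite mulN1r.
  have main m : (0 < m)%N -> `|L1 f - L2 f| <= (C1 + C2) * m%:R^-1.
    move=> m0; have bd x : `|f x - S m x| <= m%:R^-1 by exact: layer_cake_discrete.
    have bfS := bmfB bf (bS m).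
    rewrite (_ : L1 f - L2 f = (L1 f - L1 (S m)) - (L2 f - L2 (S m))); last first.
      by rewrite L12S; ring.
    rewrite -!LB// (le_trans (ler_normB _ _))// mulrDl lerD//; [exact: B1|exact: B2].
  apply/normr0_eq0/eqP; rewrite eq_le normr_ge0 andbT.
  apply/ler_addgt0Pr => e e0; rewrite add0r.
  have C0 : 0 <= C1 + C2 by exact: addr_ge0.
  have [n hn] : exists n : nat, (C1 + C2) / e < n%:R.
    exists (Num.truncn ((C1 + C2) / e)).+1.
    by have /andP[] := truncn_itv (divr_ge0 C0 (ltW e0)).
  have n0 : 0 < n%:R :> R by apply: le_lt_trans hn; rewrite divr_ge0// ltW.
  apply: (le_trans (main n _)); first by rewrite -(ltr_nat R).
  by rewrite ler_pdivrMr// mulrC -ler_pdivrMr// ltW.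
move=> f bf; have [mf [M0 hM0]] := bf.
pose M := `|M0| + 1; have M0' : 0 < M by rewrite ltr_wpDl.
have hM x : `|f x| <= M by rewrite (le_trans (hM0 x))// (le_trans (ler_norm _))// lerDl.
pose g x := (M *+ 2)^-1 * (f x + M).
have bg : bmf g by apply: bmfZ; apply: bmfD => //; exact: bmf_cst.
have M20 : 0 < M *+ 2 by rewrite pmulrn_lgt0.
have fE : f = fun x => (M *+ 2) * g x + (- M).
  by apply/funext => x; rewrite /g mulrA mulfV ?mul1r ?addrK// gt_eqF.
have LE L : bounded_linear L -> L f = (M *+ 2) * L g + L (fun=> - M).
  move=> [D Z _]; rewrite [in LHS]fE (D _ _ (bmfZ (M *+ 2) bg) (bmf_cst _ _)).
  by rewrite Z.
rewrite !LE// L12c H01// => x; have := hM x; rewrite ler_norml => /andP[h1 h2].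
rewrite /g mulr_ge0 ?invr_ge0 ?(ltW M20)//=; last by lra.
by rewrite mulrC ler_pdivrMr// mul1r mulr2n; lra.
Qed.

End bounded_linear_ext.

Lemma Ex_bounded_linear d (U : measurableType d) d' (T : measurableType d')
    (R : realType) (P : probability T R) (X : T -> U) (g : T -> R) :
  measurable_fun setT X -> bmf g ->
  bounded_linear (fun f : U -> R => Ex P (fun w => f (X w) * g w)).
Proof.
move=> mX bg; split.
- move=> f1 f2 b1 b2; rewrite -ExD; last 2 first.
  + exact/bmfM/bg/bmf_comp/mX.
  + exact/bmfM/bg/bmf_comp/mX.
  by congr (Rintegral _ _ _); apply/funext => w; rewrite mulrDl.
- move=> c f bf; rewrite -ExZ; last exact/bmfM/bg/bmf_comp/mX.
  by congr (Rintegral _ _ _); apply/funext => w; rewrite mulrA.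
- have [mg [M hM]] := bg; exists `|M| => // f e bf fe.
  apply: Ex_norm_bound; first exact/bmfM/bg/bmf_comp/mX.
  move=> w; rewrite normrM mulrC ler_pM//.
  by rewrite (le_trans (hM w))// ler_norm.
Qed.

Lemma bounded_linearZ d (U : measurableType d) (R : realType) (c : R)
    (L : (U -> R) -> R) :
  bounded_linear L -> bounded_linear (fun f => c * L f).
Proof.
move=> [LD LZ [C C0 LC]]; split.
- by move=> f g bf bg; rewrite LD// mulrDr.
- by move=> k f bf; rewrite LZ// mulrCA.
- exists (`|c| * C); first by rewrite mulr_ge0.
  by move=> f e bf fe; rewrite normrM -mulrA ler_wpM2l// LC.
Qed.

(** * Trigonometric estimates *)
Section taylor.
Variable R : realType.
Implicit Types x y : R.

Let mvt0 (f df : R -> R) x : 0 <= x ->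
  (forall z, is_derive z (1 : R) f (df z)) ->
  exists2 z, 0 <= z <= x & f x - f 0 = df z * x.
Proof.
move=> x0 fdf.
have cf : {within `[0, x], continuous f}.
  by apply: derivable_within_continuous => z _; have [] := fdf z.
have [z zx fE] := @MVT_segment R f df 0 x x0 (fun z _ => fdf z) cf.
by exists z; [move: zx; rewrite in_itv|rewrite fE subr0].
Qed.

Lemma norm_sin_le x : `|sin x| <= `|x|.
Proof.
wlog x0 : x / 0 <= x.
  move=> H; have [|/ltW x0] := leP 0 x; first exact: H.
  by rewrite -(normrN x) -(normrN (sin x)) -sinN H// oppr_ge0.
have [z _] := mvt0 x0 (@is_derive_sin R).
rewrite sin0 subr0 => ->; rewrite normrM ler_piMl//.
exact: cos_max.
Qed.

Lemma one_sub_cos_le x : `|1 - cos x| <= x ^+ 2 / 2.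
Proof.
have -> : 1 - cos x = 2 * sin (x / 2) ^+ 2.
  have {1}-> : x = (x / 2) *+ 2 by rewrite -mulr_natr divfK// pnatr_eq0.
  by rewrite cos_mulr2n cos2sin2; ring.
have h : sin (x / 2) ^+ 2 <= (x / 2) ^+ 2.
  rewrite -[leLHS]real_normK ?num_real// -[leRHS]real_normK ?num_real//.
  by rewrite lerXn2r ?nnegrE ?norm_sin_le.
rewrite ger0_norm; last by rewrite mulr_ge0 ?sqr_ge0.
have {1}<- : (2 : R) * (x / 2) ^+ 2 = x ^+ 2 / 2 by field.
by rewrite ler_pM2l.
Qed.

Lemma sin_taylor x : `|sin x - x| <= `|x| ^+ 3 / 2.
Proof.
wlog x0 : x / 0 <= x.
  move=> H; have [|/ltW x0] := leP 0 x; first exact: H.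
  rewrite -(normrN x) -(normrN (sin x - x)) opprD -sinN H// oppr_ge0//.
have dF z : is_derive z (1 : R) (fun x => sin x - x) (cos z - 1).
apply: is_deriveB.
have [z /andP[z0 zx]] := mvt0 x0 dF.
rewrite /= sin0 !subr0 => ->; rewrite normrM distrC (ger0_norm x0) exprS.
rewrite [leRHS](_ : _ = (x ^+ 2 / 2) * x); last by ring.
rewrite ler_wpM2r// (le_trans (one_sub_cos_le z))// ler_pM2r//.
by rewrite lerXn2r// nnegrE.
Qed.

Lemma cos_taylor x : `|cos x - (1 - x ^+ 2 / 2)| <= x ^+ 4.
Proof.
set y := x / 2; have xE : x = y *+ 2 by rewrite /y -mulr_natr divfK// pnatr_eq0.
have -> : cos x - (1 - x ^+ 2 / 2) = - 2 * (sin y - y) * (sin y + y).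
  by rewrite {1}xE cos_mulr2n cos2sin2 xE; field.
rewrite 2!normrM normrN (ger0_norm (ler0n R 2)).
have h1 := sin_taylor y.
have h2 : `|sin y + y| <= 2 * `|y|.
  by rewrite (le_trans (ler_normD _ _))// mulr_natl mulr2n lerD2r norm_sin_le.
have -> : x ^+ 4 = 16 * `|y| ^+ 4.
  by rewrite xE -normrX ger0_norm ?exprn_even_ge0//; ring.
apply: (@le_trans _ _ (2 * (`|y| ^+ 3 / 2) * (2 * `|y|))).
  by rewrite ler_pM// ?mulr_ge0// ler_wpM2l.
rewrite [leLHS](_ : _ = 2 * `|y| ^+ 4); last by field.
by rewrite ler_wpM2r ?exprn_ge0// ler_nat.
Qed.

Lemma expRN_taylor y : 0 <= y -> `|1 - y - expR (- y)| <= y ^+ 2.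
Proof.
move=> y0; have h1 : 1 - y <= expR (- y) by exact: expR_ge1Dx.
rewrite ler0_norm ?subr_le0// opprB lerBlDl expRN.
have h2 : 1 + y <= expR y by exact: expR_ge1Dx.
have y1 : 0 < 1 + y by rewrite ltr_wpDr.
rewrite (@le_trans _ _ (1 + y)^-1) ?lef_pV2 ?posrE ?expR_gt0//.
rewrite -[leLHS]mul1r ler_pdivrMr//.
have : 0 <= y ^+ 3 by rewrite exprn_ge0.
by rewrite (_ : (1 - y + y ^+ 2) * (1 + y) = 1 + y ^+ 3); [lra|ring].
Qed.

End taylor.

Lemma continuous_bmf (R : realType) (f : R -> R) M :
  continuous f -> (forall x, `|f x| <= M) -> bmf (f : measurableTypeR R -> R).
Proof. by move=> cf fM; split; [exact: continuous_measurable_fun|exists M]. Qed.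

Lemma bmf_cos (R : realType) : bmf (cos : measurableTypeR R -> R).
Proof. by apply: (@continuous_bmf _ _ 1); [exact: continuous_cos|exact: cos_max]. Qed.

Lemma bmf_sin (R : realType) : bmf (sin : measurableTypeR R -> R).
Proof. by apply: (@continuous_bmf _ _ 1); [exact: continuous_sin|exact: sin_max]. Qed.

Lemma bmf_cosC d (T : measurableType d) (R : realType) (f : T -> R) :
  measurable_fun setT f -> bmf (fun w => cos (f w)).
Proof. exact: (bmf_comp (@bmf_cos R)). Qed.

Lemma bmf_sinC d (T : measurableType d) (R : realType) (f : T -> R) :
  measurable_fun setT f -> bmf (fun w => sin (f w)).
Proof. exact: (bmf_comp (@bmf_sin R)). Qed.

(** * Expectations of functions of independent variables *)
Lemma identically_distributed_Ex d (T : measurableType d) (R : realType)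
    (P : probability T R) d' (U : measurableType d') (X Y : T -> U) :
  measurable_fun setT X -> measurable_fun setT Y ->
  identically_distributed P X Y ->
  forall h : U -> R, bmf h -> Ex P (fun w => h (X w)) = Ex P (fun w => h (Y w)).
Proof.
move=> mX mY XY h bh.
have L Z (mZ : measurable_fun setT Z) :
  bounded_linear (fun f : U -> R => Ex P (fun w => f (Z w))).
  rewrite (_ : (fun f => _) = (fun f : U -> R => Ex P (fun w => f (Z w) * 1))).
    exact: (Ex_bounded_linear _ mZ (bmf_cst _ _)).
  by apply/funext => f; congr (Rintegral _ _ _); apply/funext => w; rewrite mulr1.
apply: (bounded_linear_ext (L _ mX) (L _ mY)) => // A mA.
have E Z (mZ : measurable_fun setT Z) :
  Ex P (fun w => \1_A (Z w)) = fine (P (Z @^-1` A)).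
  rewrite -Ex_indic; last by rewrite -[X in measurable X]setTI; exact: mZ.
  by congr (Rintegral _ _ _); apply/funext => w.
by rewrite !E// XY.
Qed.

Section independence.
Context d (T : measurableType d) (R : realType) (P : probability T R).
Context d' (U : measurableType d') (X : nat -> T -> U).
Hypothesis mX : forall l, measurable_fun setT (X l).
Hypothesis iX : mutually_independent P X.

Let bX l (f : U -> R) : bmf f -> bmf (fun w => f (X l w)).
Proof. by move=> bf; exact: bmf_comp. Qed.

Let upd (f : nat -> U -> R) k h l := if l == k then h else f l.

(** Both sides are bounded linear in each factor, which allows the indicators of
    the definition of independence to be replaced by general functions one factor
    at a time. *)
Lemma independent_Ex_prod n (f : nat -> U -> R) : (forall l, bmf (f l)) ->
  Ex P (fun w => \prod_(l < n) f l (X l w)) =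
  \prod_(l < n) Ex P (fun w => f l (X l w)).
Proof.
move=> bf.
(* The factors of index at least [k] are still indicators. *)
suff H k : forall f : nat -> U -> R, (forall l, bmf (f l)) ->
    (forall l, (k <= l)%N -> exists2 A, measurable A & f l = \1_A) ->
    Ex P (fun w => \prod_(l < n) f l (X l w)) =
    \prod_(l < n) Ex P (fun w => f l (X l w)).
  pose g l := if (l < n)%N then f l else \1_(@setT U).
  have := H n g; rewrite /g.
  under eq_Rintegral do under eq_bigr do rewrite ltn_ord.
  under eq_bigr do rewrite ltn_ord.
  apply; first by move=> l; case: ifP => _ //; exact: bmf_indic.
  by move=> l nl; rewrite ltnNge nl; exists setT.
elim: k => [|k IH] {bf} {}f bf fA.
  have /choice[A hA] : forall l, exists A, measurable A /\ f l = \1_A.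
    by move=> l; have [//|A] := fA l; exists A.
  have mA l : measurable (A l) by have [] := hA l.
  have fE l : f l = \1_(A l) by have [] := hA l.
  have mXA l : measurable (X l @^-1` A l).
    by rewrite -[X in measurable X]setTI; exact: mX.
  have := iX (iota_uniq 0 n) mA.
  rewrite -[iota 0 n](_ : index_iota 0 n = _); last by rewrite /index_iota subn0.
  rewrite big_mkord => PA.
  transitivity (fine (P (\bigcap_(l in [set` index_iota 0 n]) X l @^-1` A l))).
    rewrite -Ex_indic; last exact: bigcap_measurableType.
    congr (Rintegral _ _ _); apply/funext => w; rewrite indicE.
    have [/set_mem h|/negP h] := boolP (w \in _).
      rewrite big1// => l _; rewrite fE indicE mem_set//.
      by apply: h; rewrite /= mem_index_iota leq0n ltn_ord.
    have [l ln hl] : exists2 l : nat, (l < n)%N & ~ A l (X l w).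
      apply: contrapT => H; apply: h; apply/mem_set => l /=.
      rewrite mem_index_iota leq0n /= => ln; apply: contrapT => hl.
      by apply: H; exists l.
    rewrite (bigD1 (Ordinal ln))//= fE indicE memNset ?mul0r//.
  rewrite PA /=; apply: eq_bigr => l _; rewrite -Ex_indic//.
  by congr (Rintegral _ _ _); apply/funext => w; rewrite fE.
have [nk|kn] := leqP n k.
  have := IH (upd f k \1_setT).
  rewrite /upd.
  have E l : (l < n)%N -> (if l == k then \1_setT else f l) = f l.
    by move=> ln; case: eqP ln => // ->; rewrite ltnNge nk.
  under eq_Rintegral do under eq_bigr do rewrite E ?ltn_ord//.
  under eq_bigr do rewrite E ?ltn_ord//.
  apply; first by move=> l; case: ifP => _ //; exact: bmf_indic.
  move=> l kl; case: (eqVneq l k) => [_|lk]; first by exists setT.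
  by apply: fA; rewrite ltn_neqAle eq_sym lk.
pose ko := Ordinal kn.
pose g w := \prod_(l < n | l != ko) f l (X l w).
pose c := \prod_(l < n | l != ko) Ex P (fun w => f l (X l w)).
have bg : bmf g by apply: bmf_prod => l; exact: bX.
pose L1 (h : U -> R) := Ex P (fun w => h (X k w) * g w).
pose L2 (h : U -> R) := c * Ex P (fun w => h (X k w) * 1).
have E1 h : Ex P (fun w => \prod_(l < n) upd f k h l (X l w)) = L1 h.
  congr (Rintegral _ _ _); apply/funext => w.
  rewrite (bigD1 ko)//= {1}/upd eqxx; congr (_ * _).
  by apply: eq_bigr => l lk; rewrite /upd ifN.
have E2 h : \prod_(l < n) Ex P (fun w => upd f k h l (X l w)) = L2 h.
  rewrite /L2 mulrC (bigD1 ko)//= {1}/upd eqxx; congr (_ * _).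
    by congr (Rintegral _ _ _); apply/funext => w; rewrite mulr1.
  by apply: eq_bigr => l lk; rewrite /upd ifN.
have fE : f = upd f k (f k).
  by apply/funext => l; rewrite /upd; case: eqP => // ->.
rewrite fE E1 E2.
apply: (bounded_linear_ext (Ex_bounded_linear _ (mX k) bg)) => //.
  exact/bounded_linearZ/(Ex_bounded_linear _ (mX k) (bmf_cst _ _)).
move=> A mA; rewrite -/(L1 _) -/(L2 _) -E1 -E2; apply: IH.
  by move=> l; rewrite /upd; case: ifP => _ //; exact: bmf_indic.
move=> l kl; rewrite /upd; case: (eqVneq l k) => [_|lk]; first by exists A.
by apply: fA; rewrite ltn_neqAle eq_sym lk.
Qed.

(** The variable [F] behaves as a function of the first [k] variables would, as far
    as product formulas are concerned. *)
Definition past k (F : T -> R) : Prop := bmf F /\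
  forall n (f : nat -> U -> R), (forall j, bmf (f j)) ->
    Ex P (fun w => F w * \prod_(k <= j < n) f j (X j w)) =
    Ex P F * \prod_(k <= j < n) Ex P (fun w => f j (X j w)).

Lemma past_cst c : past 0 (fun=> c).
Proof.
split=> [|n f bf]; first exact: bmf_cst.
rewrite ExZ; last by apply: bmf_prod => j; exact: bX.
rewrite Ex_cst; congr (_ * _).
under eq_Rintegral do rewrite big_mkord.
by rewrite big_mkord independent_Ex_prod.
Qed.

Lemma past_Ex k F h : past k F -> bmf h ->
  Ex P (fun w => F w * h (X k w)) = Ex P F * Ex P (fun w => h (X k w)).
Proof.
move=> [_ /(_ k.+1 (fun=> h))] H bh.
have := H (fun=> bh); rewrite big_nat1.
by under eq_Rintegral do rewrite big_nat1.
Qed.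

Lemma pastM k F h : past k F -> bmf h ->
  past k.+1 (fun w => F w * h (X k w)).
Proof.
move=> pF bh; have [bF HF] := pF.
split=> [|n f bf]; first by apply: bmfM => //; exact: bX.
have [nk|kn] := leqP n k.
  rewrite big_geq ?mulr1; last exact: (leq_trans nk).
  congr (Rintegral _ _ _); apply/funext => w.
  by rewrite big_geq ?mulr1//; exact: (leq_trans nk).
have bu j : bmf (upd f k h j) by rewrite /upd; case: ifP.
have := HF n _ bu; rewrite big_ltn// {2}/upd eqxx.
rewrite past_Ex// mulrA => H.
transitivity (Ex P (fun w => F w * \prod_(k <= j < n) upd f k h j (X j w))).
  congr (Rintegral _ _ _); apply/funext => w.
  rewrite [in RHS]big_ltn// {1}/upd eqxx mulrA; congr (_ * _).
  rewrite big_nat [RHS]big_nat; apply: eq_bigr => j /andP[kj _].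
  by rewrite /upd gtn_eqF.
rewrite H; congr (_ * _).
rewrite big_nat [RHS]big_nat; apply: eq_bigr => j /andP[kj _].
by rewrite /upd gtn_eqF.
Qed.

Lemma pastD k F G : past k F -> past k G -> past k (fun w => F w + G w).
Proof.
move=> [bF HF] [bG HG]; split=> [|n f bf]; first exact: bmfD.
have bp : bmf (fun w => \prod_(k <= j < n) f j (X j w)).
  by apply: bmf_prod => j; exact: bX.
rewrite ExD// mulrDl -HF// -HG// -ExD; try exact: bmfM.
by congr (Rintegral _ _ _); apply/funext => w; rewrite mulrDl.
Qed.

Lemma past_ext k F G : F =1 G -> past k F -> past k G.
Proof. by move=> /funext ->. Qed.

Lemma pastS k F : past k F -> past k.+1 F.
Proof.
move=> pF; apply: past_ext (pastM pF (bmf_cst _ 1)) => w.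
by rewrite mulr1.
Qed.

Lemma past_sum k (h : U -> R) : bmf h -> past k (fun w => \sum_(l < k) h (X l w)).
Proof.
move=> bh; elim: k => [|k IH].
  by apply: past_ext (past_cst 0) => w; rewrite big_ord0.
have p1 : past k (fun=> 1).
  by elim: k {IH} => [|k IH]; [exact: past_cst|exact: pastS].
apply: past_ext (pastD (pastS IH) (pastM p1 bh)) => w.
by rewrite big_ord_recr mul1r.
Qed.

Lemma bmf_cos_sum k b (h : U -> R) : bmf h ->
  bmf (fun w => cos (b + \sum_(l < k) h (X l w))).
Proof.
move=> bh; apply: bmf_cosC; apply: measurable_funD => //.
by apply: bmf_measurable; apply: bmf_sum => l; exact: bX.
Qed.

(** The addition formula, with the sine of the first sum written as a cosine with
    shifted phase: a single family of expectations is then stable under adding one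
    variable. *)
Let cos_sumS k b (h : U -> R) w :
  cos (b + \sum_(l < k.+1) h (X l w)) =
  cos (b + \sum_(l < k) h (X l w)) * cos (h (X k w)) +
  cos (b - pi / 2 + \sum_(l < k) h (X l w)) * (- sin (h (X k w))) :> R.
Proof.
rewrite big_ord_recr/= addrA cosD mulrN; congr (_ - _ * _).
by rewrite addrAC cosBpihalf.
Qed.

Let bmf_cosh (h : U -> R) : bmf h -> bmf (fun u : U => cos (h u) : R).
Proof. by move=> bh; exact/bmf_cosC/bmf_measurable. Qed.
Let bmf_sinh (h : U -> R) : bmf h -> bmf (fun u : U => - sin (h u) : R).
Proof. by move=> bh; exact/bmfN/bmf_sinC/bmf_measurable. Qed.

Lemma past_cos k b (h : U -> R) : bmf h ->
  past k (fun w => cos (b + \sum_(l < k) h (X l w))).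
Proof.
move=> bh; elim: k b => [|k IH] b.
  by apply: past_ext (past_cst (cos b)) => w; rewrite big_ord0 addr0.
apply: past_ext (pastD (pastM (IH b) (bmf_cosh bh))
                       (pastM (IH (b - pi / 2)) (bmf_sinh bh))) => w.
by rewrite cos_sumS.
Qed.

Variable Xs : T -> U.
Hypothesis mXs : measurable_fun setT Xs.
Hypothesis hid : forall l, identically_distributed P (X l) Xs.

Let idX l (h : U -> R) : bmf h ->
  Ex P (fun w => h (X l w)) = Ex P (fun w => h (Xs w)).
Proof. exact: identically_distributed_Ex. Qed.

Let bXs (f : U -> R) : bmf f -> bmf (fun w => f (Xs w)).
Proof. by move=> bf; exact: bmf_comp. Qed.

Lemma Ex_iid_sum n (h : U -> R) : bmf h ->
  Ex P (fun w => \sum_(l < n) h (X l w)) = n%:R * Ex P (fun w => h (Xs w)).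
Proof.
move=> bh; rewrite Ex_sum; last by move=> l; exact: bX.
under eq_bigr do rewrite idX//.
by rewrite sumr_const card_ord mulr_natl.
Qed.

Let Ex_sum_sqr n (h : U -> R) : bmf h -> Ex P (fun w => h (Xs w)) = 0 ->
  Ex P (fun w => (\sum_(l < n) h (X l w)) ^+ 2) =
  n%:R * Ex P (fun w => h (Xs w) ^+ 2).
Proof.
move=> bh h0; elim: n => [|n IH].
  rewrite mul0r -[RHS](Ex_cst P); congr (Rintegral _ _ _); apply/funext => w.
  by rewrite big_ord0 expr0n.
have [bS _] := past_sum n bh.
transitivity (Ex P (fun w => (\sum_(l < n) h (X l w)) ^+ 2) +
   2 * Ex P (fun w => (\sum_(l < n) h (X l w)) * h (X n w)) +
   Ex P (fun w => h (X n w) ^+ 2)).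
  have b1 := bmfX 2 bS; have b3 := bmfX 2 (bX n bh).
  have b2 := bmfM bS (bX n bh).
  rewrite -ExZ// -!ExD//; first last.
  - exact: bmfZ.
  - by apply: bmfD => //; exact: bmfZ.
  by congr (Rintegral _ _ _); apply/funext => w; rewrite big_ord_recr/=; ring.
rewrite (past_Ex (past_sum n bh) bh) (idX n bh) h0 mulr0 mulr0 addr0 IH.
by rewrite (idX n (bmfX 2 bh)) -natr1 mulrDl mul1r.
Qed.

(** Variance plus squared bias, the variance being bounded by the raw second
    moment. *)
Lemma iid_sum_sqr_le n (h : U -> R) c : bmf h ->
  Ex P (fun w => (\sum_(l < n) h (X l w) - c) ^+ 2) <=
  n%:R * Ex P (fun w => h (Xs w) ^+ 2) +
  (n%:R * Ex P (fun w => h (Xs w)) - c) ^+ 2.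
Proof.
move=> bh; set m := Ex P (fun w => h (Xs w)).
pose h0 u := h u - m.
have bh0 : bmf h0 by apply: bmfB => //; exact: bmf_cst.
have bhX := bXs bh.
have h00 : Ex P (fun w => h0 (Xs w)) = 0.
  by rewrite ExB ?Ex_cst ?subrr//; exact: bmf_cst.
have bS : bmf (fun w => \sum_(l < n) h0 (X l w)).
  by apply: bmf_sum => l; exact: bX.
pose k := n%:R * m - c.
have -> : Ex P (fun w => (\sum_(l < n) h (X l w) - c) ^+ 2) =
    Ex P (fun w => (\sum_(l < n) h0 (X l w)) ^+ 2) +
    2 * k * Ex P (fun w => \sum_(l < n) h0 (X l w)) + k ^+ 2.
  rewrite -[X in _ + X](Ex_cst P) -ExZ// -!ExD//; first last.
  - exact: bmfZ.
  - exact: bmfX.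
  - exact: bmf_cst.
  - by apply: bmfD; [exact: bmfX|exact: bmfZ].
  congr (Rintegral _ _ _); apply/funext => w.
  rewrite /h0 sumrB sumr_const card_ord -mulr_natl /k; ring.
rewrite (Ex_iid_sum _ bh0) h00 mulr0 mulr0 addr0 lerD2r (Ex_sum_sqr _ bh0)//.
rewrite ler_wpM2l//.
have -> : Ex P (fun w => h0 (Xs w) ^+ 2) = Ex P (fun w => h (Xs w) ^+ 2) - m ^+ 2.
  transitivity (Ex P (fun w => h (Xs w) ^+ 2 - (2 * m) * h (Xs w)) + m ^+ 2).
    rewrite -[X in _ + X](Ex_cst P) -ExD//; first last.
    - exact: bmf_cst.
    - by apply: bmfB; [exact: bmfX|exact: bmfZ].
    by congr (Rintegral _ _ _); apply/funext => w; rewrite /h0; ring.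
  rewrite ExB; [|exact: bmfX|exact: bmfZ].
  by rewrite ExZ// -/m; ring.
by rewrite lerBlDr lerDl sqr_ge0.
Qed.

(** Adding one variable multiplies the expectation by [E cos h], up to a term with
    [E sin h]; by Taylor expansion these are close to [exp (- v / (2 n))] and [0],
    and the errors of the [n] steps add up. *)
Lemma cos_iid_sum_le n b (h : U -> R) e v : bmf h -> (0 < n)%N -> 0 <= v ->
  (forall u, `|h u| <= e) ->
  `|Ex P (fun w => cos (b + \sum_(l < n) h (X l w))) - expR (- (v / 2)) * cos b|
  <= `|n%:R * Ex P (fun w => h (Xs w) ^+ 2) - v| + v ^+ 2 / n%:R +
     (e + e ^+ 2) * (n%:R * Ex P (fun w => h (Xs w) ^+ 2)) +
     `|n%:R * Ex P (fun w => h (Xs w))|.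
Proof.
move=> bh n0 v0 he.
have n0' : 0 < n%:R :> R by rewrite ltr0n.
(* The bound on [h] makes [e] nonnegative only if there is a point at all. *)
have [u0|/forallNP noU] := pselect (exists u : U, True); last first.
  exfalso; have := probability_setT P.
  rewrite (_ : setT = set0) ?measure0; first by move/esym/eqP; rewrite onee_eq0.
  by apply/seteqP; split => // w _; exact: (noU (Xs w)).
have e0 : 0 <= e by have [u _] := u0; rewrite (le_trans _ (he u)).
set m1 := Ex P (fun w => h (Xs w)); set m2 := Ex P (fun w => h (Xs w) ^+ 2).
have bh2 := bXs (bmfX 2 bh); have bh1 := bXs bh.
have m20 : 0 <= m2 by apply: Ex_ge0 => w; exact: sqr_ge0.
pose c := Ex P (fun w => cos (h (Xs w))).
pose s := Ex P (fun w => - sin (h (Xs w))).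
pose psi := expR (- (v / 2 / n%:R)).
have psi01 : 0 <= psi <= 1.
  by rewrite expR_ge0 expR_le1 oppr_le0 !divr_ge0// ltW.
have step k b' : `|Ex P (fun w => cos (b' + \sum_(l < k) h (X l w)))
     - psi ^+ k * cos b'| <= k%:R * (`|c - psi| + `|s|).
  elim: k b' => [|k IH] b'.
    rewrite mul0r expr0 mul1r -[X in _ - X](Ex_cst P).
    rewrite (_ : (fun w => _) = (fun=> cos b')) ?subrr ?normr0//.
    by apply/funext => w; rewrite big_ord0 addr0.
  set C := Ex P (fun w => cos (b' + \sum_(l < k) h (X l w))).
  pose S := Ex P (fun w => cos (b' - pi / 2 + \sum_(l < k) h (X l w))).
  have -> : Ex P (fun w => cos (b' + \sum_(l < k.+1) h (X l w))) = C * c + S * s.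
    rewrite /C /S /c /s -(idX k (bmf_cosh bh)) -(idX k (bmf_sinh bh)).
    rewrite -(past_Ex (past_cos k b' bh) (bmf_cosh bh)).
    rewrite -(past_Ex (past_cos k _ bh) (bmf_sinh bh)) -ExD.
    - by congr (Rintegral _ _ _); apply/funext => w; rewrite cos_sumS.
    - by apply: bmfM; [exact: bmf_cos_sum|exact: (bX k (bmf_cosh bh))].
    - by apply: bmfM; [exact: bmf_cos_sum|exact: (bX k (bmf_sinh bh))].
  have C1 : `|C| <= 1.
    by apply: Ex_norm_bound; [exact: bmf_cos_sum|move=> w; exact: cos_max].
  have S1 : `|S| <= 1.
    by apply: Ex_norm_bound; [exact: bmf_cos_sum|move=> w; exact: cos_max].
  rewrite (_ : _ - _ = psi * (C - psi ^+ k * cos b') + C * (c - psi) + S * s);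
    last by rewrite exprS; ring.
  rewrite -natr1 mulrDl mul1r.
  apply: (le_trans (ler_normD _ _)); rewrite addrA lerD//; last first.
    by rewrite normrM ler_piMl.
  apply: (le_trans (ler_normD _ _)); rewrite lerD//; last first.
    by rewrite normrM ler_piMl.
  rewrite normrM ger0_norm ?(le_trans _ (IH b'))//; last by case/andP: psi01.
  by rewrite ler_piMl//; case/andP: psi01.
have := step n b.
have -> : psi ^+ n = expR (- (v / 2)).
  by rewrite /psi -expRM_natl mulrN mulrCA divff ?mulr1// gt_eqF.
move/le_trans; apply.
have hc : `|c - (1 - m2 / 2)| <= e ^+ 2 * m2.
  have -> : 1 - m2 / 2 = Ex P (fun w => 1 - h (Xs w) ^+ 2 / 2).
    rewrite ExB; [|exact: bmf_cst|].
      rewrite Ex_cst [in RHS](_ : (fun w => _) = (fun w => 2^-1 * h (Xs w) ^+ 2)).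
        by rewrite ExZ ?[m2 / 2]mulrC.
      by apply/funext => w; rewrite mulrC.
    by apply: bmfM => //; exact: bmf_cst.
  rewrite -ExZ//.
  apply: Ex_normB; first exact: (bXs (bmf_cosh bh)).
  - apply: bmfB; first exact: bmf_cst.
    by apply: bmfM => //; exact: bmf_cst.
  - exact: bmfZ.
  move=> w; rewrite (le_trans (cos_taylor _))// (_ : 4%N = (2 + 2)%N)// exprD.
  rewrite ler_wpM2r ?sqr_ge0// -[leLHS]real_normK ?num_real//.
  by rewrite lerXn2r ?nnegrE.
have hs : `|s - (- m1)| <= e * m2.
  rewrite -(mulN1r m1) /m1 /m2 -(ExZ P (-1) bh1) -(ExZ P e bh2).
  apply: Ex_normB; first exact: (bXs (bmf_sinh bh)).
  - exact: bmfZ.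
  - exact: bmfZ.
  move=> w; rewrite mulN1r -opprD normrN (le_trans (sin_taylor _))//.
  rewrite exprS real_normK ?num_real// -mulrA ler_pM//.
    by rewrite divr_ge0// sqr_ge0.
  by rewrite ler_pdivrMr// ler_peMr ?sqr_ge0// ler1n.
have hp := expRN_taylor (divr_ge0 (divr_ge0 v0 (ler0n R 2)) (ltW n0')).
rewrite -/psi in hp.
have h1 : `|c - psi| <= e ^+ 2 * m2 + `|m2 - v / n%:R| + v ^+ 2 / n%:R ^+ 2.
  rewrite (_ : c - psi = (c - (1 - m2 / 2)) - (m2 - v / n%:R) / 2
     + (1 - v / 2 / n%:R - psi)); last by ring.
  apply: (le_trans (ler_normD _ _)); rewrite lerD//.
    apply: (le_trans (ler_normB _ _)); rewrite lerD//.
    by rewrite normrM ler_piMr// normfV invf_le1 ?normr_gt0// ger0_norm// ler1n.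
  rewrite (le_trans hp)// -expr_div_n lerXn2r// ?nnegrE ?divr_ge0// ?(ltW n0')//.
  by rewrite ler_pM2r ?invr_gt0// ler_pdivrMr// ler_peMr// ler1n.
have h2 : `|s| <= e * m2 + `|m1|.
  by rewrite -[s](subrK (- m1)) (le_trans (ler_normD _ _))// normrN lerD2r.
apply: (@le_trans _ _ (n%:R * (e ^+ 2 * m2 + `|m2 - v / n%:R| +
   v ^+ 2 / n%:R ^+ 2 + (e * m2 + `|m1|)))).
  by rewrite ler_wpM2l ?(ltW n0')// lerD.
rewrite (_ : `|n%:R * m2 - v| = n%:R * `|m2 - v / n%:R|); last first.
  by rewrite -{2}(gtr0_norm n0') -normrM mulrBr mulrCA divff ?mulr1// gt_eqF.
rewrite (_ : `|n%:R * m1| = n%:R * `|m1|); last by rewrite normrM gtr0_norm.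
rewrite le_eqVlt; apply/orP; left; apply/eqP; field.
by rewrite gt_eqF.
Qed.

End independence.

(** * Bounded convergence and exchange of expectations *)
Section bounded_convergence.
Context d (T : measurableType d) (R : realType) (P : probability T R).

Lemma Ex_bounded_cvg (f_ : nat -> T -> R) (f : T -> R) M :
  (forall n, measurable_fun setT (f_ n)) -> (forall n x, `|f_ n x| <= M) ->
  bmf f -> (forall x, f_ n x @[n --> \oo] --> f x) ->
  Ex P (f_ n) @[n --> \oo] --> Ex P f.
Proof.
move=> mf_ f_M bf f_f.
have [||||| _ _] := @dominated_convergence _ T R P setT measurableT
  (fun n x => (f_ n x)%:E) (fun x => (f x)%:E) (fun=> M%:E).
- by move=> n; apply/measurable_EFinP.
- by apply/measurable_EFinP; exact: bmf_measurable.
- by apply: aeW => x _; apply: cvg_EFin; [exact: nearW|exact: f_f].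
- exact: finite_measure_integrable_cst.
- by apply: aeW => x n _; rewrite lee_fin f_M.
move=> h; apply: fine_cvg; rewrite fineK//.
exact: (integrable_fin_num _ (bmf_integrable P bf)).
Qed.

Context d' (U : measurableType d') (Q : probability U R).

Lemma bmf_section1 (F : T * U -> R) w : bmf F -> bmf (fun u => F (w, u)).
Proof.
move=> [mF [M hM]]; split; last by exists M.
by apply: measurableT_comp => //; exact: pair1_measurable.
Qed.

Lemma bmf_section2 (F : T * U -> R) u : bmf F -> bmf (fun w => F (w, u)).
Proof.
move=> [mF [M hM]]; split; last by exists M.
by apply: measurableT_comp => //; exact: pair2_measurable.
Qed.

Lemma Ex_Fubini (F : T * U -> R) : bmf F ->
  Ex P (fun w => Ex Q (fun u => F (w, u))) =
  Ex Q (fun u => Ex P (fun w => F (w, u))).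
Proof.
move=> bF; have iF : (P \x Q)%E.-integrable setT (EFin \o F).
  exact: (bmf_integrable [the probability _ _ of (P \x Q)%E] bF).
have FE := Fubini iF; rewrite /Rintegral.
have E1 w : (\int[Q]_u (F (w, u))%:E)%E = (fine (\int[Q]_u (F (w, u))%:E))%:E.
  rewrite fineK//.
  exact: (integrable_fin_num _ (bmf_integrable Q (bmf_section1 w bF))).
have E2 u : (\int[P]_w (F (w, u))%:E)%E = (fine (\int[P]_w (F (w, u))%:E))%:E.
  rewrite fineK//.
  exact: (integrable_fin_num _ (bmf_integrable P (bmf_section2 u bF))).
transitivity (fine (\int[P]_w \int[Q]_u (F (w, u))%:E)%E).
  by congr fine; apply: eq_integral => w _; rewrite -E1.
by rewrite [in LHS]FE; congr fine; apply: eq_integral => u _; rewrite -E2.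
Qed.

Lemma bmf_Ex_section (F : T * U -> R) : bmf F ->
  bmf (fun w => Ex Q (fun u => F (w, u))).
Proof.
move=> bF; split; last first.
  have [_ [M hM]] := bF; exists M => w.
  by apply: Ex_norm_bound => //; exact: bmf_section1.
have iF : (P \x Q)%E.-integrable setT (EFin \o F).
  exact: (bmf_integrable [the probability _ _ of (P \x Q)%E] bF).
apply: (measurableT_comp (f := fine)); first exact: fine_measurable.
exact: (measurable_fubini_F iF).
Qed.

End bounded_convergence.

(** * Fourier transform of Gaussian laws *)
Section gauss.
Variable R : realType.
Local Notation leb := (@lebesgue_measure R).
Local Notation RR := (measurableTypeR R).
Implicit Types s t x y : R.

Lemma normal_pdfMfun m s x : s != 0 ->
  normal_pdf m s x = normal_peak s * normal_fun m s x.
Proof. by move=> s0; rewrite normal_pdfE. Qed.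

Lemma normal_funC m s x : normal_fun m s x = normal_fun x s m.
Proof. by rewrite /normal_fun -sqrrN opprB. Qed.

Lemma integrable_bmf_pdf m s (f : RR -> R) : bmf f ->
  leb.-integrable setT (fun x => (f x * normal_pdf m s x)%:E).
Proof.
move=> [mf [M hM]].
have iK : leb.-integrable setT (fun x : RR => (M%:E * (normal_pdf m s x)%:E)%E).
  by apply: integrableZl => //; exact: integrable_normal_pdf.
apply: (le_integrable measurableT _ _ iK).
  by apply/measurable_EFinP/measurable_funM => //; exact: measurable_normal_pdf.
move=> x _; rewrite /= lee_fin !normrM (ger0_norm (normal_pdf_ge0 _ _ _)).
by rewrite ler_wpM2r ?normal_pdf_ge0// (le_trans (hM x))// ler_norm.
Qed.

Lemma Ex_normal m s (f : RR -> R) : bmf f ->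
  Ex (normal_prob m s) f = Rintegral leb setT (fun x => f x * normal_pdf m s x).
Proof.
pose L1 (f : RR -> R) := Ex (normal_prob m s) f.
pose L2 (f : RR -> R) := Rintegral leb setT (fun x => f x * normal_pdf m s x).
move=> bf; rewrite -/(L1 f) -/(L2 f); move: f bf.
apply: bounded_linear_ext; rewrite /L1 /L2.
- rewrite (_ : (fun f => _) =
    (fun f : RR -> R => Ex (normal_prob m s) (fun w => f w * 1))).
    by apply: (Ex_bounded_linear _ _ (bmf_cst _ _)) => //; exact: measurable_id.
  by apply/funext => f; congr (Rintegral _ _ _); apply/funext => w; rewrite mulr1.
- split.
  + move=> f g bf bg; rewrite -RintegralD//; try exact: integrable_bmf_pdf.
    by apply: eq_Rintegral => x _; rewrite mulrDl.
  + move=> c f bf; rewrite -RintegralZl//; last exact: integrable_bmf_pdf.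
    by apply: eq_Rintegral => x _; rewrite mulrA.
  + exists 1 => // f e bf fe; rewrite mul1r.
    apply: (le_trans (le_normr_Rintegral _ (integrable_bmf_pdf m s bf))) => //.
    apply: (@le_trans _ _ (Rintegral leb setT (fun x => e * normal_pdf m s x))).
      apply: le_Rintegral => //.
      * under eq_fun do rewrite -(ger0_norm (normal_pdf_ge0 m s _)) normrM normr_id.
        under eq_fun do rewrite -/(normal_pdf m s _) (ger0_norm (normal_pdf_ge0 m s _)).
        exact: (integrable_bmf_pdf m s (bmf_norm bf)).
      * exact: (integrable_bmf_pdf m s (bmf_cst _ e)).
      * move=> x _; rewrite normrM (ger0_norm (normal_pdf_ge0 m s x)).
        by rewrite ler_wpM2r ?normal_pdf_ge0.
    rewrite RintegralZl//; last exact: integrable_normal_pdf.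
    by rewrite /Rintegral integral_normal_pdf mulr1.
- move=> A mA; rewrite Ex_indic// /Rintegral; congr fine.
  rewrite -[LHS]/(\int[leb]_(x in A) (normal_pdf m s x)%:E)%E [LHS]integral_mkcond.
  apply: eq_integral => x _.
  by rewrite patchE indicE; case: ifP => _ /=; rewrite ?mul1r ?mul0r.
Qed.

End gauss.

Section gaussian_integrals.
Variable R : realType.
Local Notation leb := (@lebesgue_measure R).
Local Notation RR := (measurableTypeR R).
Implicit Types s t x y : R.

(** A linear factor is absorbed by widening the Gaussian, since
    [z <= exp (z ^+ 2 / 4)]. *)
Lemma normal_pdf_moment_le m s x : s != 0 ->
  `|x - m| * normal_pdf m s x <=
  Num.sqrt 2 * `|s| * normal_pdf m (Num.sqrt 2 * s) x.
Proof.
move=> s0; have s20 : Num.sqrt 2 * s != 0 by rewrite mulf_neq0// sqrtr_eq0 -ltNge.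
rewrite !normal_pdfMfun//.
have -> : normal_peak (Num.sqrt 2 * s) = (Num.sqrt 2)^-1 * normal_peak s :> R.
  rewrite /normal_peak exprMn sqr_sqrtr// -mulrA -mulrnAr sqrtrM// invfM//.
rewrite [leRHS](_ : _ = normal_peak s * (`|s| * normal_fun m (Num.sqrt 2 * s) x));
  last first.
  by field; rewrite sqrtr_eq0 -ltNge.
rewrite mulrCA ler_wpM2l ?normal_peak_ge0//.
set z := `|x - m| / `|s|.
have sgt : 0 < `|s| by rewrite normr_gt0.
have xmE : `|x - m| = `|s| * z by rewrite /z mulrC divfK// gt_eqF.
have z2 : z ^+ 2 = (x - m) ^+ 2 / s ^+ 2.
  by rewrite /z expr_div_n !real_normK ?num_real.
have F1 : normal_fun m s x = expR (- (z ^+ 2 / 2)).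
  by rewrite /normal_fun z2; congr expR; field.
have F2 : normal_fun m (Num.sqrt 2 * s) x = expR (- (z ^+ 2 / 4)).
  rewrite /normal_fun z2 exprMn sqr_sqrtr//; congr expR; field.
  by [].
rewrite xmE -mulrA ler_wpM2l// F1 F2.
rewrite (_ : - (z ^+ 2 / 2) = - (z ^+ 2 / 4) - (z ^+ 2 / 4)); last by field.
rewrite expRD mulrA ler_piMl ?expR_ge0// expRN ler_pdivrMr ?expR_gt0// mul1r.
apply: (le_trans _ (expR_ge1Dx _)); have := sqr_ge0 (z / 2 - 1); lra.
Qed.

Lemma integrable_le_pdf m s (C : R) (f : RR -> R) : measurable_fun setT f ->
  (forall x, `|f x| <= C * normal_pdf m s x) ->
  leb.-integrable setT (EFin \o f).
Proof.
move=> mf fC.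
have iK : leb.-integrable setT (fun x : RR => (C%:E * (normal_pdf m s x)%:E)%E).
  by apply: integrableZl => //; exact: integrable_normal_pdf.
apply: (le_integrable measurableT _ _ iK); first exact/measurable_EFinP.
by move=> x _; rewrite /= lee_fin (le_trans (fC x))// ler_norm.
Qed.

Lemma Rintegral_derive_vanish (H h : R -> R) :
  (forall t, is_derive t (1 : R) H (h t)) -> continuous h ->
  leb.-integrable setT (EFin \o h) ->
  H n%:R - H (- n%:R) @[n --> \oo] --> 0 ->
  Rintegral leb setT h = 0.
Proof.
move=> dH ch ih H0.
have mh : measurable_fun setT (h : RR -> R) by exact: continuous_measurable_fun.
pose D n : set R := `[- n%:R, n%:R]%classic.
have cvgD : Rintegral leb (D n) h @[n --> \oo] --> Rintegral leb setT h.
  have [||||| _ _] := @dominated_convergence _ RR R leb setT measurableT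
    (fun n x => ((h \_ (D n)) x)%:E) (fun x => (h x)%:E) (fun x => `|(h x)%:E|%E).
  - move=> n; apply/measurable_EFinP.
    apply/(@measurable_restrictT _ _ RR RR _ h) => //; first exact: measurable_itv.
    exact: (measurable_funS measurableT _ mh).
  - exact/measurable_EFinP.
  - apply: aeW => x _; apply: cvg_EFin; first exact: nearW.
    apply: cvg_near_cst; near=> n; rewrite /= patchE mem_set// /D /= in_itv/= -ler_norml.
    by near: n; exact: nbhs_infty_ger.
  - by apply: integrable_abse.
  - apply: aeW => x n _; rewrite lee_fin patchE; case: ifP => // _.
    by rewrite normr0.
  move=> Hc; apply: fine_cvg; rewrite fineK; last first.
    exact: (integrable_fin_num _ ih).
  rewrite [X in X @ _ --> _](_ : _ = (fun n => \int[leb]_x ((h \_ (D n)) x)%:E)%E)//.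
  apply/funext => n; rewrite integral_mkcond.
  by apply: eq_integral => x _; rewrite restrict_EFin.
(* The fundamental theorem of calculus requires a nondegenerate interval, whence
   the shift of the index. *)
pose uD n := Rintegral leb (D n) h; pose uH n := H n%:R - H (- n%:R).
have s1 : (fun n => uD n.+1) @ \oo --> Rintegral leb setT h.
  by rewrite (cvg_shiftS uD _).
have s2 : (fun n => uH n.+1) @ \oo --> 0 by rewrite (cvg_shiftS uH _).
suff E : (fun n => uD n.+1) = (fun n => uH n.+1).
  by rewrite E in s1; exact: (cvg_unique _ s1 s2).
apply/funext => n; rewrite /uD /uH /Rintegral (@continuous_FTC2 _ h H).
- by [].
- by rewrite (@lt_trans _ _ 0)// ?oppr_lt0 ltr0n.
- exact: continuous_subspaceT.
- split.
  + by move=> z _; have [] := dH z.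
  + apply: cvg_at_right_filter; apply: differentiable_continuous.
    by apply/derivable1_diffP; have [] := dH (- n.+1%:R).
  + apply: cvg_at_left_filter; apply: differentiable_continuous.
    by apply/derivable1_diffP; have [] := dH (n.+1%:R).
- by move=> z _; rewrite derive1E; have [_ ->] := dH z.
Unshelve. all: by end_near. Qed.

Lemma is_derive_normal_pdf s t : s != 0 ->
  is_derive t (1 : R) (normal_pdf 0 s) (- (t / s ^+ 2) * normal_pdf 0 s t).
Proof.
move=> s0; rewrite normal_pdfE// /normal_fun.
pose e t := - (t - 0) ^+ 2 / (s ^+ 2 *+ 2) : R.
have de : is_derive t (1 : R) e (- (t / s ^+ 2)).
  rewrite /e; apply: is_derive_eq.
  rewrite /GRing.scale /=; field; exact: s0.
have := is_deriveZ (normal_peak s) (is_derive1_comp (is_derive_expR (e t)) de).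
move=> H; apply: (is_derive_eq H).
by rewrite /GRing.scale /= /e; ring.
Qed.

End gaussian_integrals.

Section gaussian_cosine.
Variables (R : realType) (s b : R).
Hypothesis s0 : s != 0.
Local Notation leb := (@lebesgue_measure R).
Local Notation RR := (measurableTypeR R).
Local Notation phi := (normal_pdf 0 s).

Let mphi : measurable_fun setT (phi : RR -> R).
Proof. exact: measurable_normal_pdf. Qed.

Let cphi : continuous phi. Proof. exact: continuous_normal_pdf. Qed.

Let C := Num.sqrt 2 * `|s|.

Let tphi t : `|t * phi t| <= C * normal_pdf 0 (Num.sqrt 2 * s) t.
Proof.
rewrite normrM (ger0_norm (normal_pdf_ge0 _ _ _)).
by have := normal_pdf_moment_le 0 t s0; rewrite subr0.
Qed.

Let C0 : 0 <= C. Proof. by rewrite mulr_ge0. Qed.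

Let ccos (y : R) : continuous (fun t : R => cos (t * y + b)).
Proof.
move=> t; apply: continuous_comp; last exact: continuous_cos.
by apply: cvgD; [apply: cvgMl; exact: cvg_id|exact: cvg_cst].
Qed.

Let csin (y : R) : continuous (fun t : R => sin (t * y + b)).
Proof.
move=> t; apply: continuous_comp; last exact: continuous_sin.
by apply: cvgD; [apply: cvgMl; exact: cvg_id|exact: cvg_cst].
Qed.

Let csintphi (y : R) : continuous (fun t : R => sin (t * y + b) * (t * phi t)).
Proof.
move=> t; apply: cvgM; first exact: csin.
by apply: cvgM; [exact: cvg_id|exact: cphi].
Qed.

Let intsin (y : R) : leb.-integrable setT (EFin \o (fun t : RR => sin (t * y + b) * (t * phi t))).
Proof.
apply: (@integrable_le_pdf _ 0 (Num.sqrt 2 * s) C).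
  exact: continuous_measurable_fun.
move=> t; rewrite normrM (le_trans _ (tphi t))// ler_piMl//.
exact: sin_max.
Qed.

Let bcos (y : R) : bmf (fun t : RR => cos (t * y + b)).
Proof. by apply: (@continuous_bmf _ _ 1) => // t; exact: cos_max. Qed.

Let intcos (y : R) : leb.-integrable setT (EFin \o (fun t : RR => cos (t * y + b) * phi t)).
Proof. exact: integrable_bmf_pdf. Qed.

Let psi (y : R) := Rintegral leb setT (fun t : RR => cos (t * y + b) * phi t).
Let chi (y : R) := Rintegral leb setT (fun t : RR => sin (t * y + b) * (t * phi t)).

Let d1 (y t : R) : is_derive y (1 : R) (fun y => cos (t * y + b) * phi t)
  (- (sin (t * y + b) * (t * phi t))).
Proof.
have h : is_derive y (1 : R) (fun y => t * y + b) t.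
  by apply: is_derive_eq; rewrite /GRing.scale/= mulr1 addr0.
have h2 := @is_derive1_comp R cos (fun y => t * y + b) y _ _ (is_derive_cos (t * y + b)) h.
have := is_deriveM h2 (is_derive_cst (phi t) y (1 : R)) => h3.
by apply: (is_derive_eq h3); rewrite /GRing.scale/=; ring.
Qed.

Let psi_derive y : is_derive y (1 : R) psi (- chi y).
Proof.
pose f y t := cos (t * y + b) * phi t.
have fy : y \in `](y - 1), (y + 1)[ by rewrite in_itv/= ltrBlDr !ltrDl ltr01.
have E x t : partial1of2 f x t = - (sin (t * x + b) * (t * phi t)).
  by rewrite partial1of2E; have [_] := d1 x t.
have intG : leb.-integrable setT (EFin \o (fun t : RR => `|t * phi t|)).
  apply: (@integrable_le_pdf _ 0 (Num.sqrt 2 * s) C).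
    apply: measurableT_comp; first exact: normr_measurable.
    by apply: measurable_funM.
  by move=> t; rewrite normr_id.
have H1 x (_ : `](y - 1), (y + 1)[%classic x) := intcos x.
have H2 x t (_ : `](y - 1), (y + 1)[%classic x) (_ : [set: RR] t) : derivable (f^~ t) x 1.
  by have [] := d1 x t.
have H3 x t (_ : `](y - 1), (y + 1)[%classic x) (_ : [set: RR] t) :
    `|partial1of2 f x t| <= `|t * phi t|.
  by rewrite E normrN normrM ler_piMl//; exact: sin_max.
split.
  exact: (derivable_under_integral measurableT fy H1 H2 _ intG H3).
rewrite -derive1E (differentiation_under_integral measurableT fy H1 H2 _ intG H3)//.
rewrite /chi -mulN1r -(RintegralZl _ measurableT (intsin y)).
by apply: eq_Rintegral => t _; rewrite E mulN1r.
Qed.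

(** Integration by parts: [t phi t] is [- s ^+ 2] times the derivative of the
    density. *)
Let chiE y : chi y = s ^+ 2 * y * psi y.
Proof.
pose H t := sin (t * y + b) * phi t.
pose h t := y * (cos (t * y + b) * phi t) - (s ^+ 2)^-1 * (sin (t * y + b) * (t * phi t)).
have dH t : is_derive t (1 : R) H (h t).
  have e1 : is_derive t (1 : R) (fun t => t * y + b) y.
    by apply: is_derive_eq; rewrite /GRing.scale/=; ring.
  have e2 := @is_derive1_comp R sin (fun t => t * y + b) t _ _ (is_derive_sin (t * y + b)) e1.
  have e3 := is_deriveM e2 (is_derive_normal_pdf (t : R) s0).
  by apply: (is_derive_eq e3); rewrite /GRing.scale/= /h; ring.
have ch : continuous h.
  move=> t; apply: cvgB; apply: cvgM; try exact: cvg_cst.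
    by apply: cvgM; [exact: ccos|exact: cphi].
  exact: csintphi.
have ih1 : leb.-integrable setT (EFin \o (fun t : RR => y * (cos (t * y + b) * phi t))).
  by have := integrableZl measurableT y (intcos y).
have ih2 : leb.-integrable setT
    (EFin \o (fun t : RR => (s ^+ 2)^-1 * (sin (t * y + b) * (t * phi t)))).
  by have := integrableZl measurableT ((s ^+ 2)^-1) (intsin y).
have ih : leb.-integrable setT (EFin \o (h : RR -> R)).
  by have := integrableB measurableT ih1 ih2.
have H0 : H n%:R - H (- n%:R) @[n --> \oo] --> 0.
  pose B := 2 * (C * normal_peak (Num.sqrt 2 * s)).
  have B0 : 0 <= B by rewrite !mulr_ge0// normal_peak_ge0.
  apply/cvgr0Pnorm_le => e e0; near=> n.
  have n0 : 0 < n%:R :> R by rewrite ltr0n; near: n; exact: nbhs_infty_gt.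
  have bd t : `|t| = n%:R -> `|H t| <= C * normal_peak (Num.sqrt 2 * s) / n%:R.
    move=> tn; rewrite ler_pdivlMr// normrM (le_trans (y := `|phi t| * n%:R))//.
      by rewrite ler_wpM2r ?(ltW n0)// ler_piMl// sin_max.
    rewrite -tn -normrM mulrC (le_trans (tphi t))// ler_wpM2l// normal_pdf_ub//.
    by rewrite mulf_neq0// sqrtr_eq0 -ltNge.
  apply: (le_trans (ler_normB _ _)).
  apply: (@le_trans _ _ (B / n%:R)).
    rewrite [leRHS](_ : _ = C * normal_peak (Num.sqrt 2 * s) / n%:R +
      C * normal_peak (Num.sqrt 2 * s) / n%:R); last by rewrite /B; ring.
    by rewrite lerD// bd// ?normrN normr_nat.
  rewrite ler_pdivrMr// mulrC -ler_pdivrMr//.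
  by near: n; exact: nbhs_infty_ger.
have := Rintegral_derive_vanish dH ch ih H0.
rewrite RintegralB// (RintegralZl _ measurableT (intcos y)).
rewrite (RintegralZl _ measurableT (intsin y)).
rewrite -/(psi y) -/(chi y) => /eqP; rewrite subr_eq0 => /eqP h1.
by rewrite -mulrA h1 mulrA mulfV ?mul1r// expf_neq0.
Unshelve. all: by end_near. Qed.

(** The transform [psi] solves the linear differential equation
    [psi' y = - s ^+ 2 * y * psi y], hence [psi] times [exp (s ^+ 2 y ^+ 2 / 2)] is
    constant. *)
Lemma Ex_normal_cos y :
  Ex (normal_prob 0 s) (fun t => cos (t * y + b)) =
  expR (- (s ^+ 2 * y ^+ 2 / 2)) * cos b.
Proof.
rewrite Ex_normal// -/(psi y).
pose g y := psi y * expR (s ^+ 2 / 2 * y ^+ 2).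
have dg z : is_derive z (1 : R) g 0.
  have e1 : is_derive z (1 : R) (fun y => s ^+ 2 / 2 * y ^+ 2) (s ^+ 2 * z).
    by apply: is_derive_eq; rewrite /GRing.scale/=; field.
  have e2 := @is_derive1_comp R expR (fun y => s ^+ 2 / 2 * y ^+ 2) z _ _ (is_derive_expR _) e1.
  have e3 := is_deriveM (psi_derive z) e2.
  by apply: (is_derive_eq e3); rewrite /GRing.scale/= chiE; ring.
have := is_derive_0_is_cst y 0 dg; rewrite /g expr0n mulr0 expR0 mulr1.
have -> : psi 0 = cos b.
  rewrite /psi; under eq_Rintegral do rewrite mulr0 add0r.
  rewrite RintegralZl//; last exact: integrable_normal_pdf.
  by rewrite /Rintegral integral_normal_pdf mulr1.
move=> h; apply: (@mulIf _ (expR (s ^+ 2 / 2 * y ^+ 2))); first by rewrite gt_eqF ?expR_gt0.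
rewrite h mulrAC -expRD [X in expR X](_ : _ = 0) ?expR0 ?mul1r//.
by field.
Qed.

End gaussian_cosine.

(** * From trigonometric to general test functions *)

Lemma continuous_compact_support_bounded (R : realType) (g : R -> R) (K : R) :
  continuous g -> (forall x, K < `|x| -> g x = 0) -> exists M, forall x, `|g x| <= M.
Proof.
move=> cg gK; pose S : set R := `[- K, K]%classic.
have cS : compact S by exact: segment_compact.
have cgS : compact (g @` S) by apply: continuous_compact => //; exact: continuous_subspaceT.
have [M [_ hM]] := compact_bounded cgS.
have M1 : M < `|M| + 1 by rewrite (le_lt_trans (ler_norm M))// ltrDl.
exists (`|M| + 1) => x; have [xK|Kx] := leP `|x| K.
  by apply: (hM _ M1); exists x => //; rewrite /S /= in_itv/= -ler_norml.
by rewrite gK// normr0 addr_ge0.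
Qed.

(** Uniform continuity controls the increments between close points; for distant
    points, the boundedness of [g] is turned into a linear bound. *)
Lemma continuous_compact_support_modulus (R : realType) (g : R -> R) (K e : R) :
  continuous g -> (forall x, K < `|x| -> g x = 0) -> 0 < e ->
  exists2 C, 0 <= C & forall x y, `|g x - g y| <= e + C * `|x - y|.
Proof.
move=> cg gK e0.
pose S : set R := `[- K, K]%classic.
have cS : compact S by exact: segment_compact.
have [M hM] := continuous_compact_support_bounded cg gK.
have [r r0 hr] : exists2 r, 0 < r & forall x y, S x -> `|x - y| < r -> `|g x - g y| <= e.
  have nc := (iffLR (compact_near_coveringP _) cS) R (nbhs 0^'+)
     (fun r x => forall y, `|x - y| < r -> `|g x - g y| <= e) _.
  have /nc : forall x, S x -> \forall x' \near x & r \near 0^'+,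
      forall y, `|x' - y| < r -> `|g x' - g y| <= e.
    move=> x _.
    have /cvgrPdist_lt /(_ (e / 2)) := cg x.
    rewrite divr_gt0// => /(_ isT) [r /= r0 hr].
    exists (ball x (r / 2), [set t | t < r / 2]) => /=.
      split; first by apply: nbhsx_ballx; rewrite divr_gt0.
      by apply: nbhs_right_lt; rewrite divr_gt0.
    move=> [x' t] /= [bx tr] y xy.
    have x'x : `|x - x'| < r by rewrite (lt_le_trans bx)// ler_pdivrMr// ler_peMr ?ler1n// ltW.
    have yx : `|x - y| < r.
      rewrite -(subrK x' x) -addrA (le_lt_trans (ler_normD _ _))//.
      by rewrite (splitr r) ltrD// (lt_trans xy).
    rewrite (_ : g x' - g y = (g x - g y) - (g x - g x')); last by ring.
    rewrite (le_trans (ler_normB _ _))// (splitr e) lerD// ltW//; exact: hr.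
  move=> near0; have [r [r0 hr]] := filter_ex (filterI (nbhs_right_gt 0) near0).
  by exists r => // x y Sx; exact: hr.
have M0 : 0 <= M by rewrite (le_trans _ (hM 0)).
exists (2 * M / r); first by rewrite divr_ge0 ?(ltW r0)// mulr_ge0.
move=> x y; have [rxy|xyr] := leP r `|x - y|.
  rewrite ler_wpDl ?(ltW e0)// -mulrA (le_trans (y := 2 * M))//.
    by rewrite (le_trans (ler_normB _ _))// mulr_natl mulr2n lerD.
  by rewrite ler_peMr ?mulr_ge0// mulrC ler_pdivlMr// mul1r.
rewrite ler_wpDr ?mulr_ge0 ?invr_ge0 ?(ltW r0)//.
have SP z : `|z| <= K -> S z by rewrite /S /= in_itv/= -ler_norml.
have [xK|Kx] := leP `|x| K; first by apply: hr => //; exact: SP.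
have [yK|Ky] := leP `|y| K; last by rewrite !gK// subrr normr0 ltW.
by rewrite distrC hr//; [exact: SP|rewrite distrC].
Qed.

Section levy.
Variable R : realType.
Local Notation leb := (@lebesgue_measure R).
Local Notation RR := (measurableTypeR R).

(** The mean absolute deviation of the Gaussian law is at most [sqrt 2 * |s|]. *)
Lemma normal_smoothing_error (g : R -> R) (s e C x : R) :
  bmf (g : RR -> R) -> s != 0 -> 0 <= C ->
  (forall x y, `|g x - g y| <= e + C * `|x - y|) ->
  `|Ex (normal_prob x s) (g : RR -> R) - g x| <= e + C * (Num.sqrt 2 * `|s|).
Proof.
move=> bg s0 C0 gC.
have s20 : Num.sqrt 2 * s != 0 by rewrite mulf_neq0// sqrtr_eq0 -ltNge.
rewrite -[X in _ - X](Ex_cst (normal_prob x s)) -ExB//; last exact: bmf_cst.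
have bgx : bmf (fun y : RR => g y - g x) by apply: bmfB => //; exact: bmf_cst.
apply: (le_trans (Ex_norm_le _ bgx)).
have bn := bmf_norm bgx; rewrite (Ex_normal x s bn).
pose D := C * (Num.sqrt 2 * `|s|).
have i1 : leb.-integrable setT (fun y : RR => (e * normal_pdf x s y)%:E).
  exact: (integrable_bmf_pdf x s (bmf_cst _ e)).
have i2 : leb.-integrable setT (fun y : RR => (D * normal_pdf x (Num.sqrt 2 * s) y)%:E).
  exact: (integrable_bmf_pdf x (Num.sqrt 2 * s) (bmf_cst _ D)).
apply: (@le_trans _ _ (Rintegral leb setT (fun y : RR =>
   e * normal_pdf x s y + D * normal_pdf x (Num.sqrt 2 * s) y))).
  apply: le_Rintegral => //.
  - exact: integrable_bmf_pdf.
  - by have := integrableD measurableT i1 i2.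
  move=> y _; have p0 := normal_pdf_ge0 x s y.
  apply: (@le_trans _ _ ((e + C * `|y - x|) * normal_pdf x s y)).
    by rewrite ler_wpM2r.
  rewrite mulrDl lerD2l -mulrA /D -mulrA ler_wpM2l//.
  exact: normal_pdf_moment_le.
rewrite RintegralD//.
have E c t : Rintegral leb setT (fun y : RR => c * normal_pdf x t y) = c.
  rewrite RintegralZl//; last exact: integrable_normal_pdf.
  by rewrite /Rintegral integral_normal_pdf mulr1.
by rewrite !E.
Qed.

(** Up to normalization, the Gaussian is its own Fourier transform. *)
Lemma normal_fun_cos (m s x : R) : s != 0 ->
  normal_fun m s x = Ex (normal_prob 0 s^-1) (fun t : RR => cos (t * (x - m))).
Proof.
move=> s0; have := Ex_normal_cos 0 (invr_neq0 s0) (x - m).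
under eq_Rintegral do rewrite addr0.
by move=> ->; rewrite cos0 mulr1 /normal_fun; congr expR; field.
Qed.

Context d (T : measurableType d) (P : probability T R).

Let pdf_mean d' (U : measurableType d') (Q : probability U R) (m s : R) (Y : U -> RR) :
  measurable_fun setT Y -> s != 0 ->
  Ex Q (fun w => normal_pdf m s (Y w)) = normal_peak s *
  Ex (normal_prob 0 s^-1) (fun t : RR => Ex Q (fun w => cos (t * (Y w - m)))).
Proof.
move=> mY s0.
pose F (z : U * RR) := cos (z.2 * (Y z.1 - m)) : R.
have bF : bmf F.
  apply: bmf_cosC; apply: measurable_funM => //.
  apply: measurable_funB => //.
  by apply: measurableT_comp => //.
rewrite -(Ex_Fubini Q (normal_prob 0 s^-1) bF) -ExZ; last first.
  apply: bmf_ext (bmf_comp (f := normal_fun m s) (X := Y) _ mY) => [w|].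
    exact: normal_fun_cos.
  split; first exact: measurable_normal_fun.
  exists 1 => x; rewrite ger0_norm ?normal_fun_ge0// /normal_fun expR_le1.
  by rewrite mulNr oppr_le0 divr_ge0 ?sqr_ge0// mulrn_wge0// sqr_ge0.
congr (Rintegral _ _ _); apply/funext => w.
by rewrite normal_pdfMfun// (normal_fun_cos _ _ s0).
Qed.

(** Smoothing by a small Gaussian turns a test function into a mixture of
    Gaussian bumps. Each bump is an average of cosines over a Gaussian law of
    frequencies, so that its expectations converge by bounded convergence. *)
Theorem cvg_cos_cvg_test d' (U : measurableType d') (Q : probability U R)
    (Y : nat -> T -> RR) (Z : U -> RR) (g : R -> R) (K : R) :
  (forall n, measurable_fun setT (Y n)) -> measurable_fun setT Z ->
  (forall t b, Ex P (fun w => cos (t * Y n w + b)) @[n --> \oo] -->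
               Ex Q (fun w => cos (t * Z w + b))) ->
  continuous g -> (forall x, K < `|x| -> g x = 0) ->
  Ex P (fun w => g (Y n w)) @[n --> \oo] --> Ex Q (fun w => g (Z w)).
Proof.
move=> mY mZ YZ cg gK.
have [M hM] := continuous_compact_support_bounded cg gK.
have bg : bmf (g : RR -> R) := continuous_bmf cg hM.
have sm s : s != 0 -> bmf (fun x : RR => Ex (normal_prob x s) (g : RR -> R)) /\
    Ex P (fun w => Ex (normal_prob (Y n w) s) (g : RR -> R)) @[n --> \oo] -->
    Ex Q (fun w => Ex (normal_prob (Z w) s) (g : RR -> R)).
  move=> s0.
  have pk0 := normal_peak_gt0 s0.
  have o0 : (1 : R) != 0 by exact: oner_neq0.
  (* The Lebesgue integral over the locations of the bumps is written as an
     expectation under the standard Gaussian law, to which [G] is relative. *)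
  pose G (m : RR) := g m / normal_pdf 0 1 m.
  have [c c0 hc] : exists2 c : R, 0 < c & forall m, `|m| <= K -> c <= normal_pdf 0 1 m.
    exists (normal_peak 1 * expR (- K ^+ 2)).
      by rewrite mulr_gt0 ?expR_gt0// normal_peak_gt0.
    move=> m mK; rewrite normal_pdfMfun// ler_pM2l ?normal_peak_gt0// ler_expR.
    rewrite subr0 expr1n mulNr lerN2.
    have : m ^+ 2 <= K ^+ 2.
      by rewrite -real_normK ?num_real// lerXn2r// nnegrE// (le_trans _ mK).
    by have := sqr_ge0 m; lra.
  have bG : bmf G.
    split.
      apply: measurable_funM; first by case: bg.
      apply: continuous_measurable_fun => x; apply: cvgV; last exact: continuous_normal_pdf.
      by rewrite normal_pdfMfun// mulf_neq0 ?gt_eqF ?normal_peak_gt0// expR_gt0.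
    exists (M / c) => m; have [mK|Km] := leP `|m| K; last first.
      by rewrite /G gK// mul0r normr0 divr_ge0 ?(ltW c0)// (le_trans _ (hM 0)).
    rewrite /G normrM ler_pM// normfV lef_pV2 ?posrE//.
    - by rewrite (ger0_norm (normal_pdf_ge0 _ _ _)) hc.
    - by rewrite (lt_le_trans c0)// (le_trans (hc _ mK))// ler_norm.
  have bpdf : bmf (fun z : RR * RR => normal_pdf z.2 s z.1).
    split.
      under eq_fun do rewrite normal_pdfMfun//.
      apply: measurable_funM => //; apply: measurableT_comp => //.
      apply: measurable_funM => //; apply: measurableT_comp => //.
      by apply: measurable_funX; apply: measurable_funB.
    exists (normal_peak s) => z.
    by rewrite ger0_norm ?normal_pdf_ge0// normal_pdf_ub.
  have gE x : Ex (normal_prob x s) (g : RR -> R) =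
      Ex (normal_prob 0 1) (fun m : RR => G m * normal_pdf m s x).
    rewrite !Ex_normal//; last first.
      apply: bmfM => //.
      exact: (bmf_section1 (T := RR) (U := RR) x bpdf).
    apply: eq_Rintegral => m _; rewrite mulrAC /G divfK; last first.
      by rewrite normal_pdfMfun// mulf_neq0 ?gt_eqF ?normal_peak_gt0// expR_gt0.
    by rewrite !normal_pdfMfun// normal_funC.
  have bF d2 (V : measurableType d2) (W : V -> RR) : measurable_fun setT W ->
      bmf (fun z : RR * V => normal_pdf z.1 s (W z.2)).
    move=> mW; apply: (bmf_comp (X := fun z : RR * V => (W z.2, z.1)) bpdf).
    by apply: measurable_fun_pair => //; exact: measurableT_comp.
  have swap d2 (V : measurableType d2) (N : probability V R) (W : V -> RR) :
      measurable_fun setT W ->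
      Ex N (fun w => Ex (normal_prob (W w) s) (g : RR -> R)) =
      Ex (normal_prob 0 1) (fun m : RR => G m *
        Ex N (fun w => normal_pdf m s (W w))).
    move=> mW; under eq_Rintegral do rewrite gE.
    have bGF : bmf (fun z : RR * V => G z.1 * normal_pdf z.1 s (W z.2)).
      apply: bmfM; first exact: (bmf_comp bG).
      exact: bF.
    rewrite -(Ex_Fubini (normal_prob 0 1) N bGF); apply: eq_Rintegral => m _.
    rewrite /= ExZ//; exact: (bmf_section1 m (bF _ _ W mW)).
  split.
    under eq_fun do rewrite gE.
    apply: (bmf_Ex_section (normal_prob 0 1) (normal_prob 0 1)
      (F := fun z : RR * RR => G z.2 * normal_pdf z.2 s z.1)).
    by apply: bmfM => //; exact: (bmf_comp bG).
  rewrite swap//; under eq_fun do rewrite swap//.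
  have bp d2 (V : measurableType d2) (N : probability V R) (W : V -> RR) :
      measurable_fun setT W ->
      bmf (fun m : RR => Ex N (fun w => normal_pdf m s (W w))).
    by move=> mW; exact: (bmf_Ex_section (normal_prob 0 1) N (bF _ _ W mW)).
  have [_ [MG hMG]] := bG.
  apply: (@Ex_bounded_cvg _ _ _ _ _ _ (MG * normal_peak s)).
  - by move=> n; apply: bmf_measurable; apply: bmfM => //; exact: bp.
  - move=> n m; rewrite normrM ler_pM//; apply: Ex_norm_bound.
      exact: (bmf_section1 m (bF _ _ _ (mY n))).
    by move=> w; rewrite ger0_norm ?normal_pdf_ge0// normal_pdf_ub.
  - by apply: bmfM => //; exact: bp.
  move=> m; apply: cvgM; first exact: cvg_cst.
  rewrite (pdf_mean Q m mZ s0); under eq_fun do rewrite (pdf_mean P m (mY _) s0).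
  apply: cvgM; first exact: cvg_cst.
  have bc d2 (V : measurableType d2) (N : probability V R) (W : V -> RR) :
      measurable_fun setT W ->
      bmf (fun t : RR => Ex N (fun w => cos (t * (W w - m)))).
    move=> mW.
    have b : bmf (fun z : RR * V => cos (z.1 * (W z.2 - m)) : R).
      apply: bmf_cosC; apply: measurable_funM => //.
      apply: measurable_funB => //.
      exact: measurableT_comp.
    exact: (bmf_Ex_section (normal_prob 0 1) N b).
  apply: (@Ex_bounded_cvg _ _ _ _ _ _ 1).
  - by move=> n; apply: bmf_measurable; exact: bc.
  - move=> n t; apply: Ex_norm_bound; last by move=> w; exact: cos_max.
    apply: bmf_cosC; apply: measurable_funM; first exact: measurable_cst.
    by apply: measurable_funB; [exact: mY|exact: measurable_cst].
  - exact: bc.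
  move=> t; have E d2 (V : measurableType d2) (N : probability V R) (W : V -> RR) :
      Ex N (fun w => cos (t * (W w - m))) = Ex N (fun w => cos (t * W w + - (t * m))).
    by apply: eq_Rintegral => w _; rewrite mulrBr.
  by rewrite E; under eq_fun do rewrite E; exact: YZ.
apply/cvgrPdist_le => e e0.
have e6 : 0 < e / 6 by rewrite divr_gt0.
have e3 : 0 < e / 3 by rewrite divr_gt0.
have [C C0 hC] := continuous_compact_support_modulus cg gK e6.
pose s := e / 6 / ((C + 1) * Num.sqrt 2) : R.
have C1 : 0 < C + 1 by rewrite ltr_wpDl.
have q2 : 0 < Num.sqrt 2 :> R by rewrite sqrtr_gt0.
have s_gt0 : 0 < s by rewrite divr_gt0// mulr_gt0.
have s0 : s != 0 by rewrite gt_eqF.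
have err x : `|Ex (normal_prob x s) (g : RR -> R) - g x| <= e / 3.
  rewrite (le_trans (normal_smoothing_error x bg s0 C0 hC))//.
  rewrite (gtr0_norm s_gt0) [leRHS](_ : _ = e / 6 + e / 6); last by field.
  rewrite lerD2l (_ : C * _ = e / 6 * (C / (C + 1))); last first.
    by rewrite /s; field; rewrite !gt_eqF.
  by rewrite ler_piMr ?(ltW e6)// ler_pdivrMr// mul1r lerDl.
have [bgs /cvgrPdist_le/(_ _ e3) gs_cvg] := sm s s0.
have errE d2 (V : measurableType d2) (N : probability V R) (W : V -> RR) :
    measurable_fun setT W ->
    `|Ex N (fun w => Ex (normal_prob (W w) s) (g : RR -> R)) -
      Ex N (fun w => g (W w))| <= e / 3.
  move=> mW; rewrite -[leRHS](Ex_cst N).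
  apply: Ex_normB => //; [exact: (bmf_comp bgs)|exact: (bmf_comp bg)|exact: bmf_cst].
near=> n.
have h1 := errE _ _ P _ (mY n); have h2 := errE _ _ Q _ mZ.
have h3 : `|Ex Q (fun w => Ex (normal_prob (Z w) s) (g : RR -> R)) -
    Ex P (fun w => Ex (normal_prob (Y n w) s) (g : RR -> R))| <= e / 3.
  by near: n; exact: gs_cvg.
move: h1 h2 h3; set a := Ex Q (fun w => g (Z w)); set b := Ex P (fun w => g (Y n w)).
set a' := Ex Q _; set b' := Ex P _ => h1 h2 h3.
rewrite (_ : a - b = (a' - b') - (a' - a) + (b' - b)); last by ring.
rewrite (_ : e = e / 3 + e / 3 + e / 3); last by field.
rewrite (le_trans (ler_normD _ _))// lerD//.
by rewrite (le_trans (ler_normB _ _))// lerD.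
Unshelve. all: by end_near. Qed.

End levy.

Section gaussian_limit.
Variable R : realType.
Local Notation RR := (measurableTypeR R).

Lemma Ex_gaussian_cos (v t b : R) : 0 <= v ->
  Ex (gaussian 0 v) (fun x : RR => cos (t * x + b)) =
  expR (- (t ^+ 2 * v / 2)) * cos b.
Proof.
move=> v0; rewrite /gaussian; case: eqVneq => [->|vn0].
  rewrite /Rintegral integral_dirac//.
    by rewrite diracE in_setT mul1e /= !mulr0 mul0r oppr0 expR0 mul1r add0r.
  apply/measurable_EFinP/bmf_measurable/bmf_cosC.
  by apply: measurable_funD => //; exact: measurable_funM.
have sv : Num.sqrt v != 0 by rewrite sqrtr_eq0 -ltNge lt_neqAle eq_sym vn0.
under eq_Rintegral do rewrite (mulrC t).
by rewrite (Ex_normal_cos _ sv) sqr_sqrtr//; congr (expR (- (_ / 2)) * _); rewrite mulrC.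
Qed.

Context d (T : measurableType d) (P : probability T R).

Lemma Ex_cvg_limit (u : nat -> T -> R) M : (forall n, measurable_fun setT (u n)) ->
  (forall n x, `|u n x| <= M) -> (forall x, u n x @[n --> \oo] --> (1 : R)) ->
  Ex P (u n) @[n --> \oo] --> (1 : R).
Proof.
move=> mu uM u1; rewrite -[X in _ --> X](Ex_cst P).
by apply: (@Ex_bounded_cvg _ _ _ _ _ _ M) => //; exact: bmf_cst.
Qed.

End gaussian_limit.

Section cutoff.
Variable R : realType.
Local Notation RR := (measurableTypeR R).

Let chi (k : nat) (x : R) : R := Num.max 0 (Num.min 1 (k.+1%:R - `|x|)).

Let chi01 k x : 0 <= chi k x <= 1.
Proof. by rewrite /chi le_max lexx/= ge_max ler01/= ge_min lexx. Qed.

Let cchi k : continuous (chi k).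
Proof.
move=> x.
apply: (@continuous_max R R^o (fun=> 0) (fun x => Num.min 1 (k.+1%:R - `|x|)) x).
  exact: cvg_cst.
apply: (@continuous_min R R^o (fun=> 1) (fun x => k.+1%:R - `|x|) x).
  exact: cvg_cst.
by apply: cvgB; [exact: cvg_cst|exact: norm_continuous].
Qed.

Let chi_supp k x : k.+1%:R < `|x| -> chi k x = 0.
Proof.
move=> kx; rewrite /chi; apply/max_idPl; rewrite ge_min; apply/orP; right.
by rewrite subr_le0 ltW.
Qed.

Let chi_one k x : `|x| <= k%:R -> chi k x = 1.
Proof.
move=> xk; have h : 1 <= k.+1%:R - `|x| by rewrite -natr1 lerBrDl lerD2r.
by rewrite /chi (min_idPl h); apply/max_idPr.
Qed.

Context d (T : measurableType d) (P : probability T R).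
Context d' (U : measurableType d') (Q : probability U R).

(** The limit law puts little mass far out, and so do the laws close to it: a
    cut-off test function therefore loses little mass along the sequence. *)
Lemma cvg_test_bounded (Y : nat -> T -> RR) (Z : U -> RR) :
  (forall n, measurable_fun setT (Y n)) -> measurable_fun setT Z ->
  (forall (g : R -> R) (K : R), continuous g -> (forall x, K < `|x| -> g x = 0) ->
    Ex P (fun w => g (Y n w)) @[n --> \oo] --> Ex Q (fun w => g (Z w))) ->
  forall f : R -> R, continuous f -> (exists M, forall x, `|f x| <= M) ->
    Ex P (fun w => f (Y n w)) @[n --> \oo] --> Ex Q (fun w => f (Z w)).
Proof.
move=> mY mZ H f cf [M fM].
have M0 : 0 <= M by rewrite (le_trans _ (fM 0)).
have bf : bmf (f : RR -> R) := continuous_bmf cf fM.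
have bchi k : bmf (chi k : RR -> R).
  apply: (@continuous_bmf _ _ 1) => // x.
  by have /andP[h1 h2] := chi01 k x; rewrite ger0_norm.
have chi1 : Ex Q (fun w => chi k (Z w)) @[k --> \oo] --> (1 : R).
  apply: (@Ex_cvg_limit _ _ _ _ _ 1).
  - by move=> k; apply: bmf_measurable; exact: (bmf_comp (bchi k)).
  - by move=> k x; have /andP[h1 h2] := chi01 k (Z x); rewrite ger0_norm.
  - move=> x; apply: cvg_near_cst; near=> k; rewrite chi_one//.
    by near: k; exact: nbhs_infty_ger.
apply/cvgrPdist_le => e e0.
pose e' := e / (4 * (M + 1)).
have M1 : 0 < M + 1 by rewrite ltr_wpDl.
have e'0 : 0 < e' by rewrite divr_gt0// mulr_gt0.
have e4 : 0 < e / 4 by rewrite divr_gt0.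
have Me' : M * e' <= e / 4.
  rewrite (_ : M * e' = e / 4 * (M / (M + 1))); last by rewrite /e'; field; rewrite gt_eqF.
  by rewrite ler_piMr ?(ltW e4)// ler_pdivrMr// mul1r lerDl.
have [k hk] : exists k, `|1 - Ex Q (fun w => chi k (Z w))| <= e' / 2.
  have e'2 : 0 < e' / 2 by rewrite divr_gt0.
  have /cvgrPdist_le /(_ _ e'2) := chi1.
  by move=> h; have [k hk] := filter_ex h; exists k.
have cfc : continuous (fun x => f x * chi k x) by move=> x; apply: cvgM; [exact: cf|exact: cchi].
have s1 : forall x, k.+1%:R < `|x| -> f x * chi k x = 0 by move=> x kx; rewrite chi_supp// mulr0.
have e'2 : 0 < e' / 2 by rewrite divr_gt0.
have /cvgrPdist_le /(_ _ e'2) H1 := H _ _ (@cchi k) (@chi_supp k).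
have /cvgrPdist_le /(_ _ e4) H2 := H _ _ cfc s1.
have errE d2 (V : measurableType d2) (N : probability V R) (W : V -> RR) :
    measurable_fun setT W ->
    `|Ex N (fun w => f (W w)) - Ex N (fun w => f (W w) * chi k (W w))| <=
    M * (1 - Ex N (fun w => chi k (W w))).
  move=> mW; have bfW := bmf_comp bf mW; have bcW := bmf_comp (bchi k) mW.
  have b1 := bmf_cst V (1 : R).
  rewrite -[X in M * (X - _)](Ex_cst N) -(ExB N b1 bcW) -(ExZ N M (bmfB b1 bcW)).
  apply: Ex_normB => //; [exact: bmfM|by apply: bmfZ; exact: bmfB|].
  move=> w; rewrite -{1}[f (W w)]mulr1 -mulrBr normrM ler_pM//.
  by rewrite ger0_norm// subr_ge0; have /andP[] := chi01 k (W w).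
near=> n.
have h1 : `|Ex Q (fun w => chi k (Z w)) - Ex P (fun w => chi k (Y n w))| <= e' / 2.
  by near: n.
have h2 : `|Ex Q (fun w => f (Z w) * chi k (Z w)) -
            Ex P (fun w => f (Y n w) * chi k (Y n w))| <= e / 4 by near: n.
have h3 := errE _ _ P _ (mY n); have h4 := errE _ _ Q _ mZ.
move: h1 h2 h3 h4 hk.
set A := Ex Q (fun w => chi k (Z w)); set B := Ex P (fun w => chi k (Y n w)).
set a := Ex Q (fun w => f (Z w)); set b := Ex P (fun w => f (Y n w)).
set a' := Ex Q (fun w => f (Z w) * _); set b' := Ex P (fun w => f (Y n w) * _).
move=> h1 h2 h3 h4 hk.
have h5 : M * (1 - A) <= e / 4.
  rewrite (le_trans _ Me')// ler_wpM2l// (le_trans (ler_norm _))// (le_trans hk)//.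
  by rewrite ler_pdivrMr// ler_peMr ?ler1n// ltW.
have h6 : M * (1 - B) <= e / 4.
  rewrite (le_trans _ Me')// ler_wpM2l//.
  rewrite (_ : 1 - B = (1 - A) + (A - B)); last by ring.
  rewrite (le_trans (ler_norm _))// (le_trans (ler_normD _ _))//.
  by rewrite [leRHS](splitr e') lerD.
rewrite (_ : a - b = (a - a') + (a' - b') - (b - b')); last by ring.
rewrite (@le_trans _ _ (e / 4 + e / 4 + e / 4))//; last by lra.
rewrite (le_trans (ler_normB _ _))// lerD//; last exact: (le_trans h3).
by rewrite (le_trans (ler_normD _ _))// lerD//; exact: (le_trans h4).
Unshelve. all: by end_near. Qed.

End cutoff.

(** * A central limit theorem for triangular arrays *)
Section clt.
Context d (T : measurableType d) (R : realType) (P : probability T R).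
Context d' (U : measurableType d') (X : nat -> T -> U) (Xs : T -> U).
Hypothesis mX : forall l, measurable_fun setT (X l).
Hypothesis mXs : measurable_fun setT Xs.
Hypothesis iX : mutually_independent P X.
Hypothesis hid : forall l, identically_distributed P (X l) Xs.

(** The summands are uniformly small, which is the strongest form of the Lindeberg
    condition; they need not be centered, only their total mean must vanish in the
    limit. *)
Theorem iid_array_clt (h : nat -> U -> R) (e : nat -> R) (v : R) :
  (forall n, bmf (h n)) -> (forall n u, `|h n u| <= e n) ->
  e n @[n --> \oo] --> (0 : R) -> 0 <= v ->
  n%:R * Ex P (fun w => h n (Xs w) ^+ 2) @[n --> \oo] --> v ->
  n%:R * Ex P (fun w => h n (Xs w)) @[n --> \oo] --> (0 : R) ->
  forall (g : R -> R) (K : R), continuous g -> (forall x, K < `|x| -> g x = 0) ->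
  Ex P (fun w => g (\sum_(l < n) h n (X l w))) @[n --> \oo] -->
  Ex (gaussian 0 v) (g : measurableTypeR R -> R).
Proof.
move=> bh he e0 v0 h2 h1 g K cg gK.
have mS n : measurable_fun setT (fun w => \sum_(l < n) h n (X l w)).
  by apply: bmf_measurable; apply: bmf_sum => l; exact: (bmf_comp (bh n)).
apply: (@cvg_cos_cvg_test R _ _ P _ _ (gaussian 0 v) _ idfun g K mS) => //.
  exact: measurable_id.
move=> t b; rewrite Ex_gaussian_cos//.
pose c n := n%:R * Ex P (fun w => h n (Xs w) ^+ 2).
pose m n := n%:R * Ex P (fun w => h n (Xs w)).
pose B n := `|t ^+ 2 * c n - t ^+ 2 * v| + (t ^+ 2 * v) ^+ 2 / n%:R +
  (`|t| * e n + (`|t| * e n) ^+ 2) * (t ^+ 2 * c n) + `|t * m n|.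
have B0 : B n @[n --> \oo] --> (0 : R).
  rewrite (_ : 0 = `|t ^+ 2 * v - t ^+ 2 * v| + (t ^+ 2 * v) ^+ 2 * 0 +
    (`|t| * 0 + (`|t| * 0) ^+ 2) * (t ^+ 2 * v) + `|t * 0|); last first.
    by rewrite subrr !mulr0 normr0 expr0n/=; ring.
  have kc k (u : nat -> R) l : u n @[n --> \oo] --> l -> k * u n @[n --> \oo] --> k * l.
    by move=> ul; apply: cvgM => //; exact: cvg_cst.
  apply: cvgD; [apply: cvgD; [apply: cvgD|]|].
  - by apply: cvg_norm; apply: cvgB; [exact: kc|exact: cvg_cst].
  - apply: kc; rewrite -(cvg_shiftS (fun n : nat => n%:R^-1 : R)).
    exact: cvg_harmonic.
  - apply: cvgM; last exact: kc.
    apply: cvgD; first exact: kc.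
    rewrite expr2; under eq_fun do rewrite expr2.
    by apply: cvgM; exact: kc.
  - by apply: cvg_norm; exact: kc.
apply/cvgrPdist_le => eps eps0; near=> n.
have Bn : `|B n| <= eps by near: n; move/cvgr0Pnorm_le: B0; apply.
rewrite distrC; apply: le_trans Bn; apply: le_trans (ler_norm _).
have n0 : (0 < n)%N by near: n; exact: nbhs_infty_gt.
have te u : `|t * h n u| <= `|t| * e n by rewrite normrM ler_wpM2l.
have tv : 0 <= t ^+ 2 * v by rewrite mulr_ge0// sqr_ge0.
have := cos_iid_sum_le mX iX mXs hid b (bmfZ t (bh n)) n0 tv te.
have bhn := bmf_comp (bh n) mXs; have bhn2 := bmfX 2 bhn.
rewrite (ExZ P t bhn).
have -> : Ex P (fun w => (t * h n (Xs w)) ^+ 2) = t ^+ 2 * Ex P (fun w => h n (Xs w) ^+ 2).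
  by rewrite -(ExZ P _ bhn2); apply: eq_Rintegral => w _; rewrite exprMn.
have -> : Ex P (fun w => cos (t * \sum_(l < n) h n (X l w) + b)) =
          Ex P (fun w => cos (b + \sum_(l < n) t * h n (X l w))).
  by apply: eq_Rintegral => w _; rewrite addrC mulr_sumr.
by rewrite /B /c /m ![_ * (n%:R * _)]mulrCA.
Unshelve. all: by end_near. Qed.

End clt.

(** * Maxima of coordinates *)
Lemma continuous_bigmax (R : realType) (V : topologicalType) (I : Type)
    (r : seq I) (Q : pred I) (F : I -> V -> R^o) :
  (forall i, continuous (F i)) ->
  continuous (fun x => \big[Num.max/0]_(i <- r | Q i) F i x : R^o).
Proof.
move=> cF x; elim: r => [|i r IH].
  rewrite (_ : (fun _ => _) = cst 0); first exact: cvg_cst.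
  by apply/funext => y; rewrite big_nil.
case Qi: (Q i); last first.
  rewrite (_ : (fun _ => _) = (fun x => \big[Num.max/0]_(i <- r | Q i) F i x))//.
  by apply/funext => y; rewrite big_cons Qi.
rewrite (_ : (fun _ => _) =
  (fun x => Num.max (F i x) (\big[Num.max/0]_(i <- r | Q i) F i x))); last first.
  by apply/funext => y; rewrite big_cons Qi.
apply: (@continuous_max R V (F i) (fun x => \big[Num.max/0]_(i <- r | Q i) F i x) x) => //.
exact: cF.
Qed.

Section ell_theory.
Context {R : realType} {d : nat}.
Implicit Types (x v : 'rV[R]_d) (I J : {set 'I_d}).

Lemma continuous_rV_measurable (f : 'rV[R]_d -> R) :
  continuous (f : _ -> R^o) -> measurable_fun setT f.
Proof.
move=> /continuousP cf; apply: (measurability _ (RGenOpens.measurableE R)).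
move=> _ [_ [a [b ->] <-]]; rewrite setTI.
by apply: sub_sigma_algebra; apply: cf; exact: interval_open.
Qed.

Lemma continuous_coord (i : 'I_d) : continuous (fun x : 'rV[R]_d => x 0 i : R^o).
Proof. exact: coord_continuous. Qed.

Lemma measurable_coord (i : 'I_d) : measurable_fun setT (fun x : 'rV[R]_d => x 0 i).
Proof. by apply: continuous_rV_measurable; exact: continuous_coord. Qed.

Lemma continuous_ell I : continuous (ell I : 'rV[R]_d -> R^o).
Proof. by apply: continuous_bigmax => i; exact: continuous_coord. Qed.

Lemma measurable_ell I : measurable_fun setT (ell I : 'rV[R]_d -> R).
Proof. by apply: continuous_rV_measurable; exact: continuous_ell. Qed.

Lemma measurable_rV_norm : measurable_fun setT (fun x : 'rV[R]_d => `|x|).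
Proof. by apply: continuous_rV_measurable; exact: norm_continuous. Qed.

Lemma ell_ge0 I x : 0 <= ell I x.
Proof. exact: bigmax_ge_id. Qed.

Lemma le_ell I x i : i \in I -> x 0 i <= ell I x.
Proof. by move=> iI; exact: (le_bigmax_cond _ (fun i => x 0 i)). Qed.

Lemma ell_le I x c : 0 <= c -> (forall i, i \in I -> x 0 i <= c) -> ell I x <= c.
Proof. by move=> c0 xc; exact: bigmax_le. Qed.

Lemma ellZ I c x : 0 <= c -> ell I (c *: x) = c * ell I x.
Proof.
move=> c0; rewrite /ell big_endo ?mulr0//.
  by apply: eq_bigr => i _; rewrite mxE.
by move=> a b; rewrite maxr_pMr.
Qed.

Lemma ell_set1 i x : ell [set i]%SET x = Num.max (x 0 i) 0.
Proof. by rewrite /ell bigmax_set1. Qed.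

Lemma ell_subset I J x : I \subset J -> ell I x <= ell J x.
Proof.
move=> IJ; apply: ell_le; first exact: ell_ge0.
by move=> i iI; apply: le_ell; exact: (fintype.subsetP IJ).
Qed.

Lemma coord_le_norm x i : `|x 0 i| <= `|x|.
Proof.
rewrite [leRHS]/Num.norm /= mx_normrE.
exact: (le_bigmax _ (fun ij : 'I_1 * 'I_d => `|x ij.1 ij.2|) (0, i)).
Qed.

Lemma rV_norm_le x c : 0 <= c -> (forall i, `|x 0 i| <= c) -> `|x| <= c.
Proof.
move=> c0 xc; rewrite [leLHS]/Num.norm /= mx_normrE.
by apply: bigmax_le => // -[i j] _ /=; rewrite (ord1 i).
Qed.

Lemma ell_le_norm I x : ell I x <= `|x|.
Proof.
apply: ell_le => // i _.
exact: (le_trans (ler_norm _) (coord_le_norm _ _)).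
Qed.

End ell_theory.

Section almost_everywhere.
Context d (T : measurableType d) (R : realType) (P : probability T R).

Lemma ae_expectation (f g : T -> R) : measurable_fun setT f -> bmf g ->
  {ae P, forall w, f w = g w} -> 'E_P[f]%E = (Ex P g)%:E.
Proof.
move=> mf bg fg; rewrite -bmf_expectation// unlock; apply: ae_eq_integral => //.
- exact/measurable_EFinP.
- by apply/measurable_EFinP; exact: bmf_measurable.
- by apply: filterS fg => w -> _.
Qed.

Lemma ae_Ex (f g : T -> R) : bmf f -> bmf g ->
  {ae P, forall w, f w = g w} -> Ex P f = Ex P g.
Proof.
move=> bf bg fg; apply/EFin_inj; rewrite -(bmf_expectation P bf).
by apply: ae_expectation => //; exact: bmf_measurable.
Qed.

End almost_everywhere.

(** * Extremal coefficients as spectral means *)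
Section measurable_comparison.
Context d (T : measurableType d) (R : realType).
Implicit Types f g : T -> R.

Lemma measurable_set_le f g : measurable_fun setT f -> measurable_fun setT g ->
  measurable [set x | f x <= g x].
Proof.
by move=> mf mg; rewrite -[X in measurable X]setTI; exact: measurable_fun_le.
Qed.

Lemma measurable_set_lt f g : measurable_fun setT f -> measurable_fun setT g ->
  measurable [set x | f x < g x].
Proof.
move=> mf mg; rewrite (_ : [set x | _] = ~` [set x | g x <= f x]).
  by apply: measurableC; exact: measurable_set_le.
by apply/seteqP; split => x /=; rewrite ltNge => /negP.
Qed.

Lemma bmf_bool (b : T -> bool) : measurable [set x | b x] ->
  bmf (fun x => (b x)%:R : R).
Proof.
move=> mb; apply: bmf_ext (bmf_indic R mb) => x; rewrite indicE.
congr (nat_of_bool _)%:R.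
by apply/idP/idP => [/set_mem//|bx]; rewrite inE.
Qed.

Lemma bmf_le f g : measurable_fun setT f -> measurable_fun setT g ->
  bmf (fun x => (f x <= g x)%R%:R : R).
Proof. by move=> mf mg; apply: bmf_bool; exact: measurable_set_le. Qed.

Lemma bmf_lt f g : measurable_fun setT f -> measurable_fun setT g ->
  bmf (fun x => (f x < g x)%R%:R : R).
Proof. by move=> mf mg; apply: bmf_bool; exact: measurable_set_lt. Qed.

End measurable_comparison.

Lemma unit_cell_exists (R : realType) (m : nat) (y : R) : 0 < y <= m%:R ->
  exists2 j : 'I_m, j%:R < y & y <= j.+1%:R.
Proof.
move=> /andP[y0 ym]; set t := Num.truncn y.
have /andP[t1 t2] := truncn_itv (ltW y0); rewrite -/t in t1 t2.
have [ty|yt] := ltP t%:R y.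
  have tm : (t < m)%N by rewrite -(ltr_nat R) (lt_le_trans ty).
  by exists (Ordinal tm) => //=; exact: ltW.
have t0 : (0 < t)%N by rewrite -(ltr_nat R) (lt_le_trans y0).
have tm : (t.-1 < m)%N by rewrite prednK// -(ler_nat R) (le_trans t1).
by exists (Ordinal tm) => /=; rewrite ?prednK// (lt_le_trans _ t1)// ltr_nat prednK.
Qed.

Lemma unit_cell_uniq (R : realType) (j k : nat) (y : R) :
  j%:R < y -> y <= j.+1%:R -> k%:R < y -> y <= k.+1%:R -> j = k.
Proof.
move=> j1 j2 k1 k2; apply/eqP; rewrite eqn_leq.
rewrite -[(j <= k)%N]ltnS -[(k <= j)%N]ltnS -!(ltr_nat R).
by rewrite (lt_le_trans j1 k2) (lt_le_trans k1 j2).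
Qed.

Section polar.
Context {R : realType} {d : nat}.
Context dS (S : measurableType dS) (Q : probability S R).
Context (mu : {measure set 'rV[R]_d -> \bar R}) (Theta : S -> 'rV[R]_d).
Hypothesis mTheta : measurable_fun setT Theta.
Hypothesis spec : spectral_vector mu Q Theta.
Hypothesis mu_fin : (mu [set x | (1 < `|x|)%R] < +oo)%E.
Implicit Types I : {set 'I_d}.

(** A version of [ell I Theta] that is bounded everywhere, and not merely almost
    surely. *)
Definition ell_version I w : R :=
  ell I (Theta w) * (ell I (Theta w) <= 1)%R%:R.

Let mell I : measurable_fun setT (fun w => ell I (Theta w)).
Proof. by apply: measurableT_comp mTheta; exact: measurable_ell. Qed.

Lemma ell_version01 I w : 0 <= ell_version I w <= 1.
Proof.
rewrite /ell_version; case: (leP (ell I (Theta w)) 1) => h.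
  by rewrite mulr1 ell_ge0.
by rewrite mulr0 lexx ler01.
Qed.

Lemma bmf_ell_version I : bmf (ell_version I).
Proof.
split; first by apply: measurable_funM => //; apply: bmf_measurable; exact: bmf_le.
exists 1 => w; have /andP[h1 h2] := ell_version01 I w; by rewrite ger0_norm.
Qed.

Lemma ae_ell_version I : {ae Q, forall w, ell I (Theta w) = ell_version I w}.
Proof.
apply: filterS (sv_norm spec) => w w1; rewrite /ell_version.
have h : ell I (Theta w) <= 1 by rewrite -w1 ell_le_norm.
by rewrite h mulr1.
Qed.

(** The polar decomposition of [mu] is available on products of a half-line of radii
    and a set of directions. The cells slice the directions by the value of [ell I],
    and the slabs slice the set [ell I x > 1] accordingly: a slab lies between two
    such products. *)
Let cell (m j : nat) I : set 'rV[R]_d :=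
  [set x | j%:R < m%:R * ell I x] `&` [set x | m%:R * ell I x <= j.+1%:R].

Let slab (m j : nat) I : set 'rV[R]_d := [set x | 1 < ell I x] `&`
  ([set x | j%:R * `|x| < m%:R * ell I x] `&`
   [set x | m%:R * ell I x <= j.+1%:R * `|x|]).

Let mcell m j I : measurable (cell m j I).
Proof.
apply: measurableI; [apply: measurable_set_lt|apply: measurable_set_le] => //;
  by apply: measurable_funM => //; exact: measurable_ell.
Qed.

Let mslab m j I : measurable (slab m j I).
Proof.
have mn := @measurable_rV_norm R d; have ml := @measurable_ell R d I.
apply: measurableI; first exact: measurable_set_lt.
by apply: measurableI; [apply: measurable_set_lt|apply: measurable_set_le] => //;
  exact: measurable_funM.
Qed.

Let tau_ge0 : 0 <= tau mu. Proof. exact: fine_ge0. Qed.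

Let qcell m j I := Ex Q (\1_(Theta @^-1` cell m j I)).

Let mTcell m j I : measurable (Theta @^-1` cell m j I).
Proof. by rewrite -[X in measurable X]setTI; exact: mTheta. Qed.

Let Qcell m j I : Q (Theta @^-1` cell m j I) = (qcell m j I)%:E.
Proof. by rewrite /qcell Ex_indic// fineK// fin_num_measure. Qed.

Let cell_scale m j I x : 0 < `|x| ->
  cell m j I (`|x|^-1 *: x) <->
  (j%:R * `|x| < m%:R * ell I x) /\ (m%:R * ell I x <= j.+1%:R * `|x|).
Proof.
move=> x0; rewrite /cell /= ellZ ?invr_ge0//.
by rewrite mulrCA ![`|x|^-1 * _]mulrC ltr_pdivlMr// ler_pdivrMr.
Qed.

Let mu_slab_fin m j I : mu (slab m j I) \is a fin_num.
Proof.
rewrite ge0_fin_numE//; apply: le_lt_trans mu_fin; apply: le_measure.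
- by rewrite inE; exact: mslab.
- by rewrite inE; apply: measurable_set_lt => //; exact: measurable_rV_norm.
- by move=> x [/= x1 _]; exact: (lt_le_trans x1 (ell_le_norm _ _)).
Qed.

Let mpolar m j I r : 0 <= r -> measurable
  [set x : 'rV[R]_d | r < `|x| /\ cell m j I (`|x|^-1 *: x)].
Proof.
move=> r0; have mn := @measurable_rV_norm R d; have ml := @measurable_ell R d I.
rewrite (_ : [set x | _] = [set x | r < `|x|] `&`
  ([set x | j%:R * `|x| < m%:R * ell I x] `&`
   [set x | m%:R * ell I x <= j.+1%:R * `|x|])); last first.
  by apply/seteqP; split => x /= [rx]; have x0 := le_lt_trans r0 rx;
    move/(cell_scale m j I x0).
apply: measurableI; first exact: measurable_set_lt.
by apply: measurableI; [apply: measurable_set_lt|apply: measurable_set_le] => //;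
  exact: measurable_funM.
Qed.

Let slab_le m j I : (0 < m)%N ->
  fine (mu (slab m j I)) <= tau mu * (j.+1%:R / m%:R) * qcell m j I.
Proof.
move=> m0; have m0' : 0 < m%:R :> R by rewrite ltr0n.
have r0 : 0 < m%:R / j.+1%:R :> R by rewrite divr_gt0.
have := sv_polar spec r0 (mcell m j I); rewrite Qcell -EFinM invf_div => E.
rewrite -lee_fin -E fineK//; apply: le_measure; rewrite ?inE//.
  by apply: mpolar; exact: ltW.
move=> x [/= x1 [x2 x3]].
have x0 : 0 < `|x| by rewrite (lt_le_trans _ (ell_le_norm I x))// (lt_trans _ x1).
split; last by apply/cell_scale.
rewrite ltr_pdivrMr// mulrC (lt_le_trans _ x3)// ltr_pMr//.
Qed.

Let slab_ge m j I : (0 < m)%N ->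
  tau mu * (j%:R / m%:R) * qcell m j I <= fine (mu (slab m j I)).
Proof.
move=> m0; have m0' : 0 < m%:R :> R by rewrite ltr0n.
case: j => [|j]; first by rewrite mul0r mulr0 mul0r fine_ge0.
have r0 : 0 < m%:R / j.+1%:R :> R by rewrite divr_gt0.
have := sv_polar spec r0 (mcell m j.+1 I); rewrite Qcell -EFinM invf_div => E.
rewrite -lee_fin -E fineK//; apply: le_measure; rewrite ?inE//.
  by apply: mpolar; exact: ltW.
move=> x /= [rx]; have x0 := lt_trans r0 rx; move/(cell_scale _ _ _ x0) => [x2 x3].
split => //=; rewrite -(ltr_pM2l m0') mulr1 (le_lt_trans _ x2)// ltW//.
by rewrite mulrC -ltr_pdivrMr.
Qed.

Let bcell m j I : bmf (\1_(Theta @^-1` cell m j I) : S -> R).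
Proof. exact: bmf_indic. Qed.

Let ecell m j I := Ex Q (fun w => ell_version I w * \1_(Theta @^-1` cell m j I) w).

Let ecell_bounds m (j : 'I_m) I :
  (j%:R / m%:R) * qcell m j I <= ecell m j I <= (j.+1%:R / m%:R) * qcell m j I.
Proof.
have m0' : 0 < m%:R :> R by rewrite ltr0n (leq_ltn_trans _ (ltn_ord j)).
have be : bmf (fun w => ell_version I w * \1_(Theta @^-1` cell m j I) w).
  by apply: bmfM => //; exact: bmf_ell_version.
rewrite /qcell -!ExZ//.
have H w : (j%:R / m%:R) * \1_(Theta @^-1` cell m j I) w <=
    ell_version I w * \1_(Theta @^-1` cell m j I) w <=
    (j.+1%:R / m%:R) * (\1_(Theta @^-1` cell m j I) w : R).
  rewrite indicE; case: (boolP (w \in _)) => [/set_mem [/= w1 w2]|_]; last first.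
    by rewrite !mulr0 lexx.
  rewrite !mulr1 /ell_version.
  have e1 : ell I (Theta w) <= 1.
    rewrite -(ler_pM2l m0') mulr1 (le_trans w2)// ler_nat.
    exact: ltn_ord.
  by rewrite e1 mulr1 ler_pdivrMr// ler_pdivlMr// ![_ * m%:R]mulrC w2 ltW.
by apply/andP; split; apply: Ex_le => //; try exact: bmfZ; move=> w;
  have /andP[] := H w.
Qed.

(** In the direction [t], the set [ell I x > 1] consists of the radii above
    [1 / ell I t], of mass [tau * ell I t]; slicing by the value of [ell I] makes the
    integral over directions a Riemann sum. *)
Lemma tauIE I : tauI mu I = tau mu * Ex Q (ell_version I).
Proof.
have key m : (0 < m)%N ->
    `|tauI mu I - tau mu * Ex Q (ell_version I)| <= tau mu / m%:R.
  move=> m0; have m0' : 0 < m%:R :> R by rewrite ltr0n.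
  have E1 : tauI mu I = \sum_(j < m) fine (mu (slab m j I)).
    rewrite /tauI.
    have -> : [set x | 1 < ell I x] = \big[setU/set0]_(j < m) slab m j I.
      rewrite -(bigcup_mkord m (fun j => slab m j I)); apply/seteqP; split => [x /= x1|x [j _ []//]].
      have x0 : 0 < `|x| by rewrite (lt_le_trans _ (ell_le_norm I x))// (lt_trans _ x1).
      have : 0 < m%:R * ell I x / `|x| <= m%:R.
        rewrite divr_gt0 ?mulr_gt0 ?(lt_trans _ x1)//=.
        by rewrite ler_pdivrMr// ler_pM2l// ell_le_norm.
      move=> /unit_cell_exists[j j1 j2]; exists j; first exact: ltn_ord.
      by split => //=; rewrite -ltr_pdivlMr// -ler_pdivrMr.
    rewrite measure_semi_additive_ord => [|j||].
    - by rewrite sum_fine// => j _; exact: mu_slab_fin.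
    - exact: mslab.
    - move=> j k _ _ [x [[/= x1 [j1 j2]] [_ [k1 k2]]]]; apply/val_inj => /=.
      have x0 : 0 < `|x| by rewrite (lt_le_trans _ (ell_le_norm I x))// (lt_trans _ x1).
      by apply: (@unit_cell_uniq _ _ _ (m%:R * ell I x / `|x|));
        rewrite ?ltr_pdivlMr// ?ler_pdivrMr.
    - by apply: bigsetU_measurable => j _; exact: mslab.
  have E2 : Ex Q (ell_version I) = \sum_(j < m) ecell m j I.
    rewrite -Ex_sum; last by move=> j; apply: bmfM => //; exact: bmf_ell_version.
    congr (Rintegral _ _ _); apply/funext => w.
    rewrite -mulr_sumr /ell_version; have [e1|e1] := leP (ell I (Theta w)) 1; last first.
      by rewrite !mulr0 mul0r.
    rewrite mulr1; have := ell_ge0 I (Theta w); rewrite le_eqVlt => /predU1P[<-|e0].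
      by rewrite mul0r.
    have : 0 < m%:R * ell I (Theta w) <= m%:R by rewrite mulr_gt0//= ler_piMr// ltW.
    move=> /unit_cell_exists[j j1 j2].
    rewrite (bigD1 j)//= big1 ?addr0; last first.
      move=> k kj; rewrite indicE memNset//= => -[/= k1 k2].
      by move/negP: kj; apply; apply/eqP/val_inj/(unit_cell_uniq k1 k2 j1 j2).
    by rewrite indicE mem_set ?mulr1.
  have q1 : \sum_(j < m) qcell m j I <= 1.
    rewrite /qcell -Ex_sum// -[leRHS](Ex_cst Q); apply: Ex_le.
    - exact: bmf_sum.
    - exact: bmf_cst.
    move=> w; have [[j hj]|H] := pselect (exists j : 'I_m, cell m j I (Theta w)).
      rewrite (bigD1 j)//= big1 ?addr0.
        by rewrite indicE mem_set.
      move=> k kj; rewrite indicE memNset//= => -[/= k1 k2].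
      by case: hj => j1 j2; move/negP: kj; apply; apply/eqP/val_inj/(unit_cell_uniq k1 k2 j1 j2).
    rewrite big1// => j _; rewrite indicE memNset// => hj; apply: H.
    by exists j.
  rewrite E1 E2 mulr_sumr -sumrB (le_trans (ler_norm_sum _ _ _))//.
  apply: (@le_trans _ _ (\sum_(j < m) tau mu / m%:R * qcell m j I)); last first.
    rewrite -mulr_sumr ler_piMr// divr_ge0// ltW//.
  apply: ler_sum => j _.
  have h1 := slab_le j I m0; have h2 := slab_ge j I m0.
  have /andP[h3 h4] := ecell_bounds j I.
  have h5 := ler_wpM2l tau_ge0 h3; have h6 := ler_wpM2l tau_ge0 h4.
  have E : tau mu * (j.+1%:R / m%:R) * qcell m j I =
     tau mu * (j%:R / m%:R) * qcell m j I + tau mu / m%:R * qcell m j I.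
    by rewrite -natr1; ring.
  rewrite !mulrA in h1 h2 h5 h6 E *; rewrite ler_norml; apply/andP; split; lra.
apply/eqP; rewrite -subr_eq0 -normr_eq0 eq_le normr_ge0 andbT.
apply/ler_addgt0Pr => e e0; rewrite add0r.
have [n hn] : exists n : nat, tau mu / e < n%:R.
  exists (Num.truncn (tau mu / e)).+1.
  by have /andP[] := truncn_itv (divr_ge0 tau_ge0 (ltW e0)).
have n0 : 0 < n%:R :> R by apply: le_lt_trans hn; rewrite divr_ge0// ltW.
apply: (le_trans (key n _)); first by rewrite -(ltr_nat R).
by rewrite ler_pdivrMr// mulrC -ler_pdivrMr// ltW.
Qed.

End polar.

(** * The tilted spectral vector *)
(** The inverse, with [0^-1 = 0], is the pointwise limit of the continuous
    functions [x / (x ^+ 2 + 1 / n.+1)]. *)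
Lemma measurable_invr (R : realType) :
  measurable_fun setT (GRing.inv : measurableTypeR R -> measurableTypeR R).
Proof.
pose f (n : nat) (x : R) := x / (x ^+ 2 + n.+1%:R^-1).
have fpos n x : 0 < x ^+ 2 + n.+1%:R^-1 :> R by rewrite ltr_wpDl ?sqr_ge0// invr_gt0.
apply: (@measurable_fun_cvg _ (measurableTypeR R) R setT (f : nat -> measurableTypeR R -> R)).
  move=> n; apply: continuous_measurable_fun => x.
  apply: cvgM; first exact: cvg_id.
  apply: cvgV; first by rewrite gt_eqF.
  by apply: cvgD; [exact: exprn_continuous|exact: cvg_cst].
move=> x _; have [->|x0] := eqVneq x 0.
  by rewrite invr0; under eq_fun do rewrite /f mul0r; exact: cvg_cst.
rewrite (_ : x^-1 = x / (x ^+ 2 + 0)); last first.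
  by rewrite addr0 expr2 invfM mulrA mulfV ?mul1r.
apply: cvgM; first exact: cvg_cst.
apply: cvgV; first by rewrite addr0 expf_neq0.
by apply: cvgD; [exact: cvg_cst|exact: cvg_harmonic].
Qed.

Lemma measurable_funV d (T : measurableType d) (R : realType) (f : T -> R) :
  measurable_fun setT f -> measurable_fun setT (fun x => (f x)^-1).
Proof. by move=> mf; apply: measurableT_comp mf; exact: measurable_invr. Qed.

(** The coordinates of the tilted vector with index in [I] lie in [0, 1] only almost
    surely; clipping makes them bounded everywhere without changing their moments. *)
Definition clip01 {R : realType} (x : R) : R := Num.min (Num.max x 0) 1.

Section clip01_theory.
Variable R : realType.
Implicit Types x : R.

Lemma clip01_itv x : 0 <= clip01 x <= 1.
Proof. by rewrite /clip01 le_min ler01 le_max lexx orbT/= ge_min lexx orbT. Qed.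

Lemma clip01_id x : 0 <= x <= 1 -> clip01 x = x.
Proof.
by move=> /andP[x0 x1]; rewrite /clip01 (max_idPl x0); exact/min_idPl.
Qed.

Lemma bmf_clip01 : bmf (clip01 : measurableTypeR R -> R).
Proof.
split; last first.
  by exists 1 => x; have /andP[h1 h2] := clip01_itv x; rewrite ger0_norm.
apply: continuous_measurable_fun => x.
apply: (@continuous_min R R^o (fun x => Num.max x 0) (fun=> 1) x); last exact: cvg_cst.
by apply: (@continuous_max R R^o idfun (fun=> 0) x); [exact: cvg_id|exact: cvg_cst].
Qed.

End clip01_theory.

Section tilted.
Context {R : realType} {d : nat}.
Context dS (S : measurableType dS) (Q : probability S R).
Context (mu : {measure set 'rV[R]_d -> \bar R}) (Theta : S -> 'rV[R]_d).
Hypothesis mTheta : measurable_fun setT Theta.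
Hypothesis spec : spectral_vector mu Q Theta.
Context (I : {set 'I_d}) (Thi : S -> 'rV[R]_d).
Hypothesis mThi : measurable_fun setT Thi.
Hypothesis tilt : tilted_law Q I Theta Thi.

Local Notation el := (fun w => ell I (Theta w)).
Local Notation ev := (ell_version Theta I).

Let mell : measurable_fun setT el.
Proof. by apply: measurableT_comp mTheta; exact: measurable_ell. Qed.

Let bev : bmf ev. Proof. exact: bmf_ell_version. Qed.

Let mratio i : measurable_fun setT (fun w => (el w)^-1 * Theta w 0 i).
Proof.
apply: measurable_funM; first exact: measurable_funV.
by apply: (measurableT_comp (f := fun x : 'rV[R]_d => x 0 i)) mTheta;
  exact: measurable_coord.
Qed.

Let tilt_coord (i : 'I_d) (B : set R) : measurable (B : set (measurableTypeR R)) ->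
  Q (Thi @^-1` [set x | B (x 0 i)]) =
  ((Ex Q ev)^-1 * Ex Q (fun w => \1_B ((el w)^-1 * Theta w 0 i) * ev w))%:E.
Proof.
move=> mB.
have mA : measurable [set x : 'rV[R]_d | B (x 0 i)].
  by rewrite -[X in measurable X]setTI; exact: measurable_coord.
rewrite tilt//.
have E1 : 'E_Q[ell I \o Theta]%E = (Ex Q ev)%:E.
  by apply: ae_expectation => //; exact: (ae_ell_version spec).
rewrite E1 /= EFinM; congr (_ * _)%E.
have b1 : bmf (fun w => \1_B ((el w)^-1 * Theta w 0 i) : R).
  exact: (bmf_comp (bmf_indic R mB) (mratio i)).
have E w : \1_[set x : 'rV[R]_d | B (x 0 i)] ((el w)^-1 *: Theta w) =
    \1_B ((el w)^-1 * Theta w 0 i) :> R.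
  by rewrite !indicE; congr (nat_of_bool _)%:R; apply/idP/idP => /set_mem h;
    apply/mem_set; move: h; rewrite /= mxE.
rewrite (_ : (fun w => _) = (fun w => \1_B ((el w)^-1 * Theta w 0 i) * el w)); last first.
  by apply/funext => w; rewrite E.
apply: ae_expectation.
- by apply: measurable_funM => //; exact: bmf_measurable.
- exact: bmfM.
- by apply: filterS (ae_ell_version spec I) => w ->.
Qed.

(** Where the density [ell I (Theta w)] does not vanish, a coordinate of [Theta w]
    in [I] divided by [ell I (Theta w)] lies in [0, 1]. *)
Lemma tilted_ae_itv : (forall w, orthant (Theta w)) ->
  {ae Q, forall w i, i \in I -> 0 <= Thi w 0 i <= 1}.
Proof.
move=> oT; apply: filter_forall => i; have [iI|] := boolP (i \in I); last first.
  by move=> _; exact: aeW.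
pose B : set R := ~` `[0, 1]%classic.
have mB : measurable (B : set (measurableTypeR R)).
  by apply: measurableC; exact: measurable_itv.
have := tilt_coord i mB.
rewrite [X in (_ * X)%:E](_ : _ = 0); last first.
  rewrite -[RHS](Ex_cst Q); apply: eq_Rintegral => w _.
  have [e0|e0] := eqVneq (ell I (Theta w)) 0.
     by rewrite (_ : ev w = 0) ?mulr0// /ell_version e0 mul0r.
  rewrite indicE memNset ?mul0r// /B /= => h; apply: h.
  have el0 : 0 < el w by rewrite lt_neqAle eq_sym e0 ell_ge0.
  rewrite in_itv/= mulr_ge0 ?invr_ge0 ?(ltW el0)//=; last exact: oT.
  by rewrite mulrC ler_pdivrMr// mul1r le_ell.
rewrite mulr0 => Q0.
have mQ : measurable (Thi @^-1` [set x : 'rV[R]_d | B (x 0 i)]).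
  rewrite -[X in measurable X]setTI; apply: mThi => //.
  by rewrite -[X in measurable X]setTI; exact: measurable_coord.
exists (Thi @^-1` [set x : 'rV[R]_d | B (x 0 i)]); split => // w /= nw; rewrite /B /= => h.
by apply: nw => _; move: h; rewrite in_itv.
Qed.

(** The density of the tilt cancels the denominator of [Theta_i / ell I Theta]. *)
Lemma tilted_mean i : (forall w, orthant (Theta w)) -> i \in I ->
  Ex Q (fun w => clip01 (Thi w 0 i)) =
  (Ex Q ev)^-1 * Ex Q (ell_version Theta [set i]%SET).
Proof.
move=> oT iI.
have mThic : measurable_fun setT (fun w => Thi w 0 i : measurableTypeR R).
  by apply: (measurableT_comp (f := fun x : 'rV[R]_d => x 0 i)) mThi; exact: measurable_coord.
have mrat : measurable_fun setT
    (fun w => (el w)^-1 * Theta w 0 i : measurableTypeR R) by exact: mratio.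
pose L1 (h : measurableTypeR R -> R) := Ex Q (fun w => h (Thi w 0 i) * 1).
pose L2 (h : measurableTypeR R -> R) :=
  (Ex Q ev)^-1 * Ex Q (fun w => h ((el w)^-1 * Theta w 0 i) * ev w).
have L12 : L1 (@clip01 R) = L2 (@clip01 R).
  apply: (@bounded_linear_ext _ (measurableTypeR R) R L1 L2) => //.
  - exact: (Ex_bounded_linear Q mThic (bmf_cst S (1:R))).
  - exact: (bounded_linearZ _ (Ex_bounded_linear Q mrat bev)).
  - move=> B mB; apply/EFin_inj; rewrite /L2 -tilt_coord//.
    have mQ : measurable (Thi @^-1` [set x : 'rV[R]_d | B (x 0 i)]).
      rewrite -[X in measurable X]setTI; apply: mThi => //.
      by rewrite -[X in measurable X]setTI; exact: measurable_coord.
    rewrite -[RHS]fineK ?fin_num_measure// -Ex_indic//; congr EFin.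
    by apply: eq_Rintegral => w _; rewrite mulr1.
  - exact: bmf_clip01.
have -> : Ex Q (fun w => clip01 (Thi w 0 i)) = L1 (@clip01 R).
  by apply: eq_Rintegral => w _; rewrite mulr1.
rewrite L12; congr (_ * _); apply: ae_Ex.
- by apply: bmfM => //; exact: (bmf_comp (@bmf_clip01 R)).
- exact: bmf_ell_version.
apply: filterS (sv_norm spec) => w w1; rewrite /ell_version.
have e1 J : ell J (Theta w) <= 1 by rewrite -w1 ell_le_norm.
rewrite !e1 !mulr1 ell_set1 (max_idPl (oT w i)).
have [e0|e0] := eqVneq (ell I (Theta w)) 0.
  by rewrite e0 mulr0; apply/eqP; rewrite eq_le oT -[leRHS]e0 le_ell.
have el0 : 0 < el w by rewrite lt_neqAle eq_sym e0 ell_ge0.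
rewrite clip01_id; first by rewrite -mulrA mulrCA mulVf// mulr1.
rewrite mulr_ge0 ?invr_ge0 ?(ltW el0)//=; last exact: oT.
by rewrite mulrC ler_pdivrMr// mul1r le_ell.
Qed.

End tilted.

(** * Faces of the simplex and quadratic forms *)
Lemma cvg_sumr (R : realType) (T I : Type) (F : set_system T) {FF : Filter F}
    (r : seq I) (Q : pred I) (f : I -> T -> R) (l : I -> R) :
  (forall i, Q i -> f i x @[x --> F] --> l i) ->
  \sum_(i <- r | Q i) f i x @[x --> F] --> \sum_(i <- r | Q i) l i.
Proof. by apply: cvg_big; exact: add_continuous. Qed.

Lemma nonneg_cvg0 (R : realType) (f g : nat -> R) :
  (\forall n \near \oo, 0 <= f n <= g n) ->
  g n @[n --> \oo] --> (0 : R) -> f n @[n --> \oo] --> (0 : R).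
Proof. by move=> fg g0; apply: (squeeze_cvgr fg _ g0); exact: cvg_cst. Qed.

(** For [i] in [I], the maximum with [0] keeps the ratio in [0, 1] also outside the
    orthant, where test functions must be bounded too. *)
Definition coord_ratio {R : realType} {d : nat} (I : {set 'I_d}) (x : 'rV[R]_d) (i : 'I_d) : R :=
  Num.max (x 0 i) 0 / ell I x.

Definition exceed {R : realType} {d : nat} (u : R) (I : {set 'I_d}) (x : 'rV[R]_d) : R :=
  (u < ell I x)%R%:R.

(** Unlike [dotv], it takes the second vector as a function of the index, such as a
    family of ratios or of clipped variables. *)
Definition wsum {R : realType} {d : nat} (I : {set 'I_d}) (v : 'rV[R]_d) (y : 'I_d -> R) : R :=
  \sum_(i in I) v 0 i * y i.

Section face_theory.
Context {R : realType} {d : nat} (I : {set 'I_d}).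
Implicit Types (x v w : 'rV[R]_d) (y : 'I_d -> R).

Lemma ratio_itv x i : i \in I -> 0 <= coord_ratio I x i <= 1.
Proof.
move=> iI; have l0 := ell_ge0 I x; rewrite /coord_ratio divr_ge0 ?le_max ?lexx ?orbT//=.
have [e0|e0] := eqVneq (ell I x) 0; first by rewrite e0 invr0 mulr0.
rewrite ler_pdivrMr ?mul1r ?ge_max ?l0 ?andbT ?le_ell//.
by rewrite lt_neqAle eq_sym e0.
Qed.

Lemma bmf_ratio i : i \in I -> bmf (fun x => coord_ratio I x i).
Proof.
move=> iI; split; last first.
  by exists 1 => x; have /andP[h1 h2] := ratio_itv x iI; rewrite ger0_norm.
apply: measurable_funM; last by apply: measurable_funV; exact: measurable_ell.
by rewrite -[X in measurable_fun _ X](_ : ell [set i]%SET = _);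
  [exact: measurable_ell|apply/funext => x; rewrite ell_set1].
Qed.

Lemma bmf_exceed u : bmf (exceed u I : 'rV[R]_d -> R).
Proof. by apply: bmf_lt; [exact: measurable_cst|exact: measurable_ell]. Qed.

Lemma exceed_itv u x : 0 <= exceed u I x <= 1.
Proof. by rewrite /exceed; case: (_ < _); rewrite ?lexx ?ler01. Qed.

Lemma exceed_sqr u x : exceed u I x ^+ 2 = exceed u I x.
Proof. by rewrite /exceed; case: (_ < _); rewrite ?expr1n// expr0n. Qed.

Lemma wsumB v w y : wsum I (v - w) y = wsum I v y - wsum I w y.
Proof. by rewrite -sumrB; apply: eq_bigr => i _; rewrite !mxE mulrBl. Qed.

Lemma wsum_midpoint v w y :
  wsum I (2^-1 *: (v + w)) y = (wsum I v y + wsum I w y) / 2.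
Proof.
rewrite -big_split mulr_suml; apply: eq_bigr => i _; rewrite !mxE /=; ring.
Qed.

Lemma wsum_delta i y : i \in I -> wsum I (delta_mx 0 i) y = y i.
Proof.
move=> iI; rewrite /wsum (bigD1 i)//= mxE !eqxx mul1r big1 ?addr0// => j /andP[_ ji].
by rewrite mxE eqxx /= (negbTE ji) mul0r.
Qed.

Lemma dotv_wsum v x : orthant x -> (forall i, i \notin I -> v 0 i = 0) ->
  dotv v x / ell I x = wsum I v (coord_ratio I x).
Proof.
move=> ox vI; rewrite /dotv /wsum mulr_suml [RHS]big_mkcond; apply: eq_bigr => i _.
case: ifPn => iI; last by rewrite vI// !mul0r.
by rewrite /coord_ratio (max_idPl (ox i)) mulrA.
Qed.

Lemma face_sum v : face I v -> \sum_(i in I) v 0 i = 1.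
Proof.
move=> [[_ v1] vI]; rewrite -v1 [LHS]big_mkcond; apply: eq_bigr => i _.
by case: ifPn => // /vI.
Qed.

Lemma face_ge0 v i : face I v -> 0 <= v 0 i.
Proof. by move=> [[ov _] _]; exact: ov. Qed.

Lemma face_le1 v i : face I v -> v 0 i <= 1.
Proof.
move=> fv; have [[ov <-] _] := fv; rewrite (bigD1 i)//= lerDl.
by apply: sumr_ge0 => j _; exact: ov.
Qed.

Lemma wsum_cst v c : face I v -> wsum I v (fun=> c) = c.
Proof. by move=> fv; rewrite /wsum -mulr_suml face_sum// mul1r. Qed.

Lemma wsum_itv v y : face I v -> (forall i, i \in I -> 0 <= y i <= 1) ->
  0 <= wsum I v y <= 1.
Proof.
move=> fv y01; apply/andP; split.
  by apply: sumr_ge0 => i iI; rewrite mulr_ge0 ?face_ge0//; case/andP: (y01 i iI).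
rewrite -(face_sum fv); apply: ler_sum => i iI.
by rewrite ler_piMr ?face_ge0//; case/andP: (y01 i iI).
Qed.

Lemma wsum_norm_le w y c : 0 <= c -> (forall i, i \in I -> `|y i| <= 1) ->
  (forall i, `|w 0 i| <= c) -> `|wsum I w y| <= c * #|I|%:R.
Proof.
move=> c0 y1 wc; rewrite (le_trans (ler_norm_sum _ _ _))//.
rewrite mulr_natr -sumr_const; apply: ler_sum => i iI.
by rewrite normrM -[leRHS]mulr1 ler_pM ?y1.
Qed.

Lemma face_midpoint v w : face I v -> face I w -> face I (2^-1 *: (v + w)).
Proof.
move=> fv fw; have [[ov v1] vI] := fv; have [[ow w1] wI] := fw; split; [split|].
- by move=> i; rewrite !mxE mulr_ge0 ?invr_ge0 ?addr_ge0.
- under eq_bigr do rewrite !mxE.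
  by rewrite -mulr_sumr big_split /= v1 w1; field.
- by move=> i iI; rewrite !mxE vI// wI// addr0 mulr0.
Qed.

Lemma face_delta i : i \in I -> face I (delta_mx 0 i : 'rV[R]_d).
Proof.
move=> iI; split; [split|].
- by move=> j; rewrite mxE; case: (_ && _).
- rewrite (bigD1 i)//= mxE !eqxx big1 ?addr0// => j ji.
  by rewrite mxE eqxx (negbTE ji).
- move=> j jI; rewrite mxE eqxx /=; case: eqP => // ji.
  by rewrite ji iI in jI.
Qed.

(** Comparing a minimizer with the midpoint of itself and a competitor gives
    quadratic growth, even where the quadratic form is degenerate. *)
Lemma quadratic_growth (q : 'rV[R]_d -> R) vm v :
  (forall v w, q (2^-1 *: (v + w)) = (q v + q w) / 2 - q (v - w) / 4) ->
  face I vm -> (forall w, face I w -> q vm <= q w) -> face I v ->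
  q (v - vm) / 2 <= q v - q vm.
Proof.
move=> hq fm minq fv.
by have := minq _ (face_midpoint fv fm); rewrite hq; lra.
Qed.

Lemma parallelogram (a b : R) : ((a + b) / 2) ^+ 2 = (a ^+ 2 + b ^+ 2) / 2 - (a - b) ^+ 2 / 4.
Proof. by field. Qed.

Let closed_level (f : 'rV[R]_d -> R) c : continuous (f : _ -> R^o) ->
  closed [set v | f v = c].
Proof.
move=> cf; rewrite (_ : [set v | _] = f @^-1` [set c]) //.
by apply: closed_comp; [move=> v _; exact: cf|exact: closed_eq].
Qed.

Let continuous_sum_coord : continuous (fun v : 'rV[R]_d => \sum_i v 0 i : R^o).
Proof.
move=> v; apply: (@cvg_sumr R 'rV[R]_d _ (nbhs v) _ _ _ (fun i (v : 'rV[R]_d) => v 0 i)).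
by move=> i _; exact: continuous_coord.
Qed.

Lemma face_compact : compact (face I : set 'rV[R]_d).
Proof.
apply: bounded_closed_compact.
  exists 1; split; first exact: num_real.
  move=> M M1 v /= fv; rewrite (le_trans _ (ltW M1))// rV_norm_le// => i.
  by rewrite ger0_norm ?face_ge0 ?face_le1.
rewrite (_ : face I = (\bigcap_i [set v | 0 <= v 0 i]) `&` [set v | \sum_i v 0 i = 1]
  `&` \bigcap_(i in [set i | i \notin I]) [set v | v 0 i = 0]); last first.
  apply/seteqP; split => v.
    by move=> [[ov v1] vI]; split => [|i /= iI]; [split => //= i _; exact: ov|exact: vI].
  by move=> [[ov v1] vI]; split; [split => // i; exact: ov|move=> i iI; exact: vI].
apply: closedI; [apply: closedI|].
- apply: closed_bigI => i _.
  by apply: (@closed_comp 'rV[R]_d R^o (fun v => v 0 i) [set x | 0 <= x]); [move=> v _; exact: continuous_coord|exact: closed_ge].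
- exact: closed_level continuous_sum_coord.
- by apply: closed_bigI => i _; apply: closed_level; exact: continuous_coord.
Qed.

Lemma face_net (e : R) : 0 < e -> exists s : seq 'rV[R]_d,
  (forall v, v \in s -> face I v) /\
  (forall v, face I v -> exists2 w, w \in s & `|v - w| < e).
Proof.
move=> e0; have := face_compact; rewrite compact_cover => /(_ _ (face I) (fun v => ball v e)).
case=> [v _|v fv|s sI scov]; first exact: ball_open.
  by exists v => //; exact: ballxx.
exists (finmap.enum_fset s); split => [v vs|v /scov[w ws]].
  by have := sI v vs; rewrite inE.
by rewrite /= -ball_normE /= distrC => h; exists w.
Qed.

Lemma sphere_compact : compact [set w : 'rV[R]_d |
  [/\ forall i, i \notin I -> w 0 i = 0, \sum_i w 0 i = 0 & `|w| = 1]].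
Proof.
apply: bounded_closed_compact.
  exists 1; split; first exact: num_real.
  by move=> M M1 v /= [_ _ ->]; exact: ltW.
rewrite (_ : [set w | _] = (\bigcap_(i in [set i | i \notin I]) [set v : 'rV[R]_d | v 0 i = 0]) `&`
  [set v : 'rV[R]_d | \sum_i v 0 i = 0] `&` [set v : 'rV[R]_d | `|v| = 1]); last first.
  apply/seteqP; split => v; first by move=> [vI v0 v1]; split => //; split.
  by move=> [[vI v0] v1]; split => // i iI; exact: vI.
apply: closedI; [apply: closedI|].
- by apply: closed_bigI => i _; apply: closed_level; exact: continuous_coord.
- exact: closed_level continuous_sum_coord.
- by apply: closed_level; exact: norm_continuous.
Qed.

(** By homogeneity it suffices to bound [q] from below on the unit sphere of the
    directions of total mass zero, which is compact. *)
Lemma coercive (q : 'rV[R]_d -> R) : continuous (q : _ -> R^o) ->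
  (forall c w, q (c *: w) = c ^+ 2 * q w) ->
  (forall w, (forall i, i \notin I -> w 0 i = 0) -> \sum_i w 0 i = 0 -> w != 0 -> 0 < q w) ->
  exists2 l, 0 < l & forall w, (forall i, i \notin I -> w 0 i = 0) ->
    \sum_i w 0 i = 0 -> l * `|w| ^+ 2 <= q w.
Proof.
move=> cq hq pq.
have nc := (iffLR (compact_near_coveringP _) sphere_compact) R (nbhs 0^'+)
     (fun r w => r <= q w) _.
have /nc near0 : forall w, [/\ forall i, i \notin I -> w 0 i = 0, \sum_i w 0 i = 0 & `|w| = 1] ->
   \forall w' \near w & r \near 0^'+, r <= q w'.
  move=> w [wI w0 w1]; have w_neq0 : w != 0 by rewrite -normr_gt0 w1.
  have qw := pq w wI w0 w_neq0.
  have q2 : 0 < q w / 2 by rewrite divr_gt0.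
  exists ([set w' | q w / 2 < q w'], [set r | r < q w / 2]) => /=.
    split; last exact: nbhs_right_lt.
    have /cvgrPdist_lt /(_ _ q2) := cq w; apply: filterS => w' /=.
    by rewrite ltr_norml => /andP[_]; lra.
  by move=> [w' r] /= [h1 h2]; rewrite ltW// (lt_trans h2).
have [l [l0 hl]] := filter_ex (filterI (nbhs_right_gt 0) near0).
exists l => // w wI w0; have [->|w_neq0] := eqVneq w 0.
  by rewrite normr0 expr0n mulr0; have := hq 0 0; rewrite scale0r expr0n mul0r => ->.
have n0 : 0 < `|w| by rewrite normr_gt0.
have := hl (`|w|^-1 *: w); rewrite hq => /(_ _).
rewrite exprVn mulrC ler_pdivlMr ?exprn_gt0//; apply; split => [i iI||].
- by rewrite mxE wI// mulr0.
- by under eq_bigr do rewrite mxE; rewrite -mulr_sumr w0 mulr0.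
- by rewrite normrZ normfV normr_id mulVf// gt_eqF.
Qed.

End face_theory.

(** * Measurability of the plug-in estimator *)
Section empirical_moments.
Context {R : realType} {d : nat} (T : Type) (X : nat -> T -> 'rV[R]_d).
Hypothesis oX : forall l w, orthant (X l w).
Context (n : nat) (u : R) (I : {set 'I_d}).
Implicit Types v : 'rV[R]_d.

Lemma MhatE v p w : (forall i, i \notin I -> v 0 i = 0) ->
  Mhat X n u I v p w =
  n%:R^-1 * \sum_(l < n) wsum I v (coord_ratio I (X l w)) ^+ p * exceed u I (X l w).
Proof.
by move=> vI; congr (_ * _); apply: eq_bigr => l _; rewrite dotv_wsum.
Qed.

Let n0 : 0 <= n%:R^-1 :> R. Proof. by rewrite invr_ge0. Qed.

Let e01 l w := exceed_itv I u (X l w).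
Let e0 l w : 0 <= exceed u I (X l w).
Proof. by have /andP[] := e01 l w. Qed.

Lemma Phat_ge0 w : 0 <= Phat X n u I w.
Proof. by rewrite mulr_ge0// sumr_ge0. Qed.

Lemma Phat_le1 w : Phat X n u I w <= 1.
Proof.
rewrite /Phat; have [->|n1] := posnP n; first by rewrite invr0 mul0r.
rewrite mulrC ler_pdivrMr ?ltr0n// mul1r -[leRHS]mulr1 -[X in X%:R * _]card_ord mulr_natl -sumr_const.
by apply: ler_sum => l _; have /andP[] := e01 l w.
Qed.

Let sqdist v v' w := n%:R^-1 * \sum_(l < n)
  wsum I (v - v') (coord_ratio I (X l w)) ^+ 2 * exceed u I (X l w).

Lemma vhat_face w v : is_vhat X n u I w v -> face I v.
Proof. by case. Qed.

Let face_out v : face I v -> forall i, i \notin I -> v 0 i = 0.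
Proof. by case. Qed.

(** If no observation exceeds the threshold, all the moments vanish; otherwise the
    denominator is a positive constant. *)
Lemma vhat_minimizer w v v' : is_vhat X n u I w v -> face I v' ->
  Mhat X n u I v 2 w <= Mhat X n u I v' 2 w.
Proof.
move=> [fv minv] fv'; have [P0|P0] := eqVneq (Phat X n u I w) 0.
  have M0 z : face I z -> Mhat X n u I z 2 w = 0.
    move=> fz; rewrite (MhatE _ _ (face_out fz)).
    have [n_eq0|n_gt0] := posnP n; first by rewrite n_eq0 invr0 mul0r.
    move/eqP: P0; rewrite /Phat mulf_eq0 invr_eq0 pnatr_eq0 -leqn0 leqNgt n_gt0 /=.
    rewrite psumr_eq0 => [/allP el0|l _]; last exact: e0.
    rewrite big1 ?mulr0// => l _; have := el0 l; rewrite mem_index_enum => /(_ isT)/=/eqP el.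
    by rewrite /exceed el mulr0.
  by rewrite !M0.
have P1 : 0 < Phat X n u I w by rewrite lt_neqAle eq_sym P0 Phat_ge0.
by have := minv _ fv'; rewrite lee_fin ler_pM2r// invr_gt0.
Qed.

Lemma Mhat_growth w v v' : is_vhat X n u I w v -> face I v' ->
  sqdist v' v w / 2 <= Mhat X n u I v' 2 w - Mhat X n u I v 2 w.
Proof.
move=> mv fv'; have fv := vhat_face mv.
pose q z := n%:R^-1 * \sum_(l < n) wsum I z (coord_ratio I (X l w)) ^+ 2 * exceed u I (X l w).
rewrite !(MhatE _ _ (face_out _))// -/(q v') -/(q v) -/(q (v' - v)).
apply: (quadratic_growth (I := I)) => //.
- move=> a b; rewrite /q -[in RHS]mulrDr -big_split/= -!mulrA -mulrBr !mulr_suml -sumrB.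
  congr (_ * _); apply: eq_bigr => l _.
  by rewrite wsum_midpoint parallelogram wsumB; ring.
- move=> z fz; rewrite /q -!(MhatE _ _ (face_out _))//.
  exact: vhat_minimizer.
Qed.

(** A consequence of [|t| <= eta + t ^+ 2 / eta]: directions that are close for the
    empirical quadratic form have close first moments. *)
Lemma Mhat1_close w v v' eta : face I v -> face I v' -> 0 < eta ->
  `|Mhat X n u I v' 1 w - Mhat X n u I v 1 w| <= eta + sqdist v' v w / eta.
Proof.
move=> fv fv' eta0; rewrite !(MhatE _ _ (face_out _))//.
rewrite -mulrBr -sumrB normrM (ger0_norm n0).
apply: (@le_trans _ _ (n%:R^-1 * \sum_(l < n) (eta * exceed u I (X l w) +
   wsum I (v' - v) (coord_ratio I (X l w)) ^+ 2 * exceed u I (X l w) / eta))); last first.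
  rewrite big_split/= mulrDr -mulr_suml mulrA lerD2r -mulr_sumr mulrCA.
  by rewrite ler_piMr ?(ltW eta0)//; exact: Phat_le1.
rewrite ler_wpM2l// (le_trans (ler_norm_sum _ _ _))//; apply: ler_sum => l _.
rewrite !expr1 -mulrBl -wsumB normrM (ger0_norm (e0 l w)) mulrAC -mulrDl ler_wpM2r//.
set a := wsum I _ _; have [h|h] := leP `|a| eta.
  by rewrite ler_wpDr// divr_ge0 ?sqr_ge0// ltW.
rewrite ler_wpDl ?(ltW eta0)// ler_pdivlMr// -[leRHS]real_normK ?num_real// expr2.
by rewrite ler_wpM2l// ltW.
Qed.

Lemma Mhat2_lipschitz w v v' c : face I v -> face I v' -> `|v - v'| <= c ->
  `|Mhat X n u I v 2 w - Mhat X n u I v' 2 w| <= 2 * (c * #|I|%:R).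
Proof.
move=> fv fv' vc; have c0 : 0 <= c by rewrite (le_trans _ vc).
have C0 : 0 <= 2 * (c * #|I|%:R) by rewrite !mulr_ge0.
rewrite !(MhatE _ _ (face_out _))// -mulrBr -sumrB normrM (ger0_norm n0).
apply: (@le_trans _ _ (n%:R^-1 * \sum_(l < n) (2 * (c * #|I|%:R)) * exceed u I (X l w))).
  rewrite ler_wpM2l// (le_trans (ler_norm_sum _ _ _))//; apply: ler_sum => l _.
  rewrite -mulrBl normrM (ger0_norm (e0 l w)) ler_wpM2r// subr_sqr -wsumB normrM mulrC.
  have y01 := fun i iI => @ratio_itv R d I (X l w) i iI.
  rewrite ler_pM//.
    have /andP[h1 h2] := wsum_itv fv y01; have /andP[h3 h4] := wsum_itv fv' y01.
    by rewrite ger0_norm ?addr_ge0// (_ : 2 = 1 + 1)// lerD.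
  apply: wsum_norm_le => // [i iI|i]; first by have /andP[h1 h2] := y01 i iI; rewrite ger0_norm.
  exact: le_trans (coord_le_norm _ _) vc.
by rewrite -mulr_sumr mulrCA ler_piMr//; exact: Phat_le1.
Qed.

End empirical_moments.

Lemma seq_argmin (R : realType) (E : eqType) (f : E -> R) (s : seq E) x : x \in s ->
  exists2 v, v \in s & forall v', v' \in s -> f v <= f v'.
Proof.
elim: s x => // y s IH x _; case: s IH => [_|z s IH].
  by exists y; rewrite ?mem_head// => v'; rewrite inE => /eqP ->.
have [v vs hv] := IH z (mem_head _ _).
have [yv|vy] := leP (f y) (f v).
  exists y; first exact: mem_head.
  move=> v'; rewrite inE => /predU1P[->//|v's].
  exact: (le_trans yv (hv _ v's)).
exists v; first by rewrite inE vs orbT.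
by move=> v'; rewrite inE => /predU1P[->|]; [exact: ltW|exact: hv].
Qed.

Section measurable_estimator.
Context {R : realType} {d : nat} dT (T : measurableType dT) (X : nat -> T -> 'rV[R]_d).
Hypothesis oX : forall l w, orthant (X l w).
Hypothesis mX : forall l, measurable_fun setT (X l).
Context (n : nat) (u : R) (I : {set 'I_d}).

Lemma bmf_wsum_ratio (v : 'rV[R]_d) : bmf (fun x => wsum I v (coord_ratio I x)).
Proof.
rewrite (_ : (fun x => _) = (fun x => \sum_(i < d)
    v 0 i * (if i \in I then coord_ratio I x i else 0))); last first.
  apply/funext => x; rewrite /wsum big_mkcond; apply: eq_bigr => i _.
  by case: ifP; rewrite ?mulr0.
apply: bmf_sum => i; apply: bmfZ; case: (boolP (i \in I)) => [iI|_]; last exact: bmf_cst.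
exact: bmf_ratio.
Qed.

Lemma bmf_Mhat v p : face I v -> bmf (fun w => Mhat X n u I v p w).
Proof.
move=> [_ vI]; rewrite (_ : (fun w => _) = (fun w => n%:R^-1 *
    \sum_(l < n) wsum I v (coord_ratio I (X l w)) ^+ p * exceed u I (X l w))); last first.
  by apply/funext => w; rewrite MhatE.
apply: bmfZ; apply: bmf_sum => l; apply: bmfM.
  by apply: bmfX; exact: (bmf_comp (bmf_wsum_ratio v)).
exact: (bmf_comp (bmf_exceed I u)).
Qed.

Lemma bmf_Phat : bmf (fun w => Phat X n u I w).
Proof. by apply: bmfZ; apply: bmf_sum => l; exact: (bmf_comp (bmf_exceed I u)). Qed.

(** Minimizers need not be unique, but by quadratic growth they all have the
    same first moment; it is the limit of the first moments of the approximate
    minimizers taken in finer and finer finite nets. *)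
Lemma measurable_inv_tauMK (vhat : T -> 'rV[R]_d) : I != finset.set0 ->
  (forall w, is_vhat X n u I w (vhat w)) ->
  measurable_fun setT (inv_tauMK X n u I vhat).
Proof.
move=> I0 hv.
have /choice[s hs] : forall m : nat, exists s : seq 'rV[R]_d,
    (forall v, v \in s -> face I v) /\
    (forall v, face I v -> exists2 w, w \in s & `|v - w| < m.+1%:R^-1).
  by move=> m; apply: face_net; rewrite invr_gt0.
(* [b m v] indicates that [v] minimizes over the [m]-th net, and [r m] is the
   largest first moment of such a [v]. *)
pose b m v w : R := \prod_(v' <- s m) (Mhat X n u I v 2 w <= Mhat X n u I v' 2 w)%R%:R.
pose r m w := \big[Num.max/0]_(v <- s m) (Mhat X n u I v 1 w * b m v w).
have bE m v w : b m v w =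
   (all (fun v' => Mhat X n u I v 2 w <= Mhat X n u I v' 2 w) (s m))%:R.
  rewrite /b; elim: (s m) => [|v' s' IH]; first by rewrite big_nil.
  by rewrite big_cons IH /=; case: (_ <= _); rewrite ?mul1r ?mul0r.
have mb m v : v \in s m -> bmf (b m v).
  move=> vs; suff H s' : (forall x, x \in s' -> x \in s m) -> bmf (fun w =>
      \prod_(v' <- s') (Mhat X n u I v 2 w <= Mhat X n u I v' 2 w)%R%:R : R) by exact: H.
  elim: s' => [_|v' s' IH s's].
    by under eq_fun do rewrite big_nil; exact: bmf_cst.
  under eq_fun do rewrite big_cons; apply: bmfM; last first.
    by apply: IH => x xs; apply: s's; rewrite inE xs orbT.
  apply: bmf_le; apply: bmf_measurable; apply: bmf_Mhat; apply: (hs m).1 => //.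
  by apply: s's; exact: mem_head.
have mr m : measurable_fun setT (r m).
  suff H s' : (forall x, x \in s' -> x \in s m) -> measurable_fun setT
      (fun w => \big[Num.max/0]_(v <- s') (Mhat X n u I v 1 w * b m v w)) by exact: H.
  elim: s' => [_|v' s' IH s's].
    by under eq_fun do rewrite big_nil; exact: measurable_cst.
  under eq_fun do rewrite big_cons; apply: measurable_maxr; last first.
    by apply: IH => x xs; apply: s's; rewrite inE xs orbT.
  have v's : v' \in s m by apply: s's; exact: mem_head.
  by apply: bmf_measurable; apply: bmfM; [apply: bmf_Mhat; exact: (hs m).1|exact: mb].
apply: (@measurable_fun_cvg _ _ _ _ (fun m w => r m w / Phat X n u I w)).
  move=> m; apply: measurable_funM => //; apply: measurable_funV.
  exact: (bmf_measurable bmf_Phat).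
move=> w _; apply: cvgM; last exact: cvg_cst.
have fh := vhat_face (hv w).
apply/cvgrPdist_le => e e0; near=> m.
have e2 : 0 < e / 2 by rewrite divr_gt0.
pose K : R := #|I|%:R.
have small : 4 * (m.+1%:R^-1 * K) / (e / 2) <= e / 2.
  rewrite ler_pdivrMr// mulrCA ler_pdivrMl// -ler_pdivrMr ?mulr_gt0//.
  apply: (@le_trans _ _ m%:R); last by rewrite ler_nat.
  by near: m; exact: nbhs_infty_ger.
have close v : v \in s m -> (forall v', v' \in s m -> Mhat X n u I v 2 w <= Mhat X n u I v' 2 w) ->
    `|Mhat X n u I v 1 w - Mhat X n u I (vhat w) 1 w| <= e.
  move=> vs minv; have fv := (hs m).1 v vs.
  rewrite (le_trans (Mhat1_close oX n u w fh fv e2))// [leRHS](splitr e) lerD2l.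
  apply: le_trans small; rewrite ler_wpM2r ?invr_ge0 ?(ltW e2)//.
  have := Mhat_growth oX (hv w) fv; set D := n%:R^-1 * _ => h1.
  have [v' v's vv'] := (hs m).2 _ fh; have fv' := (hs m).1 _ v's.
  have := Mhat2_lipschitz oX n u w fh fv' (ltW vv'); rewrite ler_norml => /andP[h2 _].
  have h3 := minv _ v's; rewrite -/K in h2.
  move: h1 h2 h3; set k := _ * K; set N1 := Mhat _ _ _ _ v _ _.
  set N2 := Mhat _ _ _ _ (vhat w) _ _; set N3 := Mhat _ _ _ _ v' _ _.
  move: D k N1 N2 N3 => D k N1 N2 N3; lra.
have [z zs _] := (hs m).2 _ fh.
have [v0 v0s minv0] := seq_argmin (fun v => Mhat X n u I v 2 w) zs.
have Mge0 v : face I v -> 0 <= Mhat X n u I v 1 w.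
  move=> fv; rewrite MhatE//; last by case: fv.
  rewrite mulr_ge0 ?invr_ge0// sumr_ge0// => l _; rewrite mulr_ge0//.
  by rewrite expr1; have /andP[] := wsum_itv fv (fun i iI => @ratio_itv R d I (X l w) i iI).
rewrite ler_norml; apply/andP; split.
  rewrite lerBrDl lerBlDr /r big_seq; apply: bigmax_le => [|v vs].
    by rewrite addr_ge0 ?Mge0// ltW.
  rewrite bE; case: allP => hall; last by rewrite mulr0 addr_ge0 ?Mge0// ltW.
  have := close v vs (fun v' v's => hall v' v's); rewrite mulr1 ler_norml => /andP[_]; lra.
have h : Mhat X n u I v0 1 w <= r m w.
  have := le_bigmax_seq (0 : R) v0 xpredT
    (fun v => Mhat X n u I v 1 w * b m v w) v0s isT.
  by rewrite bE (introT allP) ?mulr1.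
have := close v0 v0s minv0; rewrite ler_norml => /andP[h1 _]; lra.
Unshelve. all: by end_near. Qed.

End measurable_estimator.

(** * Asymptotics of the plug-in estimator *)
Section extremal_coefficients.
Context {R : realType} {d : nat}.
Context dT (T : measurableType dT) (P : probability T R).
Context dS (S : measurableType dS) (Q : probability S R).
Context (Xs : T -> 'rV[R]_d) (X : nat -> T -> 'rV[R]_d).
Context (a : R -> R) (mu : {measure set 'rV[R]_d -> \bar R}).
Context (Theta : S -> 'rV[R]_d) (ThetaI : {set 'I_d} -> S -> 'rV[R]_d) (u : nat -> R).
Hypothesis mXs : measurable_fun setT Xs.
Hypothesis mX : forall l, measurable_fun setT (X l).
Hypothesis mTheta : measurable_fun setT Theta.
Hypothesis mThetaI : forall J, measurable_fun setT (ThetaI J).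
Hypothesis oXs : forall w, orthant (Xs w).
Hypothesis oX : forall l w, orthant (X l w).
Hypothesis hid : forall l, identically_distributed P (X l) Xs.
Hypothesis a_pos : forall s, 0 < s -> 0 < a s.
Hypothesis mu_fin : (mu [set x | (1 < `|x|)%R] < +oo)%E.
Hypothesis normalized : forall i : 'I_d,
  ((a s)%:E * P [set w | (s < Xs w 0 i)%R])%E @[s --> +oo] --> 1%E.
Hypothesis spec : spectral_vector mu Q Theta.
Hypothesis tilt : forall J : {set 'I_d}, J != finset.set0 -> tilted_law Q J Theta (ThetaI J).
Hypothesis u_oo : u n @[n --> \oo] --> +oo.
Hypothesis k_oo : n%:R / a (u n) @[n --> \oo] --> +oo.
Hypothesis bias0 : forall (p : nat) (J : {set 'I_d}), (p <= 2)%N -> J != finset.set0 ->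
  ereal_sup
    [set ((Num.sqrt (n%:R / a (u n)))%:E *
          `| (a (u n))%:E * 'E_P[Mhat X n (u n) J (restrv J v) p]
             - (tauI mu J)%:E *
               'E_Q[(fun w => dotv (restrv J v) (ThetaI J w) ^+ p)%R] |)%E
    | v in simplex] @[n --> \oo] --> 0%E.

Implicit Types (J : {set 'I_d}) (v : 'rV[R]_d).

Definition clipped J w i : R := clip01 (ThetaI J w 0 i).

Local Notation sk n := (Num.sqrt (n%:R / a (u n))).

Definition tail_moment n J (f : ('I_d -> R) -> R) :=
  Ex P (fun w => f (coord_ratio J (Xs w)) * exceed (u n) J (Xs w)).

Lemma mThetaI_coord J i : measurable_fun setT (fun w => ThetaI J w 0 i).
Proof.
by apply: (measurableT_comp (f := fun x : 'rV[R]_d => x 0 i)) (mThetaI J); exact: measurable_coord.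
Qed.

Lemma bmf_clipped J i : bmf (fun w => clipped J w i).
Proof. exact: (bmf_comp (@bmf_clip01 R) (mThetaI_coord J i)). Qed.

Lemma bmf_wsum_clipped J v : bmf (fun w => wsum J v (clipped J w)).
Proof. by apply: bmf_sum => i; apply: bmfZ; exact: bmf_clipped. Qed.

Lemma measurable_dotv J v : measurable_fun setT (fun w => dotv v (ThetaI J w)).
Proof.
rewrite /dotv; elim: (index_enum _) => [|i r IH].
  by under eq_fun do rewrite big_nil; exact: measurable_cst.
under eq_fun do rewrite big_cons; apply: measurable_funD => //.
by apply: measurable_funM; [exact: measurable_cst|exact: mThetaI_coord].
Qed.

Lemma ae_dotv J v : J != finset.set0 -> (forall i, i \notin J -> v 0 i = 0) ->
  {ae Q, forall w, dotv v (ThetaI J w) = wsum J v (clipped J w)}.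
Proof.
move=> J0 vJ; have := tilted_ae_itv mTheta spec (mThetaI J) (tilt J0) (sv_orthant spec).
apply: filterS => w hw; rewrite /dotv /wsum [RHS]big_mkcond; apply: eq_bigr => i _.
case: ifPn => iJ; last by rewrite vJ// mul0r.
by rewrite /clipped clip01_id ?hw.
Qed.

Lemma near_a_pos : \forall n \near \oo, 0 < a (u n).
Proof.
have /cvgryPgt /(_ 0) := u_oo; apply: filterS => n; exact: a_pos.
Qed.

Lemma near_k_pos : \forall n \near \oo, 0 < n%:R / a (u n).
Proof. by have /cvgryPgt /(_ 0) := k_oo. Qed.

Lemma sk_oo : sk n @[n --> \oo] --> +oo.
Proof.
apply/cvgryPge => A; have /cvgryPge /(_ (A ^+ 2)) := k_oo; apply: filterS => n h.
rewrite (le_trans (ler_norm A))// -sqrtr_sqr ler_wsqrtr//.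
Qed.

Lemma Ex_Mhat n J v p : (0 < n)%N -> face J v ->
  'E_P[Mhat X n (u n) J v p]%E =
  (tail_moment n J (fun y => wsum J v y ^+ p))%:E.
Proof.
move=> n0 fv; rewrite (bmf_expectation P (bmf_Mhat oX mX n (u n) p fv)); congr EFin.
pose h x := wsum J v (coord_ratio J x) ^+ p * exceed (u n) J x.
have bh : bmf h by apply: bmfM; [apply: bmfX; exact: bmf_wsum_ratio|exact: bmf_exceed].
have vJ : forall i, i \notin J -> v 0 i = 0 by case: fv.
under eq_Rintegral do rewrite MhatE// -/(h _).
rewrite ExZ; last by apply: bmf_sum => l; exact: (bmf_comp bh).
rewrite Ex_sum; last by move=> l; exact: (bmf_comp bh).
under eq_bigr do rewrite (identically_distributed_Ex (mX _) mXs (hid _) bh).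
by rewrite sumr_const card_ord -[X in _ * X]mulr_natl mulKf// pnatr_eq0 -lt0n.
Qed.

(** The supremum in the bias condition dominates each direction of the face, and
    clipping changes the tilted vector only on a null set. *)
Lemma bias p J v : (p <= 2)%N -> J != finset.set0 -> face J v ->
  sk n * `|a (u n) * tail_moment n J (fun y => wsum J v y ^+ p)
    - tauI mu J * Ex Q (fun w => wsum J v (clipped J w) ^+ p)| @[n --> \oo] --> (0 : R).
Proof.
move=> p2 J0 fv; have [sv vJ] := fv.
set f := fun n : nat => _.
suff : (f n)%:E @[n --> \oo] --> 0%E by move/fine_cvg.
have rv : restrv J v = v.
  by apply/rowP => i; rewrite mxE; case: ifPn => // /vJ.
apply: (@squeeze_cvge _ _ _ _ (cst 0%E) _ _ _ _ _ (bias0 p2 J0)); last exact: cvg_cst.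
near=> n; apply/andP; split; first by rewrite lee_fin mulr_ge0.
apply: ereal_sup_ubound; exists v => //; rewrite rv Ex_Mhat//; last first.
  by near: n; exact: nbhs_infty_gt.
have -> : 'E_Q[(fun w => dotv v (ThetaI J w) ^+ p)%R]%E =
    (Ex Q (fun w => wsum J v (clipped J w) ^+ p))%:E.
  apply: ae_expectation.
  - by apply: measurable_funX; exact: measurable_dotv.
  - by apply: bmfX; exact: bmf_wsum_clipped.
  - by apply: filterS (ae_dotv J0 vJ) => w ->.
by rewrite /f /=.
Unshelve. all: by end_near. Qed.

Lemma sk_cvg0 (f : nat -> R) l : sk n * `|f n - l| @[n --> \oo] --> (0 : R) ->
  f n @[n --> \oo] --> l.
Proof.
move=> h; apply/cvgrPdist_le => e e0; have /cvgr0Pnorm_le /(_ _ e0) h1 := h.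
near=> n; have s1 : 1 <= sk n by near: n; have /cvgryPge /(_ 1) := sk_oo.
have : `|sk n * `|f n - l| | <= e by near: n.
rewrite ger0_norm ?mulr_ge0//; apply: le_trans; rewrite distrC.
by rewrite ler_peMl.
Unshelve. all: by end_near. Qed.

Lemma tail_moment_cvg p J v : (p <= 2)%N -> J != finset.set0 -> face J v ->
  a (u n) * tail_moment n J (fun y => wsum J v y ^+ p) @[n --> \oo] -->
  tauI mu J * Ex Q (fun w => wsum J v (clipped J w) ^+ p).
Proof. by move=> p2 J0 fv; apply: sk_cvg0; exact: bias. Qed.

Lemma tail_cvg J : J != finset.set0 ->
  a (u n) * tail_moment n J (fun=> 1) @[n --> \oo] --> tauI mu J.
Proof.
move=> J0; have /finset.set0Pn[i iJ] := J0.
have := tail_moment_cvg (leq0n 2) J0 (@face_delta R d J i iJ).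
by rewrite (_ : Ex Q _ = 1) ?mulr1//; exact: (Ex_cst Q 1).
Qed.

Let set1_neq0 (i : 'I_d) : [set i]%SET != finset.set0.
Proof. by apply/finset.set0Pn; exists i; rewrite inE. Qed.

(** The normalization of the margins and the bias condition of order zero evaluate
    the same limit. *)
Lemma tauI_set1 i : tauI mu [set i]%SET = 1.
Proof.
have h1 := tail_cvg (set1_neq0 i).
have h2 : ((a (u n))%:E * P [set w | (u n < Xs w 0 i)%R])%E @[n --> \oo] --> 1%E.
  exact: (cvg_comp _ _ u_oo (normalized i)).
have h3 : fine ((a (u n))%:E * P [set w | (u n < Xs w 0 i)%R])%E @[n --> \oo] --> (1 : R).
  exact: (fine_cvg h2).
suff h4 : a (u n) * tail_moment n [set i]%SET (fun=> 1) @[n --> \oo] --> (1 : R).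
  exact: (cvg_unique _ h1 h4).
apply: (cvg_trans _ h3); apply: near_eq_cvg; near=> n.
have u0 : 0 < u n by near: n; have /cvgryPgt /(_ 0) := u_oo.
rewrite /= /tail_moment.
have mA : measurable [set w | u n < Xs w 0 i].
  apply: measurable_set_lt => //.
  by apply: (measurableT_comp (f := fun x : 'rV[R]_d => x 0 i)) mXs; exact: measurable_coord.
have -> : Ex P (fun w => 1 * exceed (u n) [set i]%SET (Xs w)) =
   Ex P (fun w => \1_[set w | u n < Xs w 0 i] w).
  apply: eq_Rintegral => w _; rewrite mul1r /exceed ell_set1 indicE.
  rewrite (max_idPl (oXs w i)); congr (nat_of_bool _)%:R.
  by apply/idP/idP => [h|/set_mem//]; rewrite inE.
by rewrite Ex_indic// fineM ?fin_num_measure.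
Unshelve. all: by end_near. Qed.

Section fixed_set.
Context (I : {set 'I_d}).
Hypothesis I0 : I != finset.set0.
Local Notation tI := (tauI mu I).

Lemma tauI_ge1 : 1 <= tI.
Proof.
have /finset.set0Pn[i iI] := I0.
rewrite -(tauI_set1 i) /tauI fine_le//.
- rewrite ge0_fin_numE//; apply: le_lt_trans mu_fin; apply: le_measure.
  + by rewrite inE; apply: measurable_set_lt => //; exact: measurable_ell.
  + by rewrite inE; apply: measurable_set_lt => //; exact: measurable_rV_norm.
  + by move=> x /= x1; exact: (lt_le_trans x1 (ell_le_norm _ _)).
- rewrite ge0_fin_numE//; apply: le_lt_trans mu_fin; apply: le_measure.
  + by rewrite inE; apply: measurable_set_lt => //; exact: measurable_ell.
  + by rewrite inE; apply: measurable_set_lt => //; exact: measurable_rV_norm.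
  + by move=> x /= x1; exact: (lt_le_trans x1 (ell_le_norm _ _)).
- apply: le_measure.
  + by rewrite inE; apply: measurable_set_lt => //; exact: measurable_ell.
  + by rewrite inE; apply: measurable_set_lt => //; exact: measurable_ell.
  move=> x /= x1; apply: (lt_le_trans x1); apply: ell_subset.
  by apply/fintype.subsetP => j; rewrite inE => /eqP ->.
Qed.

Let tI_gt0 : 0 < tI. Proof. exact: lt_le_trans tauI_ge1. Qed.

(** Every coordinate has the same mean under the tilted law: the tilt divides
    [E Theta_i], which the normalization makes independent of [i]. *)
Lemma clipped_mean i : i \in I -> Ex Q (fun w => clipped I w i) = tI^-1.
Proof.
move=> iI; rewrite (tilted_mean mTheta spec (mThetaI I) (tilt I0) (sv_orthant spec) iI).
have tIE := tauIE mTheta spec mu_fin I.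
have := tauIE mTheta spec mu_fin [set i]%SET; rewrite tauI_set1 => t1.
set e := Ex Q (ell_version Theta I) in tIE *.
set ei := Ex Q _ in t1 *.
have e0 : e != 0 by apply: contraTneq tI_gt0 => e0; rewrite tIE e0 mulr0 ltxx.
have t0 : tau mu != 0 by apply: contraTneq tI_gt0 => t0; rewrite tIE t0 mul0r ltxx.
have -> : ei = (tau mu)^-1.
  by apply: (mulfI t0); rewrite -t1 mulfV.
by rewrite tIE invfM mulrC.
Qed.

Lemma wsum_mean v : face I v -> Ex Q (fun w => wsum I v (clipped I w)) = tI^-1.
Proof.
move=> fv; rewrite /wsum Ex_sum; last by move=> i; apply: bmfZ; exact: bmf_clipped.
rewrite -[RHS](wsum_cst _ fv) /wsum; apply: eq_bigr => i iI.
by rewrite ExZ ?clipped_mean//; exact: bmf_clipped.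
Qed.

Hypothesis iX : mutually_independent P X.

Lemma bmf_tail (f : ('I_d -> R) -> R) :
  bmf (fun x => f (coord_ratio I x)) ->
  forall n, bmf (fun x => f (coord_ratio I x) * exceed (u n) I x).
Proof. by move=> bf n; apply: bmfM => //; exact: bmf_exceed. Qed.

Lemma tail_momentD n (f g : ('I_d -> R) -> R) :
  bmf (fun x => f (coord_ratio I x)) -> bmf (fun x => g (coord_ratio I x)) ->
  tail_moment n I (fun y => f y + g y) = tail_moment n I f + tail_moment n I g.
Proof.
move=> bf bg; rewrite /tail_moment -ExD; last 2 first.
- exact: (bmf_comp (bmf_tail bf n)).
- exact: (bmf_comp (bmf_tail bg n)).
by apply: eq_Rintegral => w _; rewrite mulrDl.
Qed.

Lemma tail_momentZ n c (f : ('I_d -> R) -> R) :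
  bmf (fun x => f (coord_ratio I x)) ->
  tail_moment n I (fun y => c * f y) = c * tail_moment n I f.
Proof.
move=> bf; rewrite /tail_moment -ExZ; last exact: (bmf_comp (bmf_tail bf n)).
by apply: eq_Rintegral => w _; rewrite mulrA.
Qed.

Let b1 : bmf (fun x : 'rV[R]_d => (1 : R)). Proof. exact: bmf_cst. Qed.

Let bexc n : bmf (fun w => 1 * exceed (u n) I (Xs w)).
Proof. exact: (bmf_comp (bmf_tail (f := fun=> 1) b1 n) mXs). Qed.

Lemma k_inv_cvg0 : (n%:R / a (u n))^-1 @[n --> \oo] --> (0 : R).
Proof.
exact: ((gtr0_cvgV0 near_k_pos).2 k_oo).
Qed.

(** There are about [n / a (u n)] exceedances, so that the variance of the scaled
    sum is of order [a (u n) / n]. *)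
Lemma tail_wlln (f : ('I_d -> R) -> R) L :
  bmf (fun x => f (coord_ratio I x)) -> (forall x, `|f (coord_ratio I x)| <= 1) ->
  a (u n) * tail_moment n I f @[n --> \oo] --> L ->
  Ex P (fun w => (\sum_(l < n) (a (u n) / n%:R) *
     (f (coord_ratio I (X l w)) * exceed (u n) I (X l w)) - L) ^+ 2) @[n --> \oo] --> (0 : R).
Proof.
move=> bf f1 fL.
pose B n := (n%:R / a (u n))^-1 * (a (u n) * tail_moment n I (fun=> 1)) +
  (a (u n) * tail_moment n I f - L) ^+ 2.
have B0 : B n @[n --> \oo] --> (0 : R).
  rewrite (_ : 0 = 0 * tI + (L - L) ^+ 2); last by rewrite mul0r subrr expr0n add0r.
  apply: cvgD; first by apply: cvgM; [exact: k_inv_cvg0|exact: tail_cvg].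
  rewrite expr2; under eq_fun do rewrite expr2.
  by apply: cvgM; apply: cvgB => //; exact: cvg_cst.
apply: (nonneg_cvg0 _ B0).
near=> n; apply/andP; split; first by apply: Ex_ge0 => w; exact: sqr_ge0.
have n0 : (0 < n)%N by near: n; exact: nbhs_infty_gt.
have nR : n%:R != 0 :> R by rewrite pnatr_eq0 -lt0n.
have a0 : 0 < a (u n) by near: n; exact: near_a_pos.
pose h x := (a (u n) / n%:R) * (f (coord_ratio I x) * exceed (u n) I x).
have bh : bmf h by apply: bmfZ; exact: bmf_tail.
apply: (le_trans (iid_sum_sqr_le mX iX mXs hid n L bh)).
have bfX := bmf_comp (bmf_tail bf n) mXs.
apply: lerD.
  rewrite (_ : (n%:R / a (u n))^-1 * _ =
    n%:R * ((a (u n) / n%:R) ^+ 2 * tail_moment n I (fun=> 1))); last first.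
    by field; rewrite nR gt_eqF.
  rewrite ler_wpM2l// -(ExZ P _ (bexc n)).
  apply: Ex_le.
  - exact: (bmfX 2 (bmf_comp bh mXs)).
  - exact: (bmfZ _ (bexc n)).
  move=> w; rewrite /h exprMn mul1r ler_wpM2l ?sqr_ge0// exprMn exceed_sqr.
  rewrite ler_piMl//.
  by rewrite -[leLHS]real_normK ?num_real// expr_le1.
rewrite /h (ExZ P _ bfX) mulrA (_ : n%:R * _ = a (u n)) //.
by field.
Unshelve. all: by end_near. Qed.

Definition limit_moment i j := Ex Q (fun w => clipped I w i * clipped I w j).

Let bmf_pair i j : i \in I -> j \in I -> bmf (fun x : 'rV[R]_d => coord_ratio I x i * coord_ratio I x j).
Proof. by move=> iI jI; apply: bmfM; exact: bmf_ratio. Qed.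

(** Polarization: the bias condition concerns the squares for directions in the
    face, and the midpoint of two vertices is such a direction. *)
Lemma tail_pair_cvg i j : i \in I -> j \in I ->
  a (u n) * tail_moment n I (fun y => y i * y j) @[n --> \oo] -->
  tI * limit_moment i j.
Proof.
move=> iI jI.
pose vi : 'rV[R]_d := delta_mx 0 i; pose vj : 'rV[R]_d := delta_mx 0 j.
pose vm := 2^-1 *: (vi + vj).
have fi := face_delta iI : face I vi; have fj := face_delta jI : face I vj.
have fm := face_midpoint fi fj : face I vm.
have E y : y i * y j = 2 * wsum I vm y ^+ 2 +
    (- 2^-1 * wsum I vi y ^+ 2 + - 2^-1 * wsum I vj y ^+ 2) :> R.
  by rewrite wsum_midpoint !wsum_delta//; field.
have bw v : bmf (fun x => wsum I v (coord_ratio I x) ^+ 2).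
  by apply: bmfX; exact: bmf_wsum_ratio.
have bq v : bmf (fun w => wsum I v (clipped I w) ^+ 2).
  by apply: bmfX; exact: bmf_wsum_clipped.
have -> : limit_moment i j = 2 * Ex Q (fun w => wsum I vm (clipped I w) ^+ 2) +
   (- 2^-1 * Ex Q (fun w => wsum I vi (clipped I w) ^+ 2) +
    - 2^-1 * Ex Q (fun w => wsum I vj (clipped I w) ^+ 2)).
  rewrite -!ExZ// -!ExD//; try exact: bmfZ; last by apply: bmfD; exact: bmfZ.
  by apply: eq_Rintegral => w _; rewrite E.
have Em n : a (u n) * tail_moment n I (fun y => y i * y j) =
   2 * (a (u n) * tail_moment n I (fun y => wsum I vm y ^+ 2)) +
   (- 2^-1 * (a (u n) * tail_moment n I (fun y => wsum I vi y ^+ 2)) +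
    - 2^-1 * (a (u n) * tail_moment n I (fun y => wsum I vj y ^+ 2))).
  rewrite (_ : (fun y => y i * y j) = (fun y => 2 * wsum I vm y ^+ 2 +
    (- 2^-1 * wsum I vi y ^+ 2 + - 2^-1 * wsum I vj y ^+ 2))); last first.
    by apply/funext => y; rewrite E.
  rewrite tail_momentD; [|exact: bmfZ|by apply: bmfD; exact: bmfZ].
  rewrite tail_momentD; [|exact: bmfZ|exact: bmfZ].
  by rewrite !tail_momentZ//; ring.
under eq_fun do rewrite Em.
rewrite !mulrDr !(mulrCA tI).
have cv v : face I v -> a (u n) * tail_moment n I (fun y => wsum I v y ^+ 2) @[n --> \oo] -->
    tI * Ex Q (fun w => wsum I v (clipped I w) ^+ 2) by move=> fv; exact: tail_moment_cvg.
by apply: cvgD; [|apply: cvgD]; (apply: cvgM; [exact: cvg_cst|exact: cv]).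
Qed.

Definition limit_form (v : 'rV[R]_d) := Ex Q (fun w => wsum I v (clipped I w) ^+ 2).

Lemma wsum_sqr (v : 'rV[R]_d) y : wsum I v y ^+ 2 =
  \sum_(i in I) \sum_(j in I) v 0 i * v 0 j * (y i * y j).
Proof.
rewrite expr2 /wsum mulr_suml; apply: eq_bigr => i _; rewrite mulr_sumr.
by apply: eq_bigr => j _; ring.
Qed.

Lemma limit_formE v : limit_form v =
  \sum_(i in I) \sum_(j in I) v 0 i * v 0 j * limit_moment i j.
Proof.
rewrite /limit_form; under eq_Rintegral do rewrite wsum_sqr.
have bc i j : bmf (fun w => clipped I w i * clipped I w j) by apply: bmfM; exact: bmf_clipped.
rewrite Ex_sum; last by move=> i; apply: bmf_sum => j; exact: bmfZ.
apply: eq_bigr => i _; rewrite Ex_sum; last by move=> j; exact: bmfZ.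
by apply: eq_bigr => j _; rewrite ExZ.
Qed.

Lemma continuous_limit_form : continuous (limit_form : 'rV[R]_d -> R^o).
Proof.
rewrite (_ : limit_form = fun v => \sum_(i in I) \sum_(j in I) v 0 i * v 0 j * limit_moment i j);
  last by apply/funext => v; rewrite limit_formE.
move=> v.
apply: (@cvg_sumr R 'rV[R]_d _ (nbhs v) _ _ _
  (fun i (v : 'rV[R]_d) => \sum_(j in I) v 0 i * v 0 j * limit_moment i j)) => i _.
apply: (@cvg_sumr R 'rV[R]_d _ (nbhs v) _ _ _
  (fun j (v : 'rV[R]_d) => v 0 i * v 0 j * limit_moment i j)) => j _.
apply: cvgM; last exact: cvg_cst.
by apply: cvgM; exact: continuous_coord.
Qed.

Lemma expectation_dotv_sqr v : face I v ->
  'E_Q[(fun w => dotv v (ThetaI I w) ^+ 2)%R]%E = (limit_form v)%:E.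
Proof.
move=> [_ vI]; apply: ae_expectation.
- by apply: measurable_funX; exact: measurable_dotv.
- by apply: bmfX; exact: bmf_wsum_clipped.
- by apply: filterS (ae_dotv I0 vI) => w ->.
Qed.

Lemma limit_form_midpoint v w : limit_form (2^-1 *: (v + w)) =
  (limit_form v + limit_form w) / 2 - limit_form (v - w) / 4.
Proof.
have bq z : bmf (fun w => wsum I z (clipped I w) ^+ 2).
  by apply: bmfX; exact: bmf_wsum_clipped.
rewrite /limit_form -ExD// ![_ / _]mulrC -!ExZ//; last exact: bmfD.
rewrite -ExB; [|by apply: bmfZ; exact: bmfD|exact: bmfZ].
by apply: eq_Rintegral => x _; rewrite wsum_midpoint parallelogram wsumB ![_^-1 * _]mulrC.
Qed.

Lemma limit_formZ c v : limit_form (c *: v) = c ^+ 2 * limit_form v.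
Proof.
rewrite !limit_formE mulr_sumr; apply: eq_bigr => i _; rewrite mulr_sumr.
by apply: eq_bigr => j _; rewrite !mxE; ring.
Qed.

Hypothesis cpd : cond_pos_def (VI Q I (ThetaI I)).

Lemma VIE k l : VI Q I (ThetaI I) k l = limit_moment (enum_val k) (enum_val l).
Proof.
rewrite mxE /limit_moment (_ : 'E_Q[_]%E =
  (Ex Q (fun w => clipped I w (enum_val k) * clipped I w (enum_val l)))%:E)//.
apply: ae_expectation.
- by apply: measurable_funM; exact: mThetaI_coord.
- by apply: bmfM; exact: bmf_clipped.
have := tilted_ae_itv mTheta spec (mThetaI I) (tilt I0) (sv_orthant spec).
by apply: filterS => w hw; rewrite /clipped !clip01_id// hw// enum_valP.
Qed.

Lemma limit_form_gt0 (w : 'rV[R]_d) : (forall i, i \notin I -> w 0 i = 0) ->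
  \sum_i w 0 i = 0 -> w != 0 -> 0 < limit_form w.
Proof.
move=> wI w0 wn0; pose c : 'cV[R]_#|I| := \col_k w 0 (enum_val k).
have c_sum : \sum_k c k 0 = 0.
  transitivity (\sum_(i in I) w 0 i).
    rewrite [RHS]big_enum_val.
    by apply: eq_bigr => k _; rewrite mxE.
  rewrite -[RHS]w0 [LHS]big_mkcond; apply: eq_bigr => i _.
  by case: ifPn => // /wI.
have cn0 : c != 0.
  apply: contra_neq wn0 => c0; apply/rowP => i; rewrite mxE.
  have [iI|iI] := boolP (i \in I); last exact: wI.
  by have /colP/(_ (enum_rank_in iI i)) := c0; rewrite !mxE enum_rankK_in.
suff -> : limit_form w = (c^T *m VI Q I (ThetaI I) *m c) 0 0 by exact: cpd.
rewrite limit_formE (big_enum_val (fun i => \sum_(j in I) w 0 i * w 0 j * limit_moment i j)).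
under eq_bigr do rewrite big_enum_val.
rewrite mxE exchange_big; apply: eq_bigr => l _.
rewrite mxE mulr_suml; apply: eq_bigr => k _.
by rewrite VIE !mxE; ring.
Qed.

Context (vstar : 'rV[R]_d) (vhat : nat -> T -> 'rV[R]_d).
Hypothesis fstar : face I vstar.
Hypothesis minstar : forall v, face I v -> limit_form vstar <= limit_form v.
Hypothesis hvhat : forall n w, is_vhat X n (u n) I w (vhat n w).

Let fhat n w : face I (vhat n w). Proof. exact: vhat_face (hvhat n w). Qed.

Definition scaled_pair n i j w : R := \sum_(l < n) (a (u n) / n%:R) *
  (coord_ratio I (X l w) i * coord_ratio I (X l w) j * exceed (u n) I (X l w)).

Definition scaled_mass n w : R := \sum_(l < n) (a (u n) / n%:R) *
  (1 * exceed (u n) I (X l w)).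

Definition fluctuation n i w : R := \sum_(l < n) (sk n)^-1 *
  ((coord_ratio I (X l w) i - tI^-1) * exceed (u n) I (X l w)).

Let vout v : face I v -> forall i, i \notin I -> v 0 i = 0.
Proof. by case. Qed.

Lemma Mhat2_scaled n w v : face I v -> a (u n) * Mhat X n (u n) I v 2 w =
  \sum_(i in I) \sum_(j in I) v 0 i * v 0 j * scaled_pair n i j w.
Proof.
move=> fv; rewrite MhatE//; last exact: vout.
rewrite mulrA mulr_sumr; under eq_bigr do rewrite wsum_sqr mulr_suml mulr_sumr.
rewrite exchange_big; apply: eq_bigr => i _.
under eq_bigr do rewrite mulr_suml mulr_sumr.
rewrite exchange_big; apply: eq_bigr => j _.
by rewrite mulr_sumr; apply: eq_bigr => l _; ring.
Qed.

(** The products [v_i v_j] of weights of a face sum to one. *)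
Lemma scaled_form_close n w v delta : face I v ->
  (forall i j, i \in I -> j \in I ->
    `|scaled_pair n i j w - tI * limit_moment i j| <= delta) ->
  `|a (u n) * Mhat X n (u n) I v 2 w - tI * limit_form v| <= delta.
Proof.
move=> fv h; rewrite Mhat2_scaled// limit_formE mulr_sumr -sumrB.
rewrite (le_trans (ler_norm_sum _ _ _))//.
have -> : delta = \sum_(i in I) \sum_(j in I) v 0 i * v 0 j * delta.
  under eq_bigr do rewrite -mulr_suml -mulr_sumr (face_sum fv) mulr1.
  by rewrite -mulr_suml face_sum// mul1r.
apply: ler_sum => i iI; rewrite mulr_sumr -sumrB (le_trans (ler_norm_sum _ _ _))//.
have vv j : 0 <= v 0 i * v 0 j by rewrite mulr_ge0//; exact: (face_ge0 _ fv).
apply: ler_sum => j jI; rewrite mulrCA -mulrBr normrM (ger0_norm (vv j)).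
by rewrite ler_wpM2l//; exact: h.
Qed.

(** The empirical and the limiting forms are uniformly close on the face, so the
    empirical minimizer nearly minimizes the limiting form; quadratic growth around
    [vstar] then locates it. *)
Lemma vhat_close n w delta : 0 < a (u n) -> 0 <= delta ->
  (forall i j, i \in I -> j \in I ->
    `|scaled_pair n i j w - tI * limit_moment i j| <= delta) ->
  limit_form (vhat n w - vstar) <= 4 * delta.
Proof.
move=> a0 d0 h.
have h1 := quadratic_growth limit_form_midpoint fstar minstar (fhat n w).
have := scaled_form_close (fhat n w) h; rewrite ler_norml => /andP[h2 _].
have := scaled_form_close fstar h; rewrite ler_norml => /andP[_ h3].
have := vhat_minimizer oX (hvhat n w) fstar; rewrite -(ler_pM2l a0) => h4.
have h5 : 0 <= limit_form (vhat n w) - limit_form vstar by rewrite subr_ge0 minstar.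
have h6 : limit_form (vhat n w) - limit_form vstar <=
    tI * (limit_form (vhat n w) - limit_form vstar) by rewrite ler_peMl// tauI_ge1.
rewrite mulrBr in h6; lra.
Qed.

Lemma fluctuation_sum v n w : face I v ->
  \sum_(i in I) v 0 i * fluctuation n i w =
  \sum_(l < n) (sk n)^-1 * ((wsum I v (coord_ratio I (X l w)) - tI^-1) * exceed (u n) I (X l w)).
Proof.
move=> fv; under eq_bigr do rewrite /fluctuation mulr_sumr.
rewrite exchange_big; apply: eq_bigr => l _.
rewrite -{2}(wsum_cst tI^-1 fv) /wsum -sumrB mulr_suml mulr_sumr.
by apply: eq_bigr => i _; ring.
Qed.

(** Since the weights of a face sum to one, the estimator is linear in them. *)
Lemma estimator_linear n w : (0 < n)%N -> 0 < a (u n) -> 0 < scaled_mass n w ->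
  sk n * (inv_tauMK X n (u n) I (vhat n) w - tI^-1) =
  (\sum_(i in I) vhat n w 0 i * fluctuation n i w) / scaled_mass n w.
Proof.
move=> n0 a0 m0; rewrite fluctuation_sum// /inv_tauMK MhatE//; last exact: (vout (fhat n w)).
have nR : n%:R != 0 :> R by rewrite pnatr_eq0 -lt0n.
have k0 : 0 < n%:R / a (u n) by rewrite divr_gt0// ltr0n.
have s0 : sk n != 0 by rewrite sqrtr_eq0 -ltNge.
have sE : sk n ^+ 2 = n%:R / a (u n) by rewrite sqr_sqrtr// ltW.
move: (sk n) s0 sE => s s0 sE.
pose E := \sum_(l < n) exceed (u n) I (X l w).
have mE : scaled_mass n w = a (u n) / n%:R * E.
  by rewrite /scaled_mass -mulr_sumr; congr (_ * _); apply: eq_bigr => l _; rewrite mul1r.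
have E0 : E != 0 by apply: contraTneq m0 => e0; rewrite mE e0 mulr0 ltxx.
have an0 : a (u n) != 0 by rewrite gt_eqF.
rewrite mE (_ : Phat X n (u n) I w = n%:R^-1 * E)//.
rewrite -mulr_sumr; under [X in _ = _ * X / _]eq_bigr do rewrite mulrBl.
rewrite sumrB -mulr_sumr -/E; under eq_bigr do rewrite expr1.
set D := \sum_(l < n) _.
have -> : s^-1 = s / (n%:R / a (u n)).
  by rewrite -sE expr2 invfM mulrA mulfV ?mul1r.
by field; rewrite nR an0 E0 gt_eqF// (lt_le_trans _ tauI_ge1).
Qed.

(** The weights are replaced first, then the normalizing mass. The mass is at least
    [1 / 2] since its limit is at least one. *)
Lemma plugin_difference (p eta delta : R) (vh : 'rV[R]_d) (W : 'I_d -> R) :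
  `|p - tI| <= delta -> delta <= 2^-1 -> (forall i, `|vh 0 i - vstar 0 i| <= eta) ->
  `|(\sum_(i in I) vh 0 i * W i) / p - (\sum_(i in I) vstar 0 i * W i) / tI| <=
  (2 * eta + 2 * delta) * \sum_(i in I) `|W i|.
Proof.
move=> pd d2 veta; have t1 := tauI_ge1.
have p2 : 2^-1 <= p by move: pd; rewrite ler_norml => /andP[]; lra.
have p0 : 0 < p by rewrite (lt_le_trans _ p2).
rewrite !mulr_suml -sumrB mulr_sumr (le_trans (ler_norm_sum _ _ _))//.
apply: ler_sum => i iI.
have e0 : 0 <= eta by rewrite (le_trans _ (veta i)).
have d0 : 0 <= delta by rewrite (le_trans _ pd).
rewrite (_ : _ - _ = ((vh 0 i - vstar 0 i) / p + vstar 0 i * ((tI - p) / (p * tI))) * W i);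
  last by field; rewrite !gt_eqF.
rewrite normrM ler_wpM2r// (le_trans (ler_normD _ _))// lerD//.
  rewrite normrM normfV (gtr0_norm p0) mulrC ler_pM ?invr_ge0 ?(ltW p0)//.
  by rewrite -[leRHS]invrK lef_pV2 ?posrE// invr_gt0.
rewrite normrM (ger0_norm (face_ge0 i fstar)).
rewrite (le_trans (y := `|(tI - p) / (p * tI)|))//.
  by rewrite ler_piMl//; exact: face_le1 fstar.
rewrite normrM normfV distrC mulrC ler_pM ?invr_ge0//.
rewrite -[leRHS]invrK lef_pV2 ?posrE ?invr_gt0// ?normr_gt0 ?mulf_neq0 ?gt_eqF//.
by rewrite ger0_norm ?mulr_ge0 ?(ltW p0) ?(ltW tI_gt0)// (le_trans p2)// ler_peMr// ltW.
Qed.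

Let bwsum (v : 'rV[R]_d) : bmf (fun x => wsum I v (coord_ratio I x) - tI^-1).
Proof. by apply: bmfB; [exact: bmf_wsum_ratio|exact: bmf_cst]. Qed.

Let tI0 : tI != 0. Proof. by rewrite gt_eqF. Qed.

Let sk_scale n : 0 < a (u n) -> (0 < n)%N -> n%:R * (sk n)^-1 = sk n * a (u n).
Proof.
move=> a0 n0; have k0 : 0 < n%:R / a (u n) by rewrite divr_gt0// ltr0n.
have s0 : sk n != 0 by rewrite sqrtr_eq0 -ltNge.
have nE : n%:R = sk n ^+ 2 * a (u n) by rewrite sqr_sqrtr ?ltW// divfK// gt_eqF.
by move: (sk n) s0 nE => s s0 ->; field.
Qed.

(** The bias condition cancels the drift since the limiting mean is [tI^-1] for
    every direction of the face. *)
Lemma drift_cvg0 v : face I v ->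
  n%:R * ((sk n)^-1 * tail_moment n I (fun y => wsum I v y - tI^-1)) @[n --> \oo] --> (0 : R).
Proof.
move=> fv; apply: norm_cvg0.
have h1 := bias (isT : (1 <= 2)%N) I0 fv.
have h0 := bias (isT : (0 <= 2)%N) I0 fv.
have h : sk n * `|a (u n) * tail_moment n I (fun y => wsum I v y ^+ 1) -
      tI * Ex Q (fun w => wsum I v (clipped I w) ^+ 1)| + tI^-1 *
    (sk n * `|a (u n) * tail_moment n I (fun y => wsum I v y ^+ 0) -
      tI * Ex Q (fun w => wsum I v (clipped I w) ^+ 0)|) @[n --> \oo] --> (0 : R).
  rewrite (_ : 0 = 0 + tI^-1 * 0); last by rewrite mulr0 addr0.
  by apply: cvgD => //; apply: cvgM => //; exact: cvg_cst.
apply: (nonneg_cvg0 _ h); near=> n; rewrite normr_ge0/=.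
have a0 : 0 < a (u n) by near: n; exact: near_a_pos.
have n0 : (0 < n)%N by near: n; exact: nbhs_infty_gt.
rewrite mulrA sk_scale// -mulrA normrM (ger0_norm (sqrtr_ge0 _)).
rewrite (mulrCA tI^-1) -mulrDr ler_wpM2l//.
have e1 : Ex Q (fun w => wsum I v (clipped I w) ^+ 1) = tI^-1 by exact: wsum_mean.
have e0 : Ex Q (fun w => wsum I v (clipped I w) ^+ 0) = 1 by exact: (Ex_cst Q 1).
have m1 : tail_moment n I (fun y => wsum I v y - tI^-1) =
    tail_moment n I (fun y => wsum I v y ^+ 1) +
    (- tI^-1) * tail_moment n I (fun y => wsum I v y ^+ 0).
  rewrite -tail_momentZ//; rewrite -tail_momentD//.
  - by congr (tail_moment _ _ _); apply/funext => y; rewrite expr1 expr0 mulr1.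
  - exact: bmf_wsum_ratio.
  - by apply: bmfZ.
rewrite m1 e1 e0 mulr1 -[X in X * `| _ - tI|]gtr0_norm ?invr_gt0// -normrM.
apply: le_trans (ler_normB _ _); rewrite le_eqVlt; apply/orP; left; apply/eqP.
by congr (`|_|); rewrite mulfV// mulrBr mulVf//; ring.
Unshelve. all: by end_near. Qed.

Let bfluct i : i \in I -> bmf (fun x => coord_ratio I x i - tI^-1).
Proof. by move=> iI; apply: bmfB; [exact: bmf_ratio|exact: bmf_cst]. Qed.

Let dev01 t : 0 <= t <= 1 -> `|t - tI^-1| <= 1.
Proof.
move=> /andP[t0 t1]; have h1 : 0 < tI^-1 by rewrite invr_gt0.
have h2 : tI^-1 <= 1 by rewrite invf_le1// tauI_ge1.
by rewrite ler_norml; apply/andP; split; lra.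
Qed.

Let sk_sqr_scale n : 0 < a (u n) -> (0 < n)%N -> n%:R * (sk n)^-1 ^+ 2 = a (u n).
Proof.
move=> a0 n0; have k0 : 0 < n%:R / a (u n) by rewrite divr_gt0// ltr0n.
rewrite exprVn sqr_sqrtr ?ltW// invf_div mulrCA mulfV ?mulr1// pnatr_eq0 -lt0n//.
Qed.

(** The variance is at most [n / k = a (u n)] times the exceedance probability,
    which tends to [tI], and the mean vanishes by [drift_cvg0]. *)
Lemma fluctuation_sqr_le i : i \in I ->
  \forall n \near \oo, Ex P (fun w => fluctuation n i w ^+ 2) <= tI + 2.
Proof.
move=> iI; have fi := face_delta iI : face I (delta_mx 0 i : 'rV[R]_d).
have /cvgr0Pnorm_le /(_ _ ltr01) hd := drift_cvg0 fi.
have /cvgrPdist_le /(_ _ ltr01) hm := tail_cvg I0.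
near=> n.
have a0 : 0 < a (u n) by near: n; exact: near_a_pos.
have n0 : (0 < n)%N by near: n; exact: nbhs_infty_gt.
have : `|n%:R * ((sk n)^-1 * tail_moment n I (fun y => wsum I (delta_mx 0 i) y - tI^-1))| <= 1.
  by near: n.
have : `|tI - a (u n) * tail_moment n I (fun=> 1)| <= 1 by near: n.
rewrite ler_norml => /andP[h1 _] h2.
pose h x := (sk n)^-1 * ((coord_ratio I x i - tI^-1) * exceed (u n) I x).
have bt := bmf_tail (f := fun y => y i - tI^-1) (bfluct iI) n.
have bh : bmf h by exact: bmfZ.
have := iid_sum_sqr_le mX iX mXs hid n 0 bh.
under eq_Rintegral do rewrite subr0.
move/le_trans; apply; rewrite subr0 (_ : tI + 2 = (tI + 1) + 1); last by ring.
apply: lerD.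
  apply: (@le_trans _ _ (a (u n) * tail_moment n I (fun=> 1))); last by lra.
  rewrite -(sk_sqr_scale a0 n0) -mulrA ler_wpM2l// -(ExZ P _ (bexc n)).
  apply: Ex_le; [exact: (bmfX 2 (bmf_comp bh mXs))|exact: (bmfZ _ (bexc n))|].
  move=> w; rewrite /h exprMn ler_wpM2l ?sqr_ge0// exprMn exceed_sqr mul1r.
  rewrite ler_piMl//.
  by rewrite -[leLHS]real_normK ?num_real// expr_le1// dev01// ratio_itv.
rewrite -[leLHS]real_normK ?num_real// expr_le1//.
suff -> : Ex P (fun w => h (Xs w)) = (sk n)^-1 *
  tail_moment n I (fun y => wsum I (delta_mx 0 i) y - tI^-1) by [].
have bd := bmf_tail (f := fun y => wsum I (delta_mx 0 i) y - tI^-1) (bwsum _) n.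
rewrite /tail_moment -(ExZ P _ (bmf_comp bd mXs)).
by apply: eq_Rintegral => w _; rewrite /h wsum_delta.
Unshelve. all: by end_near. Qed.

Lemma centered_second_moment v : face I v ->
  Ex Q (fun w => (wsum I v (clipped I w) - tI^-1) ^+ 2) = limit_form v - tI^-1 ^+ 2.
Proof.
move=> fv; have bw := bmf_wsum_clipped I v.
transitivity (Ex Q (fun w => wsum I v (clipped I w) ^+ 2 -
    (2 * tI^-1) * wsum I v (clipped I w)) + tI^-1 ^+ 2).
  rewrite -[X in _ + X](Ex_cst Q) -ExD//; last exact: bmf_cst.
    by apply: eq_Rintegral => w _; ring.
  by apply: bmfB; [exact: bmfX|exact: bmfZ].
rewrite ExB; [|exact: bmfX|exact: bmfZ].
by rewrite (ExZ Q _ bw) wsum_mean// -/(limit_form v); ring.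
Qed.

Lemma variance_dotv v : face I v ->
  fine 'V_Q[fun w => dotv v (ThetaI I w)]%E = limit_form v - tI^-1 ^+ 2.
Proof.
move=> fv; have bw := bmf_wsum_clipped I v; have md := measurable_dotv I v.
have eqd := ae_dotv I0 (vout fv); rewrite /variance covariance.unlock.
rewrite (ae_expectation md bw eqd) wsum_mean//= -centered_second_moment//.
have mB : measurable_fun setT (fun w => dotv v (ThetaI I w) - tI^-1).
  by apply: measurable_funB => //; exact: measurable_cst.
rewrite (@ae_expectation _ _ _ Q _ (fun w => (wsum I v (clipped I w) - tI^-1) ^+ 2))//.
- exact: measurable_funM.
- by apply: bmfX; apply: bmfB => //; exact: bmf_cst.
- by apply: filterS eqd => w /= <-.
Qed.

Definition limit_variance := tI^-1 * (limit_form vstar - tI^-1 ^+ 2).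

Lemma limit_variance_ge0 : 0 <= limit_variance.
Proof.
apply: mulr_ge0; first by rewrite invr_ge0 ltW.
by rewrite -centered_second_moment//; apply: Ex_ge0 => w; exact: sqr_ge0.
Qed.

Definition clt_summand n x : R := tI^-1 * ((sk n)^-1 *
  ((wsum I vstar (coord_ratio I x) - tI^-1) * exceed (u n) I x)).

Let bmf_clt_summand n : bmf (clt_summand n).
Proof.
apply: bmfZ; apply: bmfZ.
exact: (bmf_tail (f := fun y => wsum I vstar y - tI^-1) (bwsum vstar) n).
Qed.

(** The summands are bounded by [k ^ (- 1 / 2)], and the bias condition provides
    the limits of their first two moments. *)
Lemma clt_sum_cvg (g : R -> R) K : continuous g -> (forall x, K < `|x| -> g x = 0) ->
  Ex P (fun w => g (\sum_(l < n) clt_summand n (X l w))) @[n --> \oo] -->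
  Ex (gaussian 0 limit_variance) (g : measurableTypeR R -> R).
Proof.
have bt n := bmf_tail (f := fun y => wsum I vstar y - tI^-1) (bwsum vstar) n.
apply: (iid_array_clt mX mXs iX hid bmf_clt_summand (e := fun n => (sk n)^-1)).
- move=> n x; rewrite /clt_summand !normrM (ger0_norm (x := tI^-1)) ?invr_ge0 ?(ltW tI_gt0)//.
  rewrite mulrCA normfV (ger0_norm (sqrtr_ge0 _)) ler_piMr ?invr_ge0//.
  have h2 : tI^-1 <= 1 by rewrite invf_le1// tauI_ge1.
  have /andP[x0 x1] := exceed_itv I (u n) x.
  rewrite mulr_ile1 ?invr_ge0 ?(ltW tI_gt0) ?mulr_ge0//.
  rewrite mulr_ile1 ?(ger0_norm x0)//.
  by apply: dev01; apply: wsum_itv => // i iI; exact: ratio_itv.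
- apply/(gtr0_cvgV0 _).2; last exact: sk_oo.
  by apply: filterS near_k_pos => n; rewrite sqrtr_gt0.
- exact: limit_variance_ge0.
- have bw2 : bmf (fun x => wsum I vstar (coord_ratio I x) ^+ 2).
    by apply: bmfX; exact: bmf_wsum_ratio.
  have bw1 : bmf (fun x => wsum I vstar (coord_ratio I x) ^+ 1).
    by apply: bmfX; exact: bmf_wsum_ratio.
  have c2 := tail_moment_cvg (isT : (2 <= 2)%N) I0 fstar.
  have c1 := tail_moment_cvg (isT : (1 <= 2)%N) I0 fstar.
  have c0 := tail_cvg I0.
  have e1 : Ex Q (fun w => wsum I vstar (clipped I w) ^+ 1) = tI^-1 by exact: wsum_mean.
  rewrite e1 mulfV// in c1.
  rewrite (_ : limit_variance = tI^-1 ^+ 2 * (tI * limit_form vstar +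
     (- (2 * tI^-1) * 1 + tI^-1 ^+ 2 * tI))); last by rewrite /limit_variance; field.
  have H : tI^-1 ^+ 2 * (a (u n) * tail_moment n I (fun y => wsum I vstar y ^+ 2) +
      (- (2 * tI^-1) * (a (u n) * tail_moment n I (fun y => wsum I vstar y ^+ 1)) +
       tI^-1 ^+ 2 * (a (u n) * tail_moment n I (fun=> 1)))) @[n --> \oo] -->
     tI^-1 ^+ 2 * (tI * limit_form vstar + (- (2 * tI^-1) * 1 + tI^-1 ^+ 2 * tI)).
    apply: cvgM; first exact: cvg_cst.
    apply: cvgD => //; apply: cvgD; apply: cvgM => //; exact: cvg_cst.
  apply: (cvg_trans _ H); apply: near_eq_cvg; near=> n.
  have a0 : 0 < a (u n) by near: n; exact: near_a_pos.
  have n0 : (0 < n)%N by near: n; exact: nbhs_infty_gt.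
  have -> : Ex P (fun w => clt_summand n (Xs w) ^+ 2) = (tI^-1 * (sk n)^-1) ^+ 2 *
      tail_moment n I (fun y => wsum I vstar y ^+ 2 +
        (- (2 * tI^-1) * wsum I vstar y ^+ 1 + tI^-1 ^+ 2 * 1)).
    rewrite -ExZ; last first.
      apply: (bmf_comp (bmf_tail (f := fun y => wsum I vstar y ^+ 2 +
        (- (2 * tI^-1) * wsum I vstar y ^+ 1 + tI^-1 ^+ 2 * 1)) _ n) mXs).
      by apply: bmfD => //; apply: bmfD; exact: bmfZ.
    apply: eq_Rintegral => w _; rewrite /clt_summand !exprMn exceed_sqr; ring.
  rewrite (_ : n%:R * (_ * _) = tI^-1 ^+ 2 * (n%:R * (sk n)^-1 ^+ 2 *
      tail_moment n I (fun y => wsum I vstar y ^+ 2 +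
        (- (2 * tI^-1) * wsum I vstar y ^+ 1 + tI^-1 ^+ 2 * 1)))); last first.
    by rewrite exprMn; move: (sk n) (tail_moment _ _ _) => s m; ring.
  rewrite (sk_sqr_scale a0 n0) tail_momentD//; last by apply: bmfD; exact: bmfZ.
  by rewrite tail_momentD; [|exact: bmfZ|exact: bmfZ]; rewrite !tail_momentZ//; ring.
- have h := drift_cvg0 fstar.
  have H : tI^-1 * (n%:R * ((sk n)^-1 * tail_moment n I (fun y => wsum I vstar y - tI^-1)))
      @[n --> \oo] --> (0 : R).
    by rewrite -(mulr0 tI^-1); apply: cvgM => //; exact: cvg_cst.
  apply: (cvg_trans _ H); apply: near_eq_cvg; near=> n.
  rewrite mulrCA; congr (_ * _); rewrite /tail_moment.
  rewrite -(ExZ P _ (bmf_comp (bt n) mXs)) -(ExZ P _ (bmfZ _ (bmf_comp (bt n) mXs))).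
  by [].
Unshelve. all: by end_near. Qed.

Lemma clt_sumE n w : \sum_(l < n) clt_summand n (X l w) =
  (\sum_(i in I) vstar 0 i * fluctuation n i w) / tI.
Proof. by rewrite fluctuation_sum// mulrC mulr_sumr. Qed.

(** A sum of squares, so that its mean is controlled by [tail_wlln] and the event
    that it is large by its mean. *)
Definition deviation n w := (scaled_mass n w - tI) ^+ 2 +
  \sum_(i in I) \sum_(j in I) (scaled_pair n i j w - tI * limit_moment i j) ^+ 2.

Let bmf_scaled n (f : ('I_d -> R) -> R) : bmf (fun x => f (coord_ratio I x)) ->
  bmf (fun w => \sum_(l < n) (a (u n) / n%:R) *
    (f (coord_ratio I (X l w)) * exceed (u n) I (X l w))).
Proof.
by move=> bf; apply: bmf_sum => l; apply: bmfZ; exact: (bmf_comp (bmf_tail bf n) (mX l)).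
Qed.

Let bmf_mass_sqr n : bmf (fun w => (scaled_mass n w - tI) ^+ 2).
Proof. by apply: bmfX; apply: bmfB; [exact: (bmf_scaled (f := fun=> 1) n b1)|exact: bmf_cst]. Qed.

Let bmf_pair_sqr n i j : i \in I -> j \in I ->
  bmf (fun w => (scaled_pair n i j w - tI * limit_moment i j) ^+ 2).
Proof.
move=> iI jI; apply: bmfX; apply: bmfB; last exact: bmf_cst.
exact: (bmf_scaled (f := fun y => y i * y j) n (bmf_pair iI jI)).
Qed.

Lemma bmf_deviation n : bmf (deviation n).
Proof.
apply: bmfD => //; apply: bmf_sum_cond => i iI; apply: bmf_sum_cond => j jI.
exact: bmf_pair_sqr.
Qed.

Lemma deviation_cvg0 : Ex P (deviation n) @[n --> \oo] --> (0 : R).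
Proof.
have bs n i : i \in I ->
    bmf (fun w => \sum_(j in I) (scaled_pair n i j w - tI * limit_moment i j) ^+ 2).
  by move=> iI; apply: bmf_sum_cond => j jI; exact: bmf_pair_sqr.
have E n : Ex P (deviation n) = Ex P (fun w => (scaled_mass n w - tI) ^+ 2) +
    \sum_(i in I) \sum_(j in I)
      Ex P (fun w => (scaled_pair n i j w - tI * limit_moment i j) ^+ 2).
  rewrite (ExD P (bmf_mass_sqr n) (bmf_sum_cond (bs n))) Ex_sum_cond; last exact: bs.
  congr (_ + _); apply: eq_bigr => i iI; apply: Ex_sum_cond => j jI; exact: bmf_pair_sqr.
suff H : Ex P (fun w => (scaled_mass n w - tI) ^+ 2) + \sum_(i in I) \sum_(j in I)
      Ex P (fun w => (scaled_pair n i j w - tI * limit_moment i j) ^+ 2) @[n --> \oo] -->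
    0 + \sum_(i in I) \sum_(j in I) (0 : R).
  move: H; rewrite add0r [X in _ --> X]big1 => [|i _]; last by rewrite big1.
  by move=> H; apply: (cvg_trans _ H); apply: near_eq_cvg; apply: nearW => n; rewrite E.
apply: cvgD.
  apply: (tail_wlln (f := fun=> 1) b1); last exact: tail_cvg.
  by move=> x; rewrite normr1.
apply: cvg_sumr => i iI; apply: cvg_sumr => j jI.
apply: (tail_wlln (f := fun y => y i * y j) (bmf_pair iI jI)); last exact: tail_pair_cvg.
move=> x; have /andP[x0 x1] := ratio_itv x iI; have /andP[y0 y1] := ratio_itv x jI.
by rewrite normrM !ger0_norm// mulr_ile1.
Qed.

Lemma deviation_ge n w :
  (scaled_mass n w - tI) ^+ 2 <= deviation n w /\
  forall i j, i \in I -> j \in I ->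
    (scaled_pair n i j w - tI * limit_moment i j) ^+ 2 <= deviation n w.
Proof.
have s0 (i j : 'I_d) : 0 <= (scaled_pair n i j w - tI * limit_moment i j) ^+ 2 by exact: sqr_ge0.
split; first by rewrite lerDl; apply: sumr_ge0 => i _; apply: sumr_ge0.
move=> i j iI jI; rewrite /deviation (bigD1 i iI)/= (bigD1 j jI)/=.
rewrite addrCA -!addrA lerDl !addr_ge0 ?sqr_ge0//; first exact: sumr_ge0.
by apply: sumr_ge0 => k _; apply: sumr_ge0.
Qed.

Definition estimation_error n w :=
  sk n * (inv_tauMK X n (u n) I (vhat n) w - tI^-1).

Definition clt_sum n w := \sum_(l < n) clt_summand n (X l w).

(** When the empirical masses are close to their limits, the weights are close to
    the optimal ones and the estimation error is close to the sum to which the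
    central limit theorem applies; otherwise the deviation is large. *)
Lemma test_difference (g : R -> R) (M C e eta delta : R) n w :
  0 < a (u n) -> (0 < n)%N -> (forall x, `|g x| <= M) ->
  0 <= e -> 0 <= C -> (forall x y, `|g x - g y| <= e + C * `|x - y|) ->
  0 < delta -> delta <= 2^-1 -> 0 <= eta ->
  (forall v, face I v -> limit_form (v - vstar) <= 4 * delta ->
     forall i, `|v 0 i - vstar 0 i| <= eta) ->
  `|g (estimation_error n w) - g (clt_sum n w)| <=
    (e + C * ((2 * eta + 2 * delta) * \sum_(i in I) (1 + fluctuation n i w ^+ 2))) +
    2 * M / delta ^+ 2 * deviation n w.
Proof.
move=> a0 n0 gM e0 C0 hg d0 d2 eta0 hv.
have M0 : 0 <= M by rewrite (le_trans _ (gM 0)).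
have [dev1 dev2] := deviation_ge n w.
have dev0 : 0 <= deviation n w by rewrite (le_trans _ dev1)// sqr_ge0.
have c0 : 0 <= 2 * eta + 2 * delta by rewrite addr_ge0// mulr_ge0// ltW.
have S0 : 0 <= \sum_(i in I) (1 + fluctuation n i w ^+ 2).
  by apply: sumr_ge0 => i _; rewrite addr_ge0// sqr_ge0.
have [dd|dd] := leP (deviation n w) (delta ^+ 2); last first.
  rewrite (le_trans (ler_normB _ _))//.
  apply: (@le_trans _ _ (2 * M)); first by rewrite mulr_natl mulr2n lerD.
  rewrite -[leLHS]add0r lerD//; first by rewrite addr_ge0// !mulr_ge0.
  rewrite -mulrA ler_peMr// ?mulr_ge0// mulrC ler_pdivlMr ?exprn_gt0// mul1r.
  exact: ltW.
have sq x : x ^+ 2 <= deviation n w -> `|x| <= delta.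
  move=> h; rewrite -(ger0_norm (ltW d0)) -ler_sqr ?nnegrE//.
  by rewrite !real_normK ?num_real// (le_trans h).
have mass := sq _ dev1.
have pairs i j (iI : i \in I) (jI : j \in I) := sq _ (dev2 i j iI jI).
have m0 : 0 < scaled_mass n w.
  by move: mass; have := tauI_ge1; rewrite ler_norml => ? /andP[]; lra.
have close := hv _ (fhat n w) (vhat_close a0 (ltW d0) pairs).
rewrite /estimation_error estimator_linear// /clt_sum clt_sumE.
rewrite -[leLHS]addr0 lerD//; last by rewrite !mulr_ge0// invr_ge0 exprn_ge0// ltW.
rewrite (le_trans (hg _ _))// lerD2l ler_wpM2l//.
rewrite (le_trans (plugin_difference _ mass d2 close))// ler_wpM2l//.
apply: ler_sum => i _; set x := fluctuation _ _ _.
by rewrite -[x ^+ 2]real_normK ?num_real//; have := sqr_ge0 (`|x| - 1); have := normr_ge0 x; nra.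
Qed.

Let bmf_fluctuation n i : i \in I -> bmf (fluctuation n i).
Proof.
move=> iI; apply: bmf_sum => l; apply: bmfZ.
exact: (bmf_comp (bmf_tail (f := fun y => y i - tI^-1) (bfluct iI) n) (mX l)).
Qed.

Lemma measurable_estimation_error n : measurable_fun setT (estimation_error n).
Proof.
apply: measurable_funM; first exact: measurable_cst.
apply: measurable_funB; last exact: measurable_cst.
exact: (measurable_inv_tauMK oX mX I0 (hvhat n)).
Qed.

(** The sum with the limiting weights and mass converges by [clt_sum_cvg]; the
    difference is controlled by the deviation, which vanishes in mean, and by the
    fluctuations, which are bounded in mean square. *)
Lemma estimation_error_cvg_test (g : R -> R) K : continuous g ->
  (forall x, K < `|x| -> g x = 0) ->
  Ex P (fun w => g (estimation_error n w)) @[n --> \oo] -->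
  Ex (gaussian 0 limit_variance) (g : measurableTypeR R -> R).
Proof.
move=> cg gK; have [M gM] := continuous_compact_support_bounded cg gK.
have M0 : 0 <= M by rewrite (le_trans _ (gM 0)).
have bg : bmf (g : measurableTypeR R -> R) := continuous_bmf cg gM.
have [l l0 hl] := coercive continuous_limit_form limit_formZ limit_form_gt0.
apply/cvgrPdist_le => eps eps0; have eps4 : 0 < eps / 4 by rewrite divr_gt0.
have [C C0 hC] := continuous_compact_support_modulus cg gK eps4.
pose N : R := \sum_(i in I) (1 + (tI + 2)).
have N0 : 0 <= N.
  by apply: sumr_ge0 => i _; rewrite addr_ge0// addr_ge0// ltW.
pose kappa := eps / 4 / (C * N + 1).
have CN : 0 < C * N + 1 by rewrite ltr_wpDl// mulr_ge0.
have kappa0 : 0 < kappa by rewrite divr_gt0.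
(* [eta] bounds the error on the weights; [delta] is small enough for [vhat_close]
   and [coercive] to imply this bound. *)
pose eta := kappa / 4; have eta0 : 0 < eta by rewrite divr_gt0.
pose delta := Num.min 2^-1 (Num.min (kappa / 4) (l * eta ^+ 2 / 4)).
have delta0 : 0 < delta.
  by rewrite !lt_min invr_gt0 ltr0n/= eta0/= divr_gt0// mulr_gt0// exprn_gt0.
have delta2 : delta <= 2^-1 by rewrite ge_min lexx.
have delta_kappa : delta <= kappa / 4 by rewrite !ge_min lexx orbT.
have delta_l : 4 * delta <= l * eta ^+ 2.
  have : delta <= l * eta ^+ 2 / 4 by rewrite !ge_min lexx !orbT.
  by lra.
have close v : face I v -> limit_form (v - vstar) <= 4 * delta ->
    forall i, `|v 0 i - vstar 0 i| <= eta.
  move=> fv hv i; have [[_ v1] vI] := fv; have [[_ s1] sI] := fstar.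
  have : l * `|v - vstar| ^+ 2 <= l * eta ^+ 2.
    apply: le_trans delta_l; apply: le_trans hv; apply: hl.
      by move=> j jI; rewrite !mxE vI// sI// subrr.
    by under eq_bigr do rewrite !mxE; rewrite sumrB v1 s1 subrr.
  rewrite ler_pM2l// ler_sqr ?nnegrE ?(ltW eta0)//; apply: le_trans.
  by have := coord_le_norm (v - vstar) i; rewrite !mxE.
pose D := 2 * M / delta ^+ 2.
have hD : D * Ex P (deviation n) @[n --> \oo] --> (0 : R).
  by rewrite -(mulr0 D); apply: cvgM; [exact: cvg_cst|exact: deviation_cvg0].
have /cvgr0Pnorm_le /(_ _ eps4) nearD := hD.
have /cvgrPdist_le /(_ _ eps4) nearS := clt_sum_cvg cg gK.
have nearW : \forall n \near \oo, forall i, i \in I ->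
    Ex P (fun w => fluctuation n i w ^+ 2) <= tI + 2.
  have H (i : 'I_d) : \forall n \near \oo, i \in I ->
      Ex P (fun w => fluctuation n i w ^+ 2) <= tI + 2.
    have [iI|iI] := boolP (i \in I); last by near=> n.
    by apply: filterS (fluctuation_sqr_le iI) => n h _.
  exact: filter_forall H.
near=> n.
have a0 : 0 < a (u n) by near: n; exact: near_a_pos.
have n0 : (0 < n)%N by near: n; exact: nbhs_infty_gt.
have hW : forall i, i \in I -> Ex P (fun w => fluctuation n i w ^+ 2) <= tI + 2 by near: n.
have hDn : `|D * Ex P (deviation n)| <= eps / 4 by near: n.
have hS : `|Ex (gaussian 0 limit_variance) (g : measurableTypeR R -> R) -
   Ex P (fun w => g (clt_sum n w))| <= eps / 4 by near: n.
pose F w := \sum_(i in I) (1 + fluctuation n i w ^+ 2).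
have bF1 i : i \in I -> bmf (fun w => 1 + fluctuation n i w ^+ 2).
  by move=> iI; apply: bmfD; [exact: bmf_cst|exact: bmfX 2 (bmf_fluctuation n iI)].
have bF : bmf F by exact: bmf_sum_cond.
have EF : Ex P F <= N.
  rewrite Ex_sum_cond//; apply: ler_sum => i iI.
  rewrite (ExD P (bmf_cst T 1) (bmfX 2 (bmf_fluctuation n iI))) Ex_cst lerD2l.
  exact: hW.
pose c := C * (2 * eta + 2 * delta).
pose B w := eps / 4 + c * F w + D * deviation n w.
have bB : bmf B.
  by apply: bmfD; [apply: bmfD; [exact: bmf_cst|exact: bmfZ]|apply: bmfZ; exact: bmf_deviation].
have EB : Ex P B <= eps / 4 + eps / 4 + eps / 4.
  rewrite /B (ExD P (bmfD (bmf_cst T (eps / 4)) (bmfZ c bF)) (bmfZ D (bmf_deviation n))).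
  rewrite (ExD P (bmf_cst T (eps / 4)) (bmfZ c bF)) Ex_cst !ExZ//; last exact: bmf_deviation.
  apply: lerD; last by rewrite (le_trans (ler_norm _)).
  rewrite lerD2l (@le_trans _ _ (C * kappa * N))//.
    apply: ler_pM => //.
    - by rewrite /c !mulr_ge0// addr_ge0// mulr_ge0// ltW.
    - by apply: Ex_ge0 => w; apply: sumr_ge0 => i _; rewrite addr_ge0// sqr_ge0.
    - rewrite /c ler_wpM2l// (_ : kappa = 2 * (kappa / 4) + 2 * (kappa / 4)); last by field.
      by rewrite lerD// ler_wpM2l.
  rewrite /kappa mulrAC mulrCA -[leRHS]mulr1 ler_wpM2l ?(ltW eps4)//.
  by rewrite -[leRHS](mulfV (lt0r_neq0 CN)) ler_wpM2r ?invr_ge0 ?(ltW CN)// lerDl.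
have hY : `|Ex P (fun w => g (estimation_error n w)) - Ex P (fun w => g (clt_sum n w))| <=
    Ex P B.
  apply: Ex_normB => //.
  - exact: (bmf_comp bg (measurable_estimation_error n)).
  - apply: (bmf_comp bg); apply: bmf_measurable; apply: bmf_sum => j.
    by apply: (bmf_comp (bmf_clt_summand n)).
  - move=> w; rewrite /B /c -(mulrA C).
    exact: (test_difference w a0 n0 gM (ltW eps4) C0 hC delta0 delta2 (ltW eta0) close).
rewrite distrC.
rewrite (_ : _ - _ = (Ex P (fun w => g (estimation_error n w)) - Ex P (fun w => g (clt_sum n w))) -
   (Ex (gaussian 0 limit_variance) (g : measurableTypeR R -> R) -
   Ex P (fun w => g (clt_sum n w)))); last by ring.
rewrite (le_trans (ler_normB _ _))//.
apply: (le_trans (lerD (le_trans hY EB) hS)); lra.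
Unshelve. all: by end_near. Qed.

Lemma estimation_error_cvg (f : R -> R) : continuous f -> (exists M, forall x, `|f x| <= M) ->
  Ex P (fun w => f (estimation_error n w)) @[n --> \oo] -->
  Ex (gaussian 0 limit_variance) (f : measurableTypeR R -> R).
Proof.
apply: (@cvg_test_bounded _ _ _ P _ _ (gaussian 0 limit_variance) estimation_error idfun).
- exact: measurable_estimation_error.
- exact: measurable_id.
- exact: estimation_error_cvg_test.
Qed.

End fixed_set.
End extremal_coefficients.

(** * Asymptotic normality *)
Theorem corollary16 (R : realType) (d : nat)
    (dT : measure_display) (T : measurableType dT) (P : probability T R)
    (dS : measure_display) (S : measurableType dS) (Q : probability S R)
    (Xstar : {RV P >-> 'rV[R]_d}) (X : nat -> {RV P >-> 'rV[R]_d})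
    (a : R -> R) (mu : {measure set 'rV[R]_d -> \bar R})
    (Theta : {RV Q >-> 'rV[R]_d})
    (ThetaI : {set 'I_d} -> {RV Q >-> 'rV[R]_d})
    (u : nat -> R) :
  (forall w, orthant (Xstar w)) ->
  (forall l w, orthant (X l w)) ->
  mutually_independent P (fun l => X l) ->
  (forall l, identically_distributed P (X l) Xstar) ->
  regularly_varying P Xstar a mu ->
  (forall i : 'I_d,
     ((a s)%:E * P [set w | (s < Xstar w 0 i)%R])%E @[s --> +oo] --> 1%E) ->
  spectral_vector mu Q Theta ->
  (forall I : {set 'I_d}, I != finset.set0 ->
     tilted_law Q I Theta (ThetaI I)) ->
  (forall I : {set 'I_d}, I != finset.set0 ->
     cond_pos_def (VI Q I (ThetaI I))) ->
  u n @[n --> \oo] --> +oo ->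
  n%:R / a (u n) @[n --> \oo] --> +oo ->
  (forall (p : nat) (J : {set 'I_d}), (p <= 2)%N -> J != finset.set0 ->
     ereal_sup
       [set ((Num.sqrt (n%:R / a (u n)))%:E *
             `| (a (u n))%:E * 'E_P[Mhat X n (u n) J (restrv J v) p]
                - (tauI mu J)%:E *
                  'E_Q[(fun w => dotv (restrv J v) (ThetaI J w) ^+ p)%R] |)%E
       | v in simplex] @[n --> \oo] --> 0%E) ->
  forall (I : {set 'I_d}) (vstar : 'rV[R]_d) (vhat : nat -> T -> 'rV[R]_d),
    I != finset.set0 ->
    is_minimizer (face I)
      (fun v => 'E_Q[(fun w => dotv v (ThetaI I w) ^+ 2)%R]%E) vstar ->
    (forall n w, is_vhat X n (u n) I w (vhat n w)) ->
    cvg_in_distribution P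
      (fun n w => Num.sqrt (n%:R / a (u n)) *
                  (inv_tauMK X n (u n) I (vhat n) w - (tauI mu I)^-1))
      (gaussian 0
         ((tauI mu I)^-1 * fine 'V_Q[fun w => dotv vstar (ThetaI I w)]%E)).
Proof.
move=> oXs oX iX hid rv normalized spec tilt cpd u_oo k_oo bias0 I vstar vhat I0.
move=> [fstar minstar] hvhat.
have mXs : measurable_fun setT Xstar := measurable_funPT _.
have mX l : measurable_fun setT (X l) := measurable_funPT _.
have mTheta : measurable_fun setT Theta := measurable_funPT _.
have mThetaI J : measurable_fun setT (ThetaI J) := measurable_funPT _.
have mu_fin : (mu [set x | (1 < `|x|)%R] < +oo)%E.
  apply: (rv_finite rv); last by exists 1 => // x /= /ltW.
  by apply: measurable_set_lt => //; exact: measurable_rV_norm.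
have min_form v : face I v ->
    limit_form Q ThetaI I vstar <= limit_form Q ThetaI I v.
  move=> fv; rewrite -lee_fin.
  have E := expectation_dotv_sqr mTheta mThetaI spec tilt I0.
  by rewrite -!E//; exact: minstar.
have mY := measurable_estimation_error a mu mX oX I0 hvhat.
split; first exact: mY.
move=> f cf [M fM].
have bf : bmf (f : measurableTypeR R -> R) := continuous_bmf cf fM.
rewrite (variance_dotv mXs mX mTheta mThetaI oXs oX hid mu_fin normalized
  spec tilt u_oo k_oo bias0 I0 fstar).
have H := estimation_error_cvg mXs mX mTheta mThetaI oXs oX hid (rv_pos rv) mu_fin normalized
  spec tilt u_oo k_oo bias0 I0 iX (cpd I I0) fstar min_form hvhat cf (ex_intro _ M fM).
rewrite -/(limit_variance Q mu ThetaI I vstar).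
have -> : (\int[gaussian 0 (limit_variance Q mu ThetaI I vstar)]_x (f x)%:E)%E =
    (Ex (gaussian 0 (limit_variance Q mu ThetaI I vstar)) (f : measurableTypeR R -> R))%:E.
  by rewrite -(bmf_expectation _ bf) unlock.
apply: cvg_EFin; last first.
  apply: (cvg_trans _ H); apply: near_eq_cvg; apply: nearW => n.
  by rewrite /= (bmf_expectation P (bmf_comp bf (mY n))).
by apply: nearW => n; rewrite /= (bmf_expectation P (bmf_comp bf (mY n))).
Qed.
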